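(* Let $d\ge 1$ and let $\{u_t(x) : t \geq 0, x \in \mathbb{R}\}$ be a random string process in $\mathbb{R}^d$. If $d < 6$, then for every $I \in \mathcal{A}$, almost surely, the string has local times $\{l(\mathbf{u}, I), \mathbf{u} \in \mathbb{R}^d\}$ on $I$, and $l(\mathbf{u}, I)$ admits the following $L^2$ representation: $$l(\mathbf{u}, I) = (2\pi)^{-d} \int_{\mathbb{R}^d} e^{-i\langle \mathbf{v}, \mathbf{u} \rangle} \int_I e^{i\langle \mathbf{v}, u_t(x) \rangle}\, dt\, dx\, d\mathbf{v}, \qquad \mathbf{u} \in \mathbb{R}^d.$$
   Context: Random string process: Let $(\Omega,\mathcal{F},(\mathcal{F}_t)_{t\ge 0},\mathbb{P})$ be a filtered probability space with $\mathcal{F}$ complete and $(\mathcal{F}_t)$ right continuous. Let $\dot W=(\dot W_1,\dots,\dot W_d)$ be an $\mathbb{R}^d$-valued space-time white noise on $[0,\infty)\times\mathbb{R}$: the components are independent, and each $W_j$ is a centered Gaussian family $\{W_j(f): f\in L^2([0,\infty)\times\mathbb{R})\}$ with $\mathbb{E}[W_j(f)W_j(g)]=\int_0^\infty\int_{\mathbb{R}} f(t,x)g(t,x)\,dx\,dt$; we write $W_j(f)=\int_0^\infty\int_{\mathbb{R}} f(t,x)\,W_j(dx\,dt)$. The noise is adapted to $(\mathcal{F}_t)$: $W(f)$ is $\mathcal{F}_t$-measurable if $f$ is supported on $[0,t]\times\mathbb{R}$ and independent of $\mathcal{F}_t$ if $f$ is supported on $[t,\infty)\times\mathbb{R}$.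 Let $G_t(x)=\frac{1}{\sqrt{4\pi t}}e^{-x^2/(4t)}$. For $\lambda>0$ let $\mathcal{E}_\lambda=\{f\in C(\mathbb{R},\mathbb{R}^d): |f(x)|e^{-\lambda|x|}\to 0 \text{ as } |x|\to\infty\}$ and $\mathcal{E}_{\exp}=\bigcup_{\lambda>0}\mathcal{E}_\lambda$. A random string process with values in $\mathbb{R}^d$ is a solution of $\frac{\partial u_t(x)}{\partial t}=\frac{\partial^2u_t(x)}{\partial x^2}+\dot W$, i.e. an $(\mathcal{F}_t)$-adapted, continuous random field $\{u_t(x): t\ge 0, x\in\mathbb{R}\}$ with values in $\mathbb{R}^d$ such that: (i) $u_0(\cdot)\in\mathcal{E}_{\exp}$ almost surely and $u_0$ is $\mathcal{F}_0$-measurable; (ii) for every $t>0$ there exists $\lambda>0$ such that $u_s(\cdot)\in\mathcal{E}_\lambda$ for all $s\le t$, almost surely; (iii) for every $t>0$ and $x\in\mathbb{R}$, $u_t(x)=\int_{\mathbb{R}}G_t(x-y)u_0(y)\,dy+\int_0^t\int_{\mathbb{R}} G_{t-r}(x-y)\,W(dy\,dr)$. $\mathcal{A}$ is the collection of all (bounded) rectangles in $[0,\infty)\times\mathbb{R}$ with sides parallel to the axes. Local times: for a Borel set $T\subseteq[0,\infty)\times\mathbb{R}$, the occupation measure of $u$ on $T$ is $\mu_T(B)=\lambda_2\{(t,x)\in T: u_t(x)\in B\}$ for Borel $B\subseteq\mathbb{R}^d$, where $\lambda_k$ is Lebesgue measure on $\mathbb{R}^k$. If $\mu_T$ is absolutely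 continuous with respect to $\lambda_d$, one says that $u$ has local times on $T$, and the local time is the Radon–Nikodym derivative $l(\mathbf{u},T)=\frac{d\mu_T}{d\lambda_d}(\mathbf{u})$. The ''$L^2$ representation'' means that $l(\cdot,I)\in L^2(\mathbb{R}^d)$ and the displayed equality holds as an inverse Fourier transform in the $L^2(\mathbb{R}^d)$ sense. *)

(* Defs.v *)
From HB Require Import structures.
From mathcomp Require Import all_boot all_order all_algebra.
From mathcomp Require Import complex.
From mathcomp Require Import all_classical all_reals all_analysis.

Set Implicit Arguments.
Unset Strict Implicit.
Unset Printing Implicit Defensive.

Import Order.TTheory GRing.Theory Num.Theory.
Import numFieldNormedType.Exports.

Local Open Scope classical_set_scope.
Local Open Scope ring_scope.
Local Open Scope complex_scope.

(* R^d is [d.-tuple R]: MathComp-Analysis equips it with the product of the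
   Borel sigma-algebras, that is, the Borel sigma-algebra of R^d. *)
Section lebesgue_tuple.
Context {R : realType}.

Definition tcons n (p : measurableTypeR R * n.-tuple R) : n.+1.-tuple R :=
  [tuple of (p.1 : R) :: p.2].

Lemma measurable_tcons n :
  measurable_fun [set: measurableTypeR R * n.-tuple R] (@tcons n).
Proof. exact: measurable_cons. Qed.

Definition tuncons n (t : n.+1.-tuple R) : measurableTypeR R * n.-tuple R :=
  (thead t, [tuple of behead t]).

Lemma measurable_tuncons n : measurable_fun [set: n.+1.-tuple R] (@tuncons n).
Proof.
apply/measurable_fun_pairP; split; last exact: measurable_behead.
exact: measurable_tnth.
Qed.

Lemma tconsK n : cancel (@tcons n) (@tuncons n).
Proof. by move=> [x t]; congr pair; apply/val_inj. Qed.

Section cons_measure.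
Variables (n : nat) (m : {sigma_finite_measure set (n.-tuple R) -> \bar R}).

Definition cons_measure : set (n.+1.-tuple R) -> \bar R :=
  pushforward (@lebesgue_measure R \x m)%E (@tcons n).

Let cons_measure0 : cons_measure set0 = 0%E.
Proof. by rewrite /cons_measure /pushforward preimage_set0 measure0. Qed.

Let cons_measure_ge0 A : (0 <= cons_measure A)%E.
Proof. exact: (measure_ge0 (@lebesgue_measure R \x m)%E). Qed.

Let cons_measure_sigma_additive : semi_sigma_additive cons_measure.
Proof.
move=> A mA tA mUA; rewrite /cons_measure /pushforward preimage_bigcup.
apply: measure_semi_sigma_additive.
- by move=> i; rewrite -[X in measurable X]setTI; exact: measurable_tcons.
- apply/trivIsetP => /= i j _ _ ij; rewrite -preimage_setI.
  by move/trivIsetP : tA => /(_ _ _ _ _ ij) ->//; rewrite preimage_set0.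
- rewrite -preimage_bigcup -[X in measurable X]setTI.
  exact: measurable_tcons.
Qed.

HB.instance Definition _ := isMeasure.Build _ _ _ cons_measure
  cons_measure0 cons_measure_ge0 cons_measure_sigma_additive.

Let cons_measure_sigma_finite : sigma_finite setT cons_measure.
Proof.
have /sigma_finiteP[F [TF ndF Foo]] := sigma_finiteT (@lebesgue_measure R).
have /sigma_finiteP[G [TG ndG Goo]] := sigma_finiteT m.
exists (fun k => @tuncons n @^-1` (F k `*` G k)).
  rewrite -preimage_bigcup -(preimage_setT (@tuncons n)); congr (_ @^-1` _).
  rewrite -setXTT TF TG predeqE => -[x y]; split.
    move=> [/= [i _ Fix] [k _ Gky]]; exists (maxn i k) => //; split.
    - by move: x Fix; exact/subsetPset/ndF/leq_maxl.
    - by move: y Gky; exact/subsetPset/ndG/leq_maxr.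
  by move=> [k _ []/= ? ?]; split; exists k.
move=> k; have [? ?] := Foo k; have [? ?] := Goo k; split.
  rewrite -[X in measurable X]setTI; apply: measurable_tuncons => //.
  exact: measurableX.
rewrite /cons_measure /pushforward -comp_preimage.
rewrite (_ : _ \o _ = id) ?preimage_id; last exact/funext/tconsK.
by rewrite product_measure1E// lte_mul_pinfty// ge0_fin_numE.
Qed.

HB.instance Definition _ := Measure_isSigmaFinite.Build _ _ _ cons_measure
  cons_measure_sigma_finite.

End cons_measure.

(* Lebesgue measure on R^n, as the n-fold product of Lebesgue measure on R *)
Fixpoint lebesgue_tuple (n : nat) :
    {sigma_finite_measure set (n.-tuple R) -> \bar R} :=
  match n with
  | 0%N => \d_([tuple] : 0.-tuple R)
  | n'.+1 => cons_measure (lebesgue_tuple n')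
  end.

Lemma lebesgue_tuple_box n (A : 'I_n -> set R) :
  (forall i, measurable (A i)) ->
  lebesgue_tuple n [set t | forall i, A i (tnth t i)] =
  (\prod_(i < n) lebesgue_measure (A i))%E.
Proof.
elim: n A => [|n IH] A mA.
  rewrite big_ord0 /= diracE mem_set// => -[] //.
rewrite big_ord_recl/= /cons_measure /pushforward.
rewrite -IH// -product_measure1E//=; [|exact: mA|]; last first.
  rewrite (_ : [set t | _] = \bigcap_(i in [set: 'I_n])
      ((fun t : n.-tuple R => tnth t i) @^-1` A (lift ord0 i))).
    apply: fin_bigcap_measurable => [|i _]; first exact: finite_finset.
    by rewrite -[X in measurable X]setTI; exact: measurable_tnth.
  by apply/seteqP; split => t /= h i *; exact: h.
congr (_ _); apply/seteqP; split => -[x t] /=.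
  move=> h; split; first by have := h ord0; rewrite tnth0.
  by move=> i; have := h (lift ord0 i); rewrite tnthS.
move=> [Ax At] i; have [j ->|->] := unliftP ord0 i; last by rewrite tnth0.
by rewrite tnthS.
Qed.

End lebesgue_tuple.

Section defs.
Context {R : realType}.

Definition dotp d (x y : d.-tuple R) : R := \sum_(i < d) tnth x i * tnth y i.

Definition enorm d (x : d.-tuple R) : R := Num.sqrt (dotp x x).

(* points of the plane are pairs z = (t, x): time first, space second *)
Definition lebesgue2 :
    {measure set (measurableTypeR R * measurableTypeR R) -> \bar R} :=
  (@lebesgue_measure R \x @lebesgue_measure R)%E.

Definition spacetime : set (R * R) := [set z | 0 <= z.1].

(* representatives of elements of L^2([0, oo) x R); the values of f at negative
   times are irrelevant *)
Definition L2_spacetime (f : R * R -> R) : Prop :=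
  f \_ spacetime \in Lfun lebesgue2 2%:E.

Definition rectangle (I : set (R * R)) : Prop :=
  exists i j : interval R,
    [/\ bounded_set [set` i], bounded_set [set` j],
        [set` i] `<=` [set t | 0 <= t] & I = [set` i] `*` [set` j]].

Definition heat_kernel (t x : R) : R :=
  (Num.sqrt (4 * pi * t))^-1 * expR (- (x ^+ 2 / (4 * t))).

(* (r, y) |-> G_(t - r)(x - y), extended by 0 to the times r >= t *)
Definition heat_integrand (t x : R) (z : R * R) : R :=
  if z.1 < t then heat_kernel (t - z.1) (x - z.2) else 0.

Definition Elambda d (lam : R) : set (R -> d.-tuple R) :=
  [set f | [/\ forall j, continuous (fun x => tnth (f x) j),
     enorm (f x) * expR (- (lam * `|x|)) @[x --> +oo] --> (0 : R) &
     enorm (f x) * expR (- (lam * `|x|)) @[x --> -oo] --> (0 : R)]].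

Definition Eexp d : set (R -> d.-tuple R) :=
  \bigcup_(lam in [set lam : R | 0 < lam]) Elambda (d := d) lam.

End defs.

Section process.
Context {R : realType} {dO : measure_display} {T : measurableType dO}.
Variable P : probability T R.

(* Only the indices t >= 0 matter. *)
Record right_continuous_filtration (F : R -> set (set T)) : Prop := {
  filtration_sigma_algebra : forall t : R, 0 <= t -> sigma_algebra setT (F t) ;
  filtration_measurable : forall t : R, 0 <= t -> F t `<=` measurable ;
  filtration_nondecreasing : forall s t : R, 0 <= s -> s <= t -> F s `<=` F t ;
  filtration_right_continuous : forall t : R, 0 <= t ->
    F t = \bigcap_(s in [set s | t < s]) F s }.

Definition measurable_wrt d' (T' : measurableType d') (G : set (set T))
    (X : T -> T') : Prop :=
  forall B, measurable B -> G (X @^-1` B).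

Definition independent_of d' (T' : measurableType d') (X : T -> T')
    (G : set (set T)) : Prop :=
  forall A B, G A -> measurable B ->
    P (A `&` X @^-1` B) = (P A * P (X @^-1` B))%E.

(* [normal_prob] is a Gaussian law only when its standard deviation is nonzero;
   the degenerate centered Gaussian law is the Dirac mass at 0. *)
Definition centered_gaussian (X : T -> R) : Prop :=
  measurable_fun setT X /\
  exists s : R, forall B, measurable B ->
    P (X @^-1` B) = if s == 0 then \d_(0 : R) B else normal_prob 0 s B.

Definition centered_gaussian_family (J : Type) (S : set J) (X : J -> T -> R) :
    Prop :=
  forall (n : nat) (f : 'I_n -> J) (a : 'I_n -> R), (forall k, S (f k)) ->
    centered_gaussian (fun w => \sum_(k < n) a k * X (f k) w).

Definition sigma_family (J : Type) (S : set J) (X : J -> T -> R) :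
    set (set T) :=
  <<s [set A | exists2 f, S f &
        exists2 B : set R, measurable B & A = X f @^-1` B] >>.

(* Taking E j = setT for some of the j gives the product rule for every
   subfamily. *)
Definition independent_sigma d (G : 'I_d -> set (set T)) : Prop :=
  forall E : 'I_d -> set T, (forall j, G j (E j)) ->
    P (\bigcap_j E j) = (\prod_(j < d) P (E j))%E.

(* W j f is the random variable W_j(f), for f in L^2([0, oo) x R). *)
Record white_noise d (F : R -> set (set T))
    (W : 'I_d -> (R * R -> R) -> T -> R) : Prop := {
  noise_gaussian : forall j,
    centered_gaussian_family [set f | L2_spacetime f] (W j) ;
  noise_covariance : forall j f g, L2_spacetime f -> L2_spacetime g ->
    ('E_P[(W j f \* W j g)%R] =
     \int[lebesgue2]_(z in spacetime) (f z * g z)%:E)%E ;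
  noise_independent :
    independent_sigma (fun j => sigma_family [set f | L2_spacetime f] (W j)) ;
  noise_adapted : forall (t : R) f, 0 <= t -> L2_spacetime f ->
    {ae lebesgue2, forall z, spacetime z -> t < z.1 -> f z = 0} ->
    measurable_wrt (F t) (fun w => [tuple W j f w | j < d]) ;
  noise_future : forall (t : R) f, 0 <= t -> L2_spacetime f ->
    {ae lebesgue2, forall z, spacetime z -> z.1 < t -> f z = 0} ->
    independent_of (fun w => [tuple W j f w | j < d]) (F t) }.

Record random_string d (F : R -> set (set T))
    (W : 'I_d -> (R * R -> R) -> T -> R) (u : R -> R -> T -> d.-tuple R) :
    Prop := {
  string_adapted : forall t x : R, 0 <= t -> measurable_wrt (F t) (u t x) ;
  string_continuous : {ae P, forall w, forall j,
    {within spacetime, continuous (fun z => tnth (u z.1 z.2 w) j)}} ;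
  string_init : {ae P, forall w, Eexp (fun x => u 0 x w)} ;
  string_init_measurable : forall x, measurable_wrt (F 0) (u 0 x) ;
  string_growth : forall t : R, 0 < t -> exists2 lam : R, 0 < lam &
    {ae P, forall w, forall s : R, 0 <= s <= t ->
      Elambda lam (fun x => u s x w)} ;
  string_mild : forall t x : R, 0 < t -> {ae P, forall w, forall j,
    tnth (u t x w) j =
      \int[lebesgue_measure]_y (heat_kernel t (x - y) * tnth (u 0 y w) j)
      + W j (heat_integrand t x) w} }.

End process.

Section local_times.
Context {R : realType} {d : nat}.
(* v is a sample path (t, x) |-> u_t(x) *)
Implicit Types (v : R -> R -> d.-tuple R) (I : set (R * R)).

Definition occupation v I (B : set (d.-tuple R)) : \bar R :=
  lebesgue2 (I `&` [set z | B (v z.1 z.2)]).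

Definition has_local_times v I : Prop :=
  occupation v I `<< lebesgue_tuple d.

(* l is a version of the Radon-Nikodym derivative of the occupation measure *)
Definition is_local_time v I (l : d.-tuple R -> R) : Prop :=
  (lebesgue_tuple d).-integrable setT (EFin \o l) /\
  forall B, measurable B ->
    occupation v I B = (\int[lebesgue_tuple d]_(x in B) (l x)%:E)%E.

End local_times.

Section fourier.
Context {R : realType}.

Definition expi (x : R) : R[i] := cos x +i* sin x.

Definition Cintegral d0 (X : measurableType d0) (mu : {measure set X -> \bar R})
    (D : set X) (f : X -> R[i]) : R[i] :=
  (\int[mu]_(x in D) complex.Re (f x)) +i* (\int[mu]_(x in D) complex.Im (f x)).

Definition CLfun d0 (X : measurableType d0) (mu : {measure set X -> \bar R})
    (p : \bar R) : set (X -> R[i]) :=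
  [set f | (fun x => complex.Re (f x)) \in Lfun mu p /\
           (fun x => complex.Im (f x)) \in Lfun mu p].

Definition CcvgL2 d0 (X : measurableType d0) (mu : {measure set X -> \bar R})
    (f_ : nat -> X -> R[i]) (f : X -> R[i]) : Prop :=
  'N[mu]_2%:E[(fun x => (Normc.normc (f_ n x - f x))%:E)]%E @[n --> \oo]
    --> 0%E.

Definition inv_fourier d (g : d.-tuple R -> R[i]) (x : d.-tuple R) : R[i] :=
  ((2 * pi) ^- d)%:C *
  Cintegral (lebesgue_tuple d) setT (fun v => expi (- dotp v x) * g v).

(* l is the inverse Fourier transform of g in the L^2 sense, that is, the value
   at g of the continuous extension of [inv_fourier] from L^1 /\ L^2 to L^2.
   By Plancherel, l is determined up to a null set and does not depend on the
   approximating sequence g_. *)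
Definition inv_fourier_L2 d (g l : d.-tuple R -> R[i]) : Prop :=
  [/\ CLfun (lebesgue_tuple d) 2%:E g, CLfun (lebesgue_tuple d) 2%:E l &
    exists g_ : nat -> d.-tuple R -> R[i],
      [/\ forall n, CLfun (lebesgue_tuple d) 1%:E (g_ n) /\
                    CLfun (lebesgue_tuple d) 2%:E (g_ n),
          CcvgL2 (lebesgue_tuple d) g_ g &
          CcvgL2 (lebesgue_tuple d) (fun n => inv_fourier (g_ n)) l]].

Definition occupation_fourier d (v : R -> R -> d.-tuple R) (I : set (R * R))
    (x : d.-tuple R) : R[i] :=
  Cintegral lebesgue2 I (fun z => expi (dotp x (v z.1 z.2))).

End fourier.

(* Main.v *)
(* Let mu be the occupation measure of the string on I and p_e the heat kernel
   of R^d.  Up to the factor (2 pi)^d, the energy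
   q(e) = int int p_e(y - z) mu(dy) mu(dz) is the integral of
   exp(- e |v|^2) |mu^(v)|^2.  Hence, if q(2 / n) has a finite lower limit, mu^ is
   in L^2, the mollifications mu * p_(1/n) form a Cauchy sequence in L^2, and
   their limit is the density of mu; they are also the inverse Fourier transforms
   of exp(- |v|^2 / n) mu^(v), whence the L^2 representation.

   By Fatou it is enough to bound E q(e) uniformly in e.  For z = (t, x) and
   z' = (s, y), u_z - u_z' is the sum of an F_0-measurable drift and of an
   independent Gaussian vector W(h) with independent components of variance
   S = |h|^2, where h is the difference of the two heat integrands; the density
   of W(h) is at most (2 pi S)^(-d/2), hence so is E p_e(u_z - u_z').  Bounding h
   from below on a small box yields
   S >= c |t - s|^(1/2)  and  S >= c min(|x - y|, min(t, s)^(1/2)).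
   As d <= 5 and 5/2 = 7/4 + 3/4, S^(-d/2) is at most
   1 + C |t - s|^(-7/8) (|x - y|^(-3/4) + t^(-3/8) + s^(-3/8)), which is integrable
   over I x I. *)
Require Import Defs.
From HB Require Import structures.
From mathcomp Require Import all_boot all_order all_algebra.
From mathcomp Require Import complex.
From mathcomp Require Import all_classical all_reals all_analysis.
From mathcomp Require Import measurable_realfun ring lra.

Set Implicit Arguments.
Unset Strict Implicit.
Unset Printing Implicit Defensive.

Import Order.TTheory GRing.Theory Num.Theory.
Import numFieldNormedType.Exports.

Local Open Scope classical_set_scope.
Local Open Scope ring_scope.

(** * The heat kernel on the line *)

Section real_functions.
Context {R : realType}.

(** The threshold [d < 6] is where the splitting of the singularity stops working: [S^(-d/2)] is
    shared between the time bound, with exponent [p], and the space bound, with exponent [q], where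
    [p + q = d / 2]; integrability asks for [p / 2 < 1] and [q < 1], hence [d / 2 < 3]. Two
    obstacles shape the probabilistic half. Fubini needs joint measurability in the event and the
    space-time point, while the string is a family of random variables whose paths are continuous
    only almost surely; hence a modified version of it. The white noise is given by its Gaussianity
    and covariance, so its linearity on a difference of integrands has to be derived, almost surely,
    from the covariance. In the analytic half Plancherel's theorem is never invoked: every identity
    involving [mu^] carries a Gaussian weight, so that Fubini and the explicit transform of the
    Gaussian suffice. These weights increase to [1], which turns a finite lower limit of the
    energies into square integrability of [mu^] and then into the Cauchy property of the
    mollifications. *)

Lemma measurable_fun_inv : measurable_fun [set: R] (@GRing.inv R).
Proof.
(* Both sides are [0] at [0]; elsewhere this reduces to the measurability of a real power. *)
have -> : @GRing.inv R = (fun x => x * (x ^+ 2) `^ (-1)).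
  apply/funext => x; rewrite powR_inv1 ?sqr_ge0//.
  have [->|x0] := eqVneq x 0; first by rewrite mul0r invr0.
  by field.
apply: measurable_funM => //.
by apply: (@measurableT_comp _ _ _ _ _ _ (@powR R ^~ (-1))).
Qed.

Lemma measurable_sqrt : measurable_fun [set: R] (@Num.sqrt R).
Proof.
apply: nondecreasing_measurable => // x y xy; exact: ler_wsqrtr.
Qed.

End real_functions.

Section heat_kernel.
Context {R : realType}.
Local Notation hk := (@heat_kernel R).
Local Notation leb := (@lebesgue_measure R).
Implicit Types t x y : R.

Lemma heat_kernel_normal t m x : 0 < t ->
  hk t (m - x) = normal_pdf m (Num.sqrt (2 * t)) x.
Proof.
move=> t0; have s0 : Num.sqrt (2 * t) != 0 by rewrite gt_eqF// sqrtr_gt0 mulr_gt0.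
rewrite normal_pdfE// /heat_kernel /normal_peak /normal_fun sqr_sqrtr; last by rewrite mulr_ge0// ltW.
congr (_ ^-1 * expR _); first by congr (Num.sqrt _); ring.
by field; lra.
Qed.

Lemma heat_kernelN t x : hk t (- x) = hk t x.
Proof. by rewrite /heat_kernel sqrrN. Qed.

Lemma heat_kernel_sym t x y : hk t (x - y) = hk t (y - x).
Proof. by rewrite -heat_kernelN opprB. Qed.

Lemma heat_kernel_ge0 t x : 0 <= hk t x.
Proof. by rewrite mulr_ge0 ?invr_ge0 ?expR_ge0. Qed.

Lemma heat_kernel_le t x : 0 <= t -> hk t x <= (Num.sqrt (4 * pi * t))^-1.
Proof.
move=> t0; rewrite ler_piMr ?invr_ge0// -[leRHS]expR0 ler_expR oppr_le0.
by rewrite divr_ge0 ?sqr_ge0// mulr_ge0.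
Qed.

Lemma continuous_heat_kernel t : continuous (hk t).
Proof.
move=> x; apply: cvgM; first exact: cvg_cst.
apply: (cvg_comp _ expR); last exact: continuous_expR.
apply: (@cvgN _ R^o); apply: cvgM; last exact: cvg_cst.
exact: sqr_continuous.
Qed.

Lemma measurable_heat_kernel2 : measurable_fun [set: R * R] (fun z => hk z.1 z.2).
Proof.
apply: measurable_funM => /=.
  apply: measurableT_comp; first exact: measurable_fun_inv.
  apply: measurableT_comp; first exact: measurable_sqrt.
  by apply: measurable_funM.
apply: measurableT_comp => //; apply: measurableT_comp => //.
apply: measurable_funM; first by apply: measurable_funX; exact: measurable_snd.
apply: measurableT_comp; first exact: measurable_fun_inv.
by apply: measurable_funM.
Qed.

Lemma integral_heat_kernel t x : 0 < t -> (\int[leb]_y (hk t (x - y))%:E = 1)%E.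
Proof.
move=> t0; rewrite -[RHS](integral_normal_pdf x (Num.sqrt (2 * t))).
by apply: eq_integral => y _; rewrite heat_kernel_normal.
Qed.

Lemma heat_kernel_convol a b x z : 0 < a -> 0 < b ->
  (\int[leb]_y (hk a (x - y) * hk b (y - z))%:E = (hk (a + b) (x - z))%:E)%E.
Proof.
move=> a0 b0; have ab : 0 < a + b by rewrite addr_gt0.
(* Completing the square in [y]: the product is a heat kernel of time [c] centred at the barycentre
   [m], times the factor [G_(a + b)(x - z)], free of [y]. *)
pose c := a * b / (a + b); pose m := (b * x + a * z) / (a + b).
have c0 : 0 < c by rewrite divr_gt0// mulr_gt0.
transitivity (\int[leb]_y ((hk (a + b) (x - z))%:E * (hk c (m - y))%:E))%E.
  apply: eq_integral => y _; rewrite -EFinM; congr EFin; rewrite /heat_kernel.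
  rewrite mulrACA [RHS]mulrACA -!expRD -!invfM.
  rewrite -!sqrtrM ?mulr_ge0 ?pi_ge0 ?(ltW c0) ?(ltW a0) ?(ltW b0) ?(ltW ab)//.
  congr ((Num.sqrt _)^-1 * expR _).
    by rewrite /c; field; rewrite gt_eqF.
  by rewrite /c /m; field; rewrite ?(gt_eqF a0) ?(gt_eqF b0) ?(gt_eqF ab).
rewrite ge0_integralZl//=.
- by rewrite integral_heat_kernel// mule1.
- apply/measurable_EFinP; apply: continuous_measurable_fun => y.
  apply: (@continuous_comp _ _ _ (fun y => m - y)); last exact: continuous_heat_kernel.
  by apply: cvgB; [exact: cvg_cst|exact: cvg_id].
- by move=> y _; rewrite lee_fin heat_kernel_ge0.
- by rewrite lee_fin heat_kernel_ge0.
Qed.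

End heat_kernel.

(** * Fourier transforms of Gaussians *)

Section gaussian_fourier.
Context {R : realType}.
Local Notation leb := (@lebesgue_measure R).
Implicit Types e v x : R.

Definition gaussf e v : R := expR (- (e * v ^+ 2)).

Lemma gaussfE e v : 0 < e ->
  gaussf e v = Num.sqrt (pi / e) * heat_kernel (4 * e)^-1 v.
Proof.
move=> e0; rewrite /heat_kernel mulrA (_ : 4 * pi / (4 * e) = pi / e); last first.
  by field; rewrite gt_eqF.
rewrite divff ?mul1r; last by rewrite gt_eqF// sqrtr_gt0 divr_gt0// pi_gt0.
by congr expR; field; rewrite gt_eqF.
Qed.

Lemma continuous_gaussf e : continuous (gaussf e).
Proof.
move=> x; apply: (cvg_comp _ expR); last exact: continuous_expR.
apply: (@cvgN _ R^o); apply: cvgM; first exact: cvg_cst.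
exact: sqr_continuous.
Qed.

Lemma measurable_gaussf e : measurable_fun [set: R] (gaussf e).
Proof. by apply: continuous_measurable_fun; exact: continuous_gaussf. Qed.

Lemma integral_gaussf e : 0 < e -> (\int[leb]_v (gaussf e v)%:E = (Num.sqrt (pi / e))%:E)%E.
Proof.
move=> e0; under eq_integral do rewrite gaussfE// EFinM.
rewrite ge0_integralZl//=.
- under eq_integral do rewrite -heat_kernelN -sub0r.
  by rewrite integral_heat_kernel ?mule1// invr_gt0 mulr_gt0.
- by apply/measurable_EFinP; apply: continuous_measurable_fun; exact: continuous_heat_kernel.
- by move=> y _; rewrite lee_fin heat_kernel_ge0.
Qed.

Lemma integrable_gaussf e : 0 < e -> leb.-integrable setT (EFin \o gaussf e).
Proof.
move=> e0; apply/integrableP; split; first by apply/measurable_EFinP; exact: measurable_gaussf.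
by under eq_integral do rewrite /= ger0_norm ?expR_ge0//; rewrite integral_gaussf// ltry.
Qed.

Lemma integrable_gaussf_bounded e (h : R -> R) (M : R) : 0 < e -> measurable_fun setT h ->
  (forall v, `|h v| <= M) -> leb.-integrable setT (EFin \o (fun v => gaussf e v * h v)).
Proof.
move=> e0 mh hM; have ig : leb.-integrable setT (fun v => (M%:E * (gaussf e v)%:E)%E).
  by apply: integrableZl => //; exact: integrable_gaussf.
apply: le_integrable ig => //.
- by apply/measurable_EFinP; apply: measurable_funM => //; exact: measurable_gaussf.
- move=> v _ /=; rewrite lee_fin !normrM mulrC ler_pM//.
  by rewrite (le_trans (hM v)) ?ler_norm.
Qed.


(** Half of the exponent absorbs the linear factor: [|v| <= (1 + 1/e) (1 + e v^2 / 2) <= (1 + 1/e)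
    exp(e v^2 / 2)]. *)
Lemma gaussf_mulr_le e v : 0 < e -> `|v| * gaussf e v <= (1 + e^-1) * gaussf (e / 2) v.
Proof.
move=> e0; have -> : gaussf e v = gaussf (e / 2) v * gaussf (e / 2) v.
  by rewrite /gaussf -expRD; congr expR; lra.
rewrite mulrA ler_wpM2r ?expR_ge0//.
rewrite -ler_pdivlMr ?expR_gt0// /gaussf -expRN opprK.
have e1 : 0 < e^-1 by rewrite invr_gt0.
apply: (@le_trans _ _ ((1 + e^-1) * (1 + e / 2 * v ^+ 2))); last first.
  rewrite ler_wpM2l ?expR_ge1Dx//; lra.
have -> : (1 + e^-1) * (1 + e / 2 * v ^+ 2) = 1 + e^-1 + e / 2 * v ^+ 2 + v ^+ 2 / 2.
  by field; rewrite gt_eqF.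
rewrite -(real_normK (num_real v)).
have := sqr_ge0 (`|v| - 1); have : 0 <= e * `|v| ^+ 2 by rewrite mulr_ge0 ?sqr_ge0// ltW.
nra.
Qed.

Lemma integrable_gaussf_mulr e (h : R -> R) : 0 < e -> measurable_fun setT h ->
  (forall v, `|h v| <= 1) -> leb.-integrable setT (EFin \o (fun v => gaussf e v * (v * h v))).
Proof.
move=> e0 mh hM.
have ig : leb.-integrable setT (fun v => ((1 + e^-1)%:E * (gaussf (e / 2) v)%:E)%E).
  by apply: integrableZl => //; apply: integrable_gaussf; rewrite divr_gt0.
apply: le_integrable ig => //.
- apply/measurable_EFinP; apply: measurable_funM => //; first exact: measurable_gaussf.
  exact: measurable_funM.
- move=> v _ /=; rewrite lee_fin [leRHS]ger0_norm; last first.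
    by rewrite mulr_ge0 ?expR_ge0// addr_ge0// invr_ge0 ltW.
  apply: le_trans (gaussf_mulr_le v e0).
  rewrite !normrM (ger0_norm (expR_ge0 _)) mulrC ler_wpM2r ?expR_ge0//.
  by rewrite ler_piMr.
Qed.

Lemma is_derive_gaussf e v : is_derive v 1 (gaussf e) (- (2 * e * v) * gaussf e v).
Proof.
rewrite /gaussf; apply: is_derive_eq.
rewrite /GRing.scale /=; ring.
Qed.

Lemma is_derive_sinM (x v : R) : is_derive v 1 (fun v => sin (v * x)) (x * cos (v * x)).
Proof. by apply: is_derive_eq; rewrite /GRing.scale /= ; ring. Qed.

Lemma is_derive_cosM (v x : R) : is_derive x 1 (fun x => cos (v * x)) (- (v * sin (v * x))).
Proof. by apply: is_derive_eq; rewrite /GRing.scale /= ; ring. Qed.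


(** The fundamental theorem of calculus on [[- n, n]], followed by dominated convergence. *)
Lemma integral_derive_eq0 (h g : R -> R) :
  (forall v, is_derive v 1 h (g v)) -> continuous g ->
  leb.-integrable setT (EFin \o g) ->
  h n%:R @[n --> \oo] --> 0 -> h (- n%:R) @[n --> \oo] --> 0 ->
  (\int[leb]_v (g v)%:E = 0)%E.
Proof.
move=> hg cg ig h1 h2.
pose I (n : nat) : set R := `[- n%:R, n%:R]%classic.
have mI n : measurable (I n) by exact: measurable_itv.
have ch : continuous h.
  move=> x; apply: differentiable_continuous; apply/derivable1_diffP.
  exact: (@ex_derive _ _ _ _ _ _ _ (hg x)).
have : (\int[leb]_v ((EFin \o g) \_ (I n)) v)%E @[n --> \oo] --> (\int[leb]_v (g v)%:E)%E.
  apply: (@dominated_cvg _ _ _ leb setT measurableT (fun n => (EFin \o g) \_ (I n)) (EFin \o g) (abse \o (EFin \o g))).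
  - move=> n; apply/measurable_restrict => //; first exact: mI.
    by apply/measurable_funTS/measurable_EFinP; exact: continuous_measurable_fun.
  - move=> v _; apply: cvg_near_cst; near=> n; rewrite patchE mem_set// /I/= in_itv/= -ler_norml.
    by near: n; exact: nbhs_infty_ger.
  - by [].
  - exact: integrable_abse.
  - move=> n v _; rewrite patchE; case: ifP => // _; by rewrite abse0 abse_ge0.
have -> : (fun n => \int[leb]_v ((EFin \o g) \_ (I n)) v)%E = (fun n => (h n%:R - h (- n%:R))%:E).
  apply/funext => n; transitivity (\int[leb]_(v in I n) (g v)%:E)%E; first by rewrite [RHS]integral_mkcond.
  have [->|n0] := eqVneq n 0%N.
    by rewrite /I oppr0 set_itv1 integral_set1 subrr.
  rewrite (@continuous_FTC2 _ g h) ?EFinB//.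
  - by rewrite (@lt_trans _ _ 0)// ?oppr_lt0 ltr0n lt0n.
  - exact: continuous_subspaceT.
  - split=> [x _||]; [exact: (@ex_derive _ _ _ _ _ _ _ (hg x)) | by apply: cvg_at_right_filter; exact: ch | by apply: cvg_at_left_filter; exact: ch].
  - by move=> x _; rewrite derive1E; exact: (@derive_val _ _ _ _ _ _ _ (hg x)).
move=> /cvg_unique; apply => //.
apply: cvg_EFin; first by near=> n.
by rewrite -[X in _ --> X](subrr 0); exact: cvgB.
Unshelve. all: by end_near.
Qed.


(** For [n >= 1], [exp(e n^2) >= 1 + e n^2 >= e (n + 1) / 2], which compares the sequence with the
    harmonic one. *)
Lemma cvg_gaussf e : 0 < e -> gaussf e n%:R @[n --> \oo] --> (0 : R).
Proof.
move=> e0; apply: (@squeeze_cvgr _ _ _ _ (cst 0) (fun n => (e^-1 * n.+1%:R^-1) * 2)).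
- near=> n; rewrite expR_ge0/= /gaussf expRN.
  have n1 : (1 : R) <= n%:R by rewrite ler1n; near: n; exists 1%N.
  have -> : e^-1 / n.+1%:R * 2 = (e * n.+1%:R / 2)^-1.
    by rewrite !invfM invrK.
  rewrite lef_pV2 ?posrE ?expR_gt0 ?divr_gt0 ?mulr_gt0//.
  apply: le_trans (expR_ge1Dx _).
  have : e * n%:R * 1 <= e * n%:R * n%:R by rewrite ler_wpM2l// mulr_ge0// ltW.
  rewrite expr2 -natr1; nra.
- exact: cvg_cst.
- rewrite -[X in _ --> X](mul0r 2); apply: cvgMl; rewrite -[X in _ --> X](mulr0 e^-1).
  by apply: cvgMr; exact: cvg_harmonic.
Unshelve. all: by end_near.
Qed.

Lemma continuous_sinM x : continuous (fun v : R => sin (v * x)).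
Proof.
move=> v; apply: (@continuous_comp _ _ _ (fun v => v * x)); last exact: continuous_sin.
by apply: cvgM; [exact: cvg_id|exact: cvg_cst].
Qed.

Lemma continuous_cosM x : continuous (fun v : R => cos (v * x)).
Proof.
move=> v; apply: (@continuous_comp _ _ _ (fun v => v * x)); last exact: continuous_cos.
by apply: cvgM; [exact: cvg_id|exact: cvg_cst].
Qed.

Lemma measurable_sinM x : measurable_fun [set: R] (fun v : R => sin (v * x)).
Proof. by apply: continuous_measurable_fun; exact: continuous_sinM. Qed.

Lemma measurable_cosM x : measurable_fun [set: R] (fun v : R => cos (v * x)).
Proof. by apply: continuous_measurable_fun; exact: continuous_cosM. Qed.

Lemma integrable_gaussf_cos e x : 0 < e ->
  leb.-integrable setT (EFin \o (fun v => gaussf e v * cos (v * x))).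
Proof.
move=> e0; apply: (@integrable_gaussf_bounded _ _ 1) => //; first exact: measurable_cosM.
by move=> v; exact: cos_max.
Qed.

Lemma integrable_gaussf_sin e x : 0 < e ->
  leb.-integrable setT (EFin \o (fun v => gaussf e v * sin (v * x))).
Proof.
move=> e0; apply: (@integrable_gaussf_bounded _ _ 1) => //; first exact: measurable_sinM.
by move=> v; exact: sin_max.
Qed.

(** Integration by parts, in the form that the derivative of [gaussf e v * sin (v * x)] has integral
    zero. *)
Lemma integral_gaussf_mulr_sin e x : 0 < e ->
  \int[leb]_v (gaussf e v * (v * sin (v * x))) =
  x / (2 * e) * \int[leb]_v (gaussf e v * cos (v * x)).
Proof.
move=> e0.
have i1 : leb.-integrable setT (EFin \o (fun v => gaussf e v * (v * sin (v * x)))).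
  apply: integrable_gaussf_mulr => //; first exact: measurable_sinM.
  by move=> v; exact: sin_max.
have i2 := integrable_gaussf_cos x e0.
pose g v := - (2 * e) * (gaussf e v * (v * sin (v * x))) + x * (gaussf e v * cos (v * x)).
have igl : leb.-integrable setT (EFin \o (fun v => - (2 * e) * (gaussf e v * (v * sin (v * x))))).
  by rewrite /comp; under eq_fun do rewrite EFinM; exact: integrableZl.
have igr : leb.-integrable setT (EFin \o (fun v => x * (gaussf e v * cos (v * x)))).
  by rewrite /comp; under eq_fun do rewrite EFinM; exact: integrableZl.
have : (\int[leb]_v (g v)%:E = 0)%E.
  apply: (@integral_derive_eq0 (fun v => gaussf e v * sin (v * x))).
  - move=> v; have H1 := is_derive_gaussf e v; have H2 := is_derive_sinM x v.
    apply: is_derive_eq; rewrite /g /GRing.scale /=; ring.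
  - move=> v; apply: cvgD.
      apply: cvgMr; apply: cvgM; first exact: continuous_gaussf.
      by apply: cvgM; [exact: cvg_id|exact: continuous_sinM].
    by apply: cvgMr; apply: cvgM; [exact: continuous_gaussf|exact: continuous_cosM].
  - rewrite (_ : EFin \o g = (fun v => (- (2 * e) * (gaussf e v * (v * sin (v * x))))%:E + (x * (gaussf e v * cos (v * x)))%:E)%E)//.
    exact: integrableD.
  - apply/cvgr0Pnorm_le => r r0; near=> n.
    rewrite normrM ger0_norm ?expR_ge0// (@le_trans _ _ (gaussf e n%:R))//.
      by rewrite ler_piMr ?expR_ge0 ?sin_max.
    rewrite -[leLHS]ger0_norm ?expR_ge0//; near: n.
    by apply: cvgr0_norm_le => //; exact: cvg_gaussf.
  - apply/cvgr0Pnorm_le => r r0; near=> n.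
    rewrite normrM ger0_norm ?expR_ge0// (@le_trans _ _ (gaussf e n%:R))//.
      by rewrite /gaussf sqrrN ler_piMr ?expR_ge0 ?sin_max.
    rewrite -[leLHS]ger0_norm ?expR_ge0//; near: n.
    by apply: cvgr0_norm_le => //; exact: cvg_gaussf.
move=> /(congr1 fine)/=; rewrite -/(Rintegral leb setT g) /g RintegralD//.
rewrite !RintegralZl//; set A := Rintegral _ _ _; set B := Rintegral _ _ _ => AB.
have -> : A = x * B / (2 * e) by rewrite -[LHS](mulfK (_ : 2 * e != 0)) ?gt_eqF ?mulr_gt0//; congr (_ / _); lra.
by rewrite mulrAC.
Unshelve. all: by end_near.
Qed.

(** Differentiation under the integral, dominated by [gaussf e v * |v|]; the integration by parts
    above then closes the formula into a linear differential equation. *)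
Lemma is_derive_fourier_gaussf e x : 0 < e ->
  is_derive x 1 (fun x => \int[leb]_v (gaussf e v * cos (v * x)))
    (- (x / (2 * e) * \int[leb]_v (gaussf e v * cos (v * x)))).
Proof.
move=> e0; pose f x v := gaussf e v * cos (v * x).
have d1 y v : is_derive y (1 : R) (f ^~ v) (- (gaussf e v * (v * sin (v * y)))).
  have H := is_derive_cosM v y; apply: is_derive_eq.
  by rewrite /GRing.scale /=; ring.
have d1E y v : partial1of2 f y v = - (gaussf e v * (v * sin (v * y))).
  by rewrite partial1of2E; exact: (@derive_val _ _ _ _ _ _ _ (d1 y v)).
have xI : `](x - 1), (x + 1)[%classic x by rewrite /= in_itv/=; lra.
have igG : leb.-integrable setT (EFin \o (fun v : R => gaussf e v * `|v|)).
  have h1 v : `|cst 1 v : R| <= 1 by rewrite /cst normr1.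
  have := integrable_abse (integrable_gaussf_mulr e0 (measurable_cst (1 : R)) h1).
  congr (leb.-integrable setT _).
  by apply/funext => v /=; rewrite mulr1 normrM (ger0_norm (expR_ge0 _)).
have intf y : `](x - 1), (x + 1)[%classic y -> leb.-integrable setT (EFin \o f y).
  by move=> _; exact: integrable_gaussf_cos.
have derf y v : `](x - 1), (x + 1)[%classic y -> [set: R] v -> derivable (f ^~ v) y 1.
  by move=> _ _; exact: (@ex_derive _ _ _ _ _ _ _ (d1 y v)).
have Gub y v : `](x - 1), (x + 1)[%classic y -> [set: R] v -> `|partial1of2 f y v| <= gaussf e v * `|v|.
  move=> _ _; rewrite d1E normrN !normrM ger0_norm ?expR_ge0// ler_wpM2l ?expR_ge0//.
  by rewrite ler_piMr// sin_max.
have G0 v : 0 <= gaussf e v * `|v| by rewrite mulr_ge0 ?expR_ge0.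
have D := @derivable_under_integral R _ _ leb f setT measurableT x _ _ xI intf derf _ G0 igG Gub.
have V := @differentiation_under_integral R _ _ leb f setT measurableT x _ _ xI intf derf _ G0 igG Gub.
apply: DeriveDef => //; rewrite -derive1E V.
have -> : \int[leb]_y partial1of2 f x y = \int[leb]_v (-1 * (gaussf e v * (v * sin (v * x)))).
  by apply: eq_Rintegral => v _; rewrite d1E mulN1r.
rewrite RintegralZl//; first by rewrite integral_gaussf_mulr_sin// mulN1r.
apply: integrable_gaussf_mulr => //; first exact: measurable_sinM.
by move=> v; exact: sin_max.
Qed.

(** The transform solves [F' = - x / (2 e) F], so that [F x * expR (x ^+ 2 / (4 * e))] is constant;
    its value at [0] is the Gaussian integral [sqrt (pi / e)]. *)
Theorem fourier_gaussf e x : 0 < e ->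
  \int[leb]_v (gaussf e v * cos (v * x)) = 2 * pi * heat_kernel e x.
Proof.
move=> e0; set F := fun x => \int[leb]_v (gaussf e v * cos (v * x)).
pose H x := F x * expR (x ^+ 2 / (4 * e)).
have dH y : is_derive y (1 : R) H 0.
  have dF := is_derive_fourier_gaussf y e0.
  rewrite /H; apply: is_derive_eq; rewrite /GRing.scale /= -/(F y).
  by field; rewrite gt_eqF.
have := is_derive_0_is_cst x 0 dH; rewrite /H /F.
under [X in _ = fine X * _ -> _]eq_integral do rewrite mulr0 cos0 mulr1.
rewrite expr0n/= mul0r expR0 mulr1 [X in _ = X -> _](_ : _ = Num.sqrt (pi / e)); last first.
  by rewrite /Rintegral integral_gaussf.
move=> h; rewrite -[LHS](mulfK (_ : expR (x ^+ 2 / (4 * e)) != 0)) ?gt_eqF ?expR_gt0//.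
rewrite h /heat_kernel expRN mulrA; congr (_ / _).
have -> : Num.sqrt (4 * pi * e) = 2 * Num.sqrt (pi * e).
  rewrite (_ : 4 * pi * e = 2 ^+ 2 * (pi * e)); last by ring.
  by rewrite sqrtrM ?sqr_ge0// sqrtr_sqr ger0_norm.
rewrite invfM.
have -> : pi / e = (pi / Num.sqrt (pi * e)) ^+ 2.
  rewrite expr_div_n sqr_sqrtr ?mulr_ge0 ?pi_ge0 ?(ltW e0)//.
  by rewrite expr2 invfM mulrACA divff ?mul1r// gt_eqF ?pi_gt0.
rewrite sqrtr_sqr ger0_norm ?divr_ge0 ?pi_ge0//.
by field; rewrite gt_eqF// sqrtr_gt0 mulr_gt0// pi_gt0.
Qed.

Lemma Rintegral_odd (f : R -> R) : measurable_fun setT f ->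
  leb.-integrable setT (EFin \o f) ->
  (forall v, f (- v) = - f v) -> \int[leb]_v f v = 0.
Proof.
move=> mf fi fN.
have mN : measurable_fun setT (-%R : measurableTypeR R -> measurableTypeR R).
  exact: oppr_measurable.
have fiN : leb.-integrable setT (EFin \o (fun v => - f v)).
  rewrite (_ : _ \o _ = (fun v => (-1)%:E * (f v)%:E)%E); first exact: integrableZl.
  by apply/funext => v /=; rewrite -EFinM mulN1r.
have : \int[leb]_v f v = \int[leb]_v (- f v).
  rewrite /Rintegral; congr fine.
  transitivity (\int[pushforward leb (-%R : measurableTypeR R -> measurableTypeR R)]_v (f v)%:E)%E.
    by apply: eq_measure_integral => A mA _; apply/esym; exact: lebesgue_measureN.
  rewrite (@integral_pushforward _ _ _ _ _ _ mN leb setT (EFin \o f)) ?preimage_setT//.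
  - by apply: eq_integral => v _ /=; rewrite fN.
  - exact/measurable_EFinP.
  - by move: fiN; congr (leb.-integrable setT _); apply/funext => v /=; rewrite fN.
have -> : \int[leb]_v (- f v) = - \int[leb]_v (f v).
  rewrite -[RHS]mulN1r -RintegralZl//.
  by apply: eq_Rintegral => v _; rewrite mulN1r.
lra.
Qed.

Lemma fourier_gaussf_sin e x : 0 < e -> \int[leb]_v (gaussf e v * sin (v * x)) = 0.
Proof.
move=> e0; apply: Rintegral_odd.
- apply: measurable_funM; [exact: measurable_gaussf|exact: measurable_sinM].
- exact: integrable_gaussf_sin.
- by move=> v; rewrite /gaussf sqrrN mulNr sinN mulrN.
Qed.

End gaussian_fourier.

(** * Integration over R^d *)

Section tuple_measure.
Context {R : realType}.
Local Notation leb := (@lebesgue_measure R).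
Local Notation lebn := (@lebesgue_tuple R).

Lemma ge0_integral_lebesgue_tuple n (f : n.+1.-tuple R -> \bar R) :
  measurable_fun setT f -> (forall t, 0 <= f t)%E ->
  (\int[lebn n.+1]_t f t = \int[leb]_x \int[lebn n]_t f (tcons (x, t)))%E.
Proof.
move=> mf f0.
rewrite (@ge0_integral_pushforward _ _ _ _ _ _ (@measurable_tcons R n) (leb \x lebn n)%E)//=.
rewrite preimage_setT (@fubini_tonelli1 _ _ _ _ _ _ _ (f \o @tcons R n))//=.
- apply: measurableT_comp => //; exact: measurable_tcons.
Qed.

Lemma integral_lebesgue_tuple n (f : n.+1.-tuple R -> \bar R) :
  (lebn n.+1).-integrable setT f ->
  (\int[lebn n.+1]_t f t = \int[leb]_x \int[lebn n]_t f (tcons (x, t)))%E.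
Proof.
move=> fi; have mf := measurable_int _ fi.
have mcf : measurable_fun setT (f \o @tcons R n).
  apply: measurableT_comp => //; exact: measurable_tcons.
have fi' : (leb \x lebn n)%E.-integrable setT (f \o @tcons R n).
  apply/integrableP; split => //.
  move/integrableP : fi => [_]; apply: le_lt_trans.
  rewrite (@ge0_integral_pushforward _ _ _ _ _ _ (@measurable_tcons R n) (leb \x lebn n)%E)//=.
  by apply: measurableT_comp.
rewrite (@integral_pushforward _ _ _ _ _ _ (@measurable_tcons R n) (leb \x lebn n)%E)//=.
by rewrite preimage_setT -integral12_prod_meas1.
Qed.

Lemma tnth_tcons0 n (x : R) (t : n.-tuple R) : tnth (tcons (x, t)) ord0 = x.
Proof. by []. Qed.

Lemma tnth_tconsS n (x : R) (t : n.-tuple R) i : tnth (tcons (x, t)) (lift ord0 i) = tnth t i.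
Proof. by rewrite tnthS. Qed.

Lemma measurable_prod_tnth n (f : 'I_n -> R -> R) :
  (forall i, measurable_fun setT (f i)) ->
  measurable_fun [set: n.-tuple R] (fun t => \prod_(i < n) f i (tnth t i)).
Proof.
move=> mf; apply: measurable_prod => i _.
apply: (@measurableT_comp _ _ _ _ _ _ (f i)) => //; exact: measurable_tnth.
Qed.

Lemma integral_prod_tnth n (f : 'I_n -> R -> R) :
  (forall i, measurable_fun setT (f i)) -> (forall i x, 0 <= f i x) ->
  (\int[lebn n]_t (\prod_(i < n) f i (tnth t i))%:E =
   \prod_(i < n) \int[leb]_x (f i x)%:E)%E.
Proof.
elim: n f => [|n IH] f mf f0.
  under eq_integral do rewrite big_ord0.
  by rewrite integral_dirac//= diracT mul1e big_ord0.
have mp m (h : 'I_m -> R -> R) : (forall i, measurable_fun setT (h i)) ->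
    measurable_fun [set: m.-tuple R] (fun t => (\prod_(i < m) h i (tnth t i))%:E).
  by move=> mh; apply/measurable_EFinP; exact: measurable_prod_tnth.
rewrite ge0_integral_lebesgue_tuple//; last 2 first.
- exact: mp.
- by move=> t; rewrite lee_fin prodr_ge0.
under eq_integral => x _.
  under eq_integral do rewrite big_ord_recl/= tnth_tcons0 EFinM.
  rewrite ge0_integralZl//; last 3 first.
  - under eq_fun do under eq_bigr do rewrite tnth_tconsS.
    exact: (mp _ (fun i => f (lift ord0 i))).
  - by move=> t _; rewrite lee_fin prodr_ge0.
  - by rewrite lee_fin.
  under eq_integral do under eq_bigr do rewrite tnth_tconsS.
  rewrite (IH (fun i => f (lift ord0 i)))//.
  over.
rewrite big_ord_recl ge0_integralZr//.
- by apply/measurable_EFinP; exact: mf.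
- by move=> x _; rewrite lee_fin.
- by apply: prode_ge0 => i _; apply: integral_ge0 => x _; rewrite lee_fin.
Qed.

Definition open_box n (a b : 'I_n -> R) : set (n.-tuple R) :=
  [set t | forall i, a i < tnth t i < b i].

Definition open_boxes n : set (set (n.-tuple R)) :=
  [set B | exists a b, B = open_box a b].

Lemma measurable_open_box n (a b : 'I_n -> R) : measurable (open_box a b).
Proof.
rewrite (_ : open_box a b = \bigcap_(i in [set: 'I_n])
    ((fun t : n.-tuple R => tnth t i) @^-1` `]a i, b i[%classic)).
  apply: fin_bigcap_measurable => [|i _]; first exact: finite_finset.
  by rewrite -[X in measurable X]setTI; exact: measurable_tnth.
by apply/seteqP; split => t /= h i *; have := h i; rewrite /= in_itv/=; exact.
Qed.

Lemma open_boxes_setI n : setI_closed (@open_boxes n).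
Proof.
move=> _ _ [a [b ->]] [a' [b' ->]].
exists (fun i => Num.max (a i) (a' i)), (fun i => Num.min (b i) (b' i)).
apply/seteqP; split => t /=.
  by move=> [h h'] i; rewrite gt_max lt_min; move: (h i) (h' i) => /andP[-> ->] /andP[-> ->].
by move=> h; split => i; have := h i; rewrite gt_max lt_min => /andP[/andP[? ?] /andP[? ?]]; apply/andP.
Qed.

Lemma tnth_bounded n (t : n.-tuple R) : exists k : nat, forall i, - k%:R < tnth t i < k%:R.
Proof.
exists (\max_(i < n) (Num.truncn `|tnth t i|).+1)%N => i.
rewrite -ltr_norml (lt_le_trans (truncnS_gt _))// ler_nat.
exact: (leq_bigmax (F := fun i => (Num.truncn `|tnth t i|).+1)).
Qed.

(** The half-space of the points whose [i]-th coordinate exceeds [a] is the union over [k] of the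
    boxes cut off at [- k] and [k] in the other directions; so each coordinate is measurable for the
    sigma-algebra of the boxes. *)
Lemma measurable_tuple_open_boxes n :
  measurable = <<s @open_boxes n >> :> set (set (n.-tuple R)).
Proof.
apply/seteqP; split; last first.
  apply: smallest_sub; first exact: sigma_algebra_measurable.
  by move=> _ [a [b ->]]; exact: measurable_open_box.
have mid : measurable_fun [set: g_sigma_algebraType (@open_boxes n)]
    (fun t => t : n.-tuple R).
  apply/measurable_fun_tnthP => i.
  apply: (measurability _ (RGenOInfty.measurableE R)) => // _ [_ [a ->] <-].
  rewrite setTI; pose A k := open_box (fun j => if j == i then a else - k%:R) (fun j : 'I_n => k%:R).
  rewrite (_ : _ @^-1` _ = \bigcup_k A k).
    apply: bigcupT_measurable => k; apply: sub_sigma_algebra.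
    by exists (fun j => if j == i then a else - k%:R), (fun j : 'I_n => k%:R).
  apply/seteqP; split => t /=.
    rewrite in_itv/= andbT => at_; have [k tk] := tnth_bounded t.
    by exists k => // j; have /andP[t1 ->] := tk j; case: eqP => [->|_]; rewrite andbT.
  by move=> [k _ /(_ i)]; rewrite eqxx in_itv/= andbT => /andP[].
move=> A mA; have := mid measurableT A mA.
by rewrite setTI.
Qed.

(** Open boxes generate the sigma-algebra and are stable under intersection, and the cubes []- k,
    k[^n] exhaust the space. *)
Lemma measure_tuple_unique n (m1 m2 : {measure set (n.-tuple R) -> \bar R}) :
  (m1 setT < +oo)%E ->
  (forall a b, m1 (open_box a b) = m2 (open_box a b)) ->
  forall A, measurable A -> m1 A = m2 A.
Proof.
move=> m1oo m12.
apply: (measure_unique (@open_boxes n) (fun k => open_box (fun=> - k%:R) (fun=> k%:R))).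
- exact: measurable_tuple_open_boxes.
- exact: open_boxes_setI.
- by move=> k; exists (fun=> - k%:R), (fun=> k%:R).
- by apply/seteqP; split => // t _; have [k tk] := tnth_bounded t; exists k.
- by move=> _ [a [b ->]].
- move=> k; apply: le_lt_trans m1oo; apply: le_measure; rewrite ?inE//.
  exact: measurable_open_box.
Qed.

End tuple_measure.

(** * The heat kernel on R^d *)

Section tuple_heat_kernel.
Context {R : realType} {d : nat}.
Local Notation leb := (@lebesgue_measure R).
Local Notation lebn := (@lebesgue_tuple R).
Implicit Types x y z v : d.-tuple R.

Definition tsub x y : d.-tuple R := [tuple tnth x i - tnth y i | i < d].

(** The heat kernel [p_e] of [R^d], written as a product so that integrals against it factor over
    the coordinates. *)
Definition hkd (e : R) x : R := \prod_(i < d) heat_kernel e (tnth x i).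

Lemma tnth_tsub x y i : tnth (tsub x y) i = tnth x i - tnth y i.
Proof. by rewrite tnth_mktuple. Qed.

Lemma hkd_ge0 e x : 0 <= hkd e x.
Proof. by apply: prodr_ge0 => i _; exact: heat_kernel_ge0. Qed.

Lemma hkd_le e x : 0 <= e -> hkd e x <= (Num.sqrt (4 * pi * e))^-1 ^+ d.
Proof.
move=> e0; rewrite -[X in _ <= _ ^+ X]card_ord -prodr_const.
by apply: ler_prod => i _; rewrite heat_kernel_ge0 heat_kernel_le.
Qed.

Lemma hkd_sym e x y : hkd e (tsub x y) = hkd e (tsub y x).
Proof. by apply: eq_bigr => i _; rewrite !tnth_tsub heat_kernel_sym. Qed.

Lemma measurable_tsub d' (T : measurableType d') (f g : T -> d.-tuple R) :
  measurable_fun setT f -> measurable_fun setT g ->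
  measurable_fun setT (fun t => tsub (f t) (g t)).
Proof.
move=> mf mg; apply/measurable_fun_tnthP => i.
rewrite (_ : _ \o _ = (fun t => tnth (f t) i - tnth (g t) i)); last first.
  by apply/funext => t /=; rewrite tnth_tsub.
by apply: measurable_funB; apply: (measurableT_comp (measurable_tnth i)).
Qed.

Lemma measurable_heat_kernel (e : R) : measurable_fun setT (heat_kernel e).
Proof. by apply: continuous_measurable_fun; exact: continuous_heat_kernel. Qed.

Lemma measurable_hkd e : measurable_fun setT (hkd e).
Proof. apply: (measurable_prod_tnth (f := fun=> heat_kernel e)) => _; exact: measurable_heat_kernel. Qed.

Lemma measurable_hkd_tsub d' (T : measurableType d') (f g : T -> d.-tuple R) e :
  measurable_fun setT f -> measurable_fun setT g ->
  measurable_fun setT (fun t => hkd e (tsub (f t) (g t))).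
Proof.
by move=> mf mg; apply: (measurableT_comp (measurable_hkd e)); exact: measurable_tsub.
Qed.

Lemma measurable_heat_kernelB (e a : R) : measurable_fun [set: R] (fun r => heat_kernel e (a - r)).
Proof.
apply: (measurableT_comp (measurable_heat_kernel e)).
exact: measurable_funB.
Qed.

Lemma integral_hkd e x : 0 < e -> (\int[lebn d]_y (hkd e (tsub x y))%:E = 1)%E.
Proof.
move=> e0; under eq_integral do (rewrite /hkd; under eq_bigr do rewrite tnth_tsub).
rewrite (integral_prod_tnth (f := fun i r => heat_kernel e (tnth x i - r))).
- by rewrite big1// => i _; rewrite integral_heat_kernel.
- by move=> i; exact: measurable_heat_kernelB.
- by move=> i y; exact: heat_kernel_ge0.
Qed.

Lemma hkd_convol a b x z : 0 < a -> 0 < b ->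
  (\int[lebn d]_y (hkd a (tsub x y) * hkd b (tsub y z))%:E = (hkd (a + b) (tsub x z))%:E)%E.
Proof.
move=> a0 b0.
under eq_integral do (rewrite /hkd -big_split; under eq_bigr do rewrite /= !tnth_tsub).
rewrite (integral_prod_tnth (f := fun i r => heat_kernel a (tnth x i - r) * heat_kernel b (r - tnth z i))).
- by rewrite /hkd -prodEFin; apply: eq_bigr => i _; rewrite heat_kernel_convol// tnth_tsub.
- move=> i; apply: measurable_funM; first exact: measurable_heat_kernelB.
  apply: (measurableT_comp (measurable_heat_kernel b)); exact: measurable_funB.
- by move=> i y; rewrite mulr_ge0 ?heat_kernel_ge0.
Qed.

(** Continuity phrased through the coordinates and an arbitrary filter, so that no topology on
    tuples is involved. *)
Lemma cvg_hkd e (T : Type) (F : set_system T) (FF : Filter F) (f : T -> d.-tuple R) x :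
  (forall i, tnth (f t) i @[t --> F] --> tnth x i) -> hkd e (f t) @[t --> F] --> hkd e x.
Proof.
move=> fx; rewrite /hkd; elim: (index_enum _) => [|i r IH].
  by under eq_fun do rewrite big_nil; rewrite big_nil; exact: cvg_cst.
under eq_fun do rewrite big_cons.
rewrite big_cons; apply: cvgM => //.
apply: (@cvg_comp _ _ _ (fun t => tnth (f t) i) (heat_kernel e)); first exact: fx.
exact: continuous_heat_kernel.
Qed.

Lemma dotp_tsub v x y : dotp v (tsub x y) = dotp v x - dotp v y.
Proof.
by rewrite /dotp -sumrB; apply: eq_bigr => i _; rewrite tnth_tsub mulrBr.
Qed.

Lemma measurable_dotp d' (T : measurableType d') (f g : T -> d.-tuple R) :
  measurable_fun setT f -> measurable_fun setT g ->
  measurable_fun setT (fun t => dotp (f t) (g t)).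
Proof.
move=> mf mg; apply: measurable_sum => i.
by apply: measurable_funM; apply: (measurableT_comp (measurable_tnth i)).
Qed.

End tuple_heat_kernel.

(** * Fourier transform of the Gaussian on [R^d] *)

Section tuple_fourier.
Context {R : realType}.
Local Notation leb := (@lebesgue_measure R).
Local Notation lebn := (@lebesgue_tuple R).

Definition gaussd d (e : R) (v : d.-tuple R) : R := \prod_(i < d) gaussf e (tnth v i).

Lemma gaussdE d (e : R) (v : d.-tuple R) : gaussd e v = expR (- (e * dotp v v)).
Proof.
rewrite /gaussd /gaussf -expR_sum; congr expR.
by rewrite /dotp mulr_sumr -sumrN; apply: eq_bigr => i _; rewrite expr2.
Qed.

Lemma dotp_ge0 d (v : d.-tuple R) : 0 <= dotp v v.
Proof. by apply: sumr_ge0 => i _; rewrite -expr2 sqr_ge0. Qed.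

Lemma gaussd_ge0 d (e : R) (v : d.-tuple R) : 0 <= gaussd e v.
Proof. by rewrite gaussdE expR_ge0. Qed.

Lemma gaussd_le1 d (e : R) (v : d.-tuple R) : 0 <= e -> gaussd e v <= 1.
Proof. by move=> e0; rewrite gaussdE -expR0 ler_expR oppr_le0 mulr_ge0// dotp_ge0. Qed.

Lemma measurable_gaussd d (e : R) : measurable_fun setT (@gaussd d e).
Proof. apply: (measurable_prod_tnth (f := fun=> gaussf e)) => _; exact: measurable_gaussf. Qed.

Lemma integrable_gaussd d (e : R) : 0 < e -> (lebn d).-integrable setT (EFin \o gaussd e).
Proof.
move=> e0; apply/integrableP; split; first by apply/measurable_EFinP; exact: measurable_gaussd.
under eq_integral do rewrite /= ger0_norm ?gaussd_ge0//.
rewrite (integral_prod_tnth (f := fun=> gaussf e)).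
- under eq_bigr do rewrite integral_gaussf//.
  by rewrite prodEFin ltry.
- by move=> _; exact: measurable_gaussf.
- by move=> _ x; exact: expR_ge0.
Qed.

Lemma integrable_gaussd_bounded d e (h : d.-tuple R -> R) (M : R) : 0 < e ->
  measurable_fun setT h -> (forall v, `|h v| <= M) ->
  (lebn d).-integrable setT (EFin \o (fun v => gaussd e v * h v)).
Proof.
move=> e0 mh hM.
have ig : (lebn d).-integrable setT (fun v => (M%:E * (gaussd e v)%:E)%E).
  by apply: integrableZl => //; exact: integrable_gaussd.
apply: le_integrable ig => //.
- by apply/measurable_EFinP; apply: measurable_funM => //; exact: measurable_gaussd.
- move=> v _ /=; rewrite lee_fin !normrM mulrC ler_pM//.
  by rewrite (le_trans (hM v)) ?ler_norm.
Qed.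

Lemma measurable_cos_dotp d (x : d.-tuple R) : measurable_fun setT (fun v => cos (dotp v x)).
Proof.
apply: (measurableT_comp (continuous_measurable_fun (@continuous_cos R))).
exact: measurable_dotp.
Qed.

Lemma measurable_sin_dotp d (x : d.-tuple R) : measurable_fun setT (fun v => sin (dotp v x)).
Proof.
apply: (measurableT_comp (continuous_measurable_fun (@continuous_sin R))).
exact: measurable_dotp.
Qed.

Lemma integrable_gaussd_cos d e (x : d.-tuple R) : 0 < e ->
  (lebn d).-integrable setT (EFin \o (fun v => gaussd e v * cos (dotp v x))).
Proof.
move=> e0; apply: (@integrable_gaussd_bounded _ _ _ 1) => //; first exact: measurable_cos_dotp.
by move=> v; exact: cos_max.
Qed.

Lemma integrable_gaussd_sin d e (x : d.-tuple R) : 0 < e ->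
  (lebn d).-integrable setT (EFin \o (fun v => gaussd e v * sin (dotp v x))).
Proof.
move=> e0; apply: (@integrable_gaussd_bounded _ _ _ 1) => //; first exact: measurable_sin_dotp.
by move=> v; exact: sin_max.
Qed.

Lemma dotp_tcons n (x a : R) (t s : n.-tuple R) :
  dotp (tcons (x, t)) (tcons (a, s)) = x * a + dotp t s.
Proof. by rewrite /dotp big_ord_recl/=; congr (_ + _); apply: eq_bigr => i _; rewrite !tnthS. Qed.

Lemma gaussd_tcons n e (x : R) (t : n.-tuple R) : gaussd e (tcons (x, t)) = gaussf e x * gaussd e t.
Proof. by rewrite /gaussd big_ord_recl/=; congr (_ * _); apply: eq_bigr => i _; rewrite !tnthS. Qed.

Lemma tcons_tuncons n (t : n.+1.-tuple R) : tcons (tuncons t) = t.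
Proof. by apply/val_inj => /=; case/tupleP: t => a s; rewrite theadE. Qed.

(** Cosine and sine are carried together because the addition formulas mix them when one coordinate
    is split off. The sine integrals vanish by oddness, which leaves a pure product for the
    cosine. *)
Let fourier_gaussd_rec d e (x : d.-tuple R) : 0 < e ->
  \int[lebn d]_v (gaussd e v * cos (dotp v x)) = (2 * pi) ^+ d * hkd e x /\
  \int[lebn d]_v (gaussd e v * sin (dotp v x)) = 0.
Proof.
move=> e0; elim: d x => [|n IH] x.
  split; rewrite /Rintegral integral_dirac//= ?indicT ?mul1r.
  - by rewrite /gaussd /dotp /hkd !big_ord0 cos0 !mul1r.
  - by apply/measurable_EFinP; apply: measurable_funM; [exact: measurable_gaussd|exact: measurable_cos_dotp].
  - by rewrite /gaussd /dotp !big_ord0 sin0 mulr0.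
  - by apply/measurable_EFinP; apply: measurable_funM; [exact: measurable_gaussd|exact: measurable_sin_dotp].
rewrite -(tcons_tuncons x); move: (tuncons x) => [a s] {x}.
have [IHc IHs] := IH s.
have ic := integrable_gaussd_cos s e0; have is_ := integrable_gaussd_sin s e0.
have sM (f : n.-tuple R -> R) (k : R) : (lebn n).-integrable setT (EFin \o f) ->
    (lebn n).-integrable setT (EFin \o (fun t => k * f t)).
  by move=> fi; rewrite /comp; under eq_fun do rewrite EFinM; exact: integrableZl.
have sum2 (k1 k2 : R) : (\int[lebn n]_t (k1 * (gaussd e t * cos (dotp t s)) +
     k2 * (gaussd e t * sin (dotp t s)))%:E)%E = (k1 * ((2 * pi) ^+ n * hkd e s))%:E.
  have i1 := sM _ k1 ic; have i2 := sM _ k2 is_.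
  have i3 : (lebn n).-integrable setT (EFin \o (fun t => k1 * (gaussd e t * cos (dotp t s)) +
     k2 * (gaussd e t * sin (dotp t s)))).
    by rewrite /comp; under eq_fun do rewrite EFinD; exact: integrableD.
  rewrite -[LHS]fineK ?integrable_fin_num//.
  rewrite -/(Rintegral _ _ _) RintegralD// !RintegralZl// IHs IHc mulr0 addr0//.
have int1 (k : R) (f : R -> R) : leb.-integrable setT (EFin \o f) ->
  (\int[leb]_x (f x * k)%:E)%E = ((\int[leb]_x f x) * k)%:E.
  move=> fi; rewrite -RintegralZr// /Rintegral fineK// integrable_fin_num//.
  by rewrite /comp; under eq_fun do rewrite EFinM; exact: integrableZr.
have icn : leb.-integrable setT (EFin \o (fun x => gaussf e x * cos (x * a))) := integrable_gaussf_cos a e0.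
have isn : leb.-integrable setT (EFin \o (fun x => gaussf e x * sin (x * a))) := integrable_gaussf_sin a e0.
split; rewrite {1}/Rintegral integral_lebesgue_tuple.
- under eq_integral => x _.
    under eq_integral => t _.
      rewrite dotp_tcons gaussd_tcons cosD.
      rewrite (_ : _ * _ = gaussf e x * cos (x * a) * (gaussd e t * cos (dotp t s)) +
        - (gaussf e x * sin (x * a)) * (gaussd e t * sin (dotp t s))); last by ring.
      over.
    rewrite sum2; over.
  rewrite int1// fourier_gaussf//= /hkd big_ord_recl/= exprS.
  under [in RHS]eq_bigr do rewrite tnthS.
  by ring.
- exact: integrable_gaussd_cos.
- under eq_integral => x _.
    under eq_integral => t _.
      rewrite dotp_tcons gaussd_tcons sinD.
      rewrite (_ : _ * _ = gaussf e x * sin (x * a) * (gaussd e t * cos (dotp t s)) +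
        (gaussf e x * cos (x * a)) * (gaussd e t * sin (dotp t s))); last by ring.
      over.
    rewrite sum2; over.
  by rewrite int1// fourier_gaussf_sin//= mul0r.
- exact: integrable_gaussd_sin.
Qed.

Theorem fourier_gaussd d e (x : d.-tuple R) : 0 < e ->
  \int[lebn d]_v (gaussd e v * cos (dotp v x)) = (2 * pi) ^+ d * hkd e x.
Proof. by move=> e0; have [] := fourier_gaussd_rec x e0. Qed.

Lemma fourier_gaussd_sin d e (x : d.-tuple R) : 0 < e ->
  \int[lebn d]_v (gaussd e v * sin (dotp v x)) = 0.
Proof. by move=> e0; have [] := fourier_gaussd_rec x e0. Qed.

End tuple_fourier.

(** * Mollification of finite measures *)

Section measure_lemmas.
Context d (T : measurableType d) (R : realType).
Variable mu : {measure set T -> \bar R}.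
Implicit Types f g : T -> R.

Lemma integral_poweR2 f :
  (\int[mu]_x `|(EFin \o f) x| `^ 2 = \int[mu]_x ((f x) ^+ 2)%:E)%E.
Proof.
apply: eq_integral => x _; rewrite /= -[in RHS](real_normK (num_real (f x))).
by rewrite -powR_mulrn.
Qed.

Lemma integrable_sqr_Lfun2 f : measurable_fun setT f ->
  (\int[mu]_x ((f x) ^+ 2)%:E < +oo)%E -> f \in Lfun mu 2%:E.
Proof.
move=> mf foo; rewrite inE; apply/andP; split; rewrite inE//=.
by rewrite /finite_norm unlock poweR_lty// integral_poweR2.
Qed.

Lemma Lnorm2_le f (r : R) : (\int[mu]_x ((f x) ^+ 2)%:E <= r%:E)%E -> 0 <= r ->
  ('N[mu]_2%:E[EFin \o f] <= (Num.sqrt r)%:E)%E.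
Proof.
move=> fr r0; rewrite unlock integral_poweR2 -powR12_sqrt// -poweR_EFin gt0_ler_poweR//.
- by rewrite in_itv/= leey integral_ge0// => x _; rewrite lee_fin sqr_ge0.
- by rewrite in_itv/= leey lee_fin r0.
Qed.

Lemma Lnorm2_cvg0 (f : nat -> T -> R) (r : nat -> R) :
  (forall n, \int[mu]_x ((f n x) ^+ 2)%:E <= (r n)%:E)%E ->
  (forall n, 0 <= r n) -> r n @[n --> \oo] --> 0 ->
  ('N[mu]_2%:E[EFin \o f n] @[n --> \oo] --> 0)%E.
Proof.
move=> fr r0 rcvg.
apply: (@squeeze_cvge _ _ _ _ (cst 0%E) _ (fun n => (Num.sqrt (r n))%:E)).
- by apply: nearW => n; rewrite Lnorm_ge0/= Lnorm2_le.
- exact: cvg_cst.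
- apply: cvg_EFin; first by apply: nearW.
  rewrite -[X in _ --> X]sqrtr0; apply: (cvg_comp _ (@Num.sqrt R) rcvg).
  exact: sqrt_continuous.
Qed.

Lemma limn_einf_le (u : (\bar R)^nat) (c : \bar R) N :
  (forall n, (N <= n)%N -> u n <= c)%E -> (limn_einf u <= c)%E.
Proof.
move=> uc; rewrite limn_einf_lim; apply: lime_le; first exact: is_cvg_einfs.
apply: nearW => n; apply: le_trans (uc (maxn n N) (leq_maxr _ _)).
by apply: ereal_inf_lbound; exists (maxn n N) => //=; exact: leq_maxl.
Qed.

(** The telescoping series converges absolutely by comparison with a geometric one. *)
Lemma cvg_geometric_step (u : nat -> R) (C z : R) : 0 <= z < 1 ->
  (forall k, `|u k.+1 - u k| <= C * z ^+ k) -> cvgn u.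
Proof.
move=> /andP[z0 z1] uC.
have -> : u = (fun n => u 0%N + series (telescope u) n).
  by apply/funext => n; exact: eq_sum_telescope.
apply: is_cvgD; first exact: is_cvg_cst.
apply: (@normed_cvg R R^o).
apply: (@series_le_cvg _ _ (geometric C z)).
- by move=> n; exact: normr_ge0.
- by move=> n; exact: le_trans (normr_ge0 _) (uC n).
- exact: uC.
- by apply: is_cvg_geometric_series; rewrite ger0_norm.
Qed.

(** Completeness of [L^2] by the Riesz-Fischer argument, in a quantitative form: the rate [delta]
    and nonnegativity pass to the limit. *)
Lemma L2_cauchy_limit (f : nat -> T -> R) (delta : nat -> R) :
  (forall n, measurable_fun setT (f n)) ->
  delta n @[n --> \oo] --> 0 ->
  (forall n m, (n <= m)%N -> \int[mu]_x ((f n x - f m x) ^+ 2)%:E <= (delta n)%:E)%E ->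
  exists L : T -> R, [/\ measurable_fun setT L,
    (forall n, \int[mu]_x ((f n x - L x) ^+ 2)%:E <= (delta n)%:E)%E &
    (forall n x, 0 <= f n x) -> forall x, 0 <= L x].
Proof.
move=> mf d0 fd.
(* Along the subsequence [phi] the squared increments have integral at most [tau k]; weighted by
   [4^k] these bounds become [2^-k], which is summable. *)
pose tau k : R := 2 / (2 ^ (k + 1))%:R / 4 ^+ k.
have tau0 k : 0 < tau k by rewrite !divr_gt0// ltr0n expn_gt0.
have /choice[N HN] k : exists m, forall n, (m <= n)%N -> delta n <= tau k.
  have /cvgr0_norm_le/(_ _ (tau0 k))[m _ mk] := d0.
  by exists m => n /mk/=; exact: le_trans (ler_norm _).
pose phi := fix phi k := if k is k'.+1 then maxn (phi k').+1 (N k) else N 0%N.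
have phiN k : (N k <= phi k)%N by case: k => [//|k] /=; exact: leq_maxr.
have phiS k : (phi k < phi k.+1)%N by rewrite /=; exact: leq_maxl.
have phik k : (k <= phi k)%N by elim: k => // k IH; exact: leq_ltn_trans IH (phiS k).
pose D k x := (4 ^+ k * (f (phi k) x - f (phi k.+1) x) ^+ 2)%:E : \bar R.
have mD k : measurable_fun setT (D k).
  apply/measurable_EFinP; apply: measurable_funM => //.
  by apply: measurable_funX; apply: measurable_funB.
have D0 k x : (0 <= D k x)%E by rewrite lee_fin mulr_ge0// sqr_ge0.
pose S x := (\sum_(k <oo) D k x)%E.
have mS : measurable_fun setT S.
  by apply: ge0_emeasurable_sum => // k x _ _; exact: D0.
have S0 x : (0 <= S x)%E by apply: nneseries_ge0 => k _ _; exact: D0.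
have iS : (\int[mu]_x S x < +oo)%E.
  rewrite integral_nneseries//.
  apply: (@le_lt_trans _ _ (\sum_(k <oo) (2 / (2 ^ (k + 1))%:R : R)%:E)%E).
    apply: lee_nneseries => [k _ _|k _]; first by apply: integral_ge0 => x _; exact: D0.
    rewrite /D; under eq_integral do rewrite EFinM.
    rewrite ge0_integralZl//=.
    - apply: (@le_trans _ _ ((4 ^+ k)%:E * (tau k)%:E)%E).
        rewrite lee_pmul2l ?lte_fin ?exprn_gt0//.
        apply: (le_trans (fd _ _ (ltnW (phiS k)))).
        by rewrite lee_fin HN.
      by rewrite -EFinM lee_fin /tau mulrC divfK// expf_neq0.
    - apply/measurable_EFinP.
      by apply: measurable_funX; apply: measurable_funB.
    - by move=> x _; rewrite lee_fin sqr_ge0.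
  have /cvg_lim := @cvg_geometric_eseries_half R 2 0.
  by rewrite /eseries/= => ->//; rewrite ltry.
have aeS : {ae mu, forall x, (S x < +oo)%E}.
  have : mu.-integrable setT S.
    apply/integrableP; split => //.
    by under eq_integral do rewrite gee0_abs//.
  move=> /(integrable_ae measurableT); apply: filterS => x /(_ I).
  by rewrite ge0_fin_numE.
pose A := [set x | (S x < +oo)%E].
have mA : measurable A.
  by rewrite -[A]setTI; exact: emeasurable_fun_infty_o.
(* The indicator of [A] makes the sequence converge at every point, to [0] off [A], so that its
   limit is measurable without an exceptional set. *)
pose h k x := f (phi k) x * \1_A x.
have mh k : measurable_fun setT (h k).
  by apply: measurable_funM => //; exact: measurable_indic.
have ch x : cvgn (h ^~ x).
  have [xA|xA] := pselect (A x); last first.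
    rewrite (_ : h ^~ x = cst 0); first exact: is_cvg_cst.
    by apply/funext => k; rewrite /h indicE memNset// mulr0.
  rewrite (_ : h ^~ x = (fun k => f (phi k) x)); last first.
    by apply/funext => k; rewrite /h indicE mem_set// mulr1.
  apply: (@cvg_geometric_step _ (Num.sqrt (fine (S x))) (2^-1)); first by lra.
  move=> k; have Sfin : S x \is a fin_num by rewrite ge0_fin_numE.
  have DS : (D k x <= S x)%E.
    have := @nneseries_lim_ge _ (D ^~ x) xpredT 0 k.+1 (fun i _ _ => D0 i x).
    apply: le_trans; rewrite big_mkord big_ord_recr/=.
    by rewrite leeDr// sume_ge0.
  (* One term of the series is at most its sum, hence the [k]-th increment is at most
     [sqrt (S x) 2^-k]: a geometric rate. *)
  have : 4 ^+ k * (f (phi k) x - f (phi k.+1) x) ^+ 2 <= fine (S x).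
    by rewrite -lee_fin fineK.
  move=> /ler_wsqrtr; rewrite sqrtrM ?exprn_ge0// sqrtr_sqr.
  rewrite (_ : 4 ^+ k = (2 ^+ k) ^+ 2); last by rewrite -exprM mulnC exprM; congr (_ ^+ _); ring.
  rewrite sqrtr_sqr ger0_norm ?exprn_ge0// distrC => H.
  by rewrite exprVn ler_pdivlMr ?exprn_gt0// mulrC.
pose L x := lim (h ^~ x @ \oo).
have mL : measurable_fun setT L.
  by apply: (@measurable_fun_cvg _ _ _ _ h) => // x _; exact: ch.
exists L; split => //; last first.
  move=> f0 x; apply: limr_ge; first exact: ch.
  by apply: nearW => k; rewrite mulr_ge0// indicE.
move=> n.
have mF k : measurable_fun setT (fun x => ((f n x - h k x) ^+ 2)%:E).
  apply/measurable_EFinP; apply: measurable_funX; exact: measurable_funB.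
(* Fatou along the subsequence; since [phi k >= k], the bound [delta n] applies as soon as
   [k >= n]. *)
apply: (@le_trans _ _ (limn_einf (fun k => \int[mu]_x ((f n x - h k x) ^+ 2)%:E)))%E.
  have E x : limn_einf (fun k => ((f n x - h k x) ^+ 2)%:E) = ((f n x - L x) ^+ 2)%:E.
    suff /cvg_limn_einf_sup[-> _] :
      ((f n x - h k x) ^+ 2)%:E @[k --> \oo] --> ((f n x - L x) ^+ 2)%:E by [].
    apply: cvg_EFin; first exact: nearW.
    apply: (cvg_comp (fun k => f n x - h k x) (fun r => r ^+ 2)); last exact: sqr_continuous.
    by apply: cvgB; [exact: cvg_cst|exact: ch].
  under eq_integral do rewrite -E.
  by apply: fatou => // k x _; rewrite lee_fin sqr_ge0.
apply: (@limn_einf_le _ _ n) => k nk.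
rewrite (@ae_eq_integral _ _ _ mu _ (fun x => ((f n x - f (phi k) x) ^+ 2)%:E))//.
- by apply: fd; exact: leq_trans (phik k).
- apply/measurable_EFinP; apply: measurable_funX; exact: measurable_funB.
- apply: filterS aeS => x xA _ /=.
  by rewrite /h indicE mem_set// mulr1.
Qed.

End measure_lemmas.

Section density_measure.
Context d (T : measurableType d) (R : realType).
Variables (mu : {measure set T -> \bar R}) (L : T -> R).
Hypotheses (mL : measurable_fun setT L) (L0 : forall x, 0 <= L x).

Definition density_measure (A : set T) : \bar R := (\int[mu]_(x in A) (L x)%:E)%E.

Let density0 : density_measure set0 = 0%E.
Proof. by rewrite /density_measure integral_set0. Qed.

Let density_ge0 A : (0 <= density_measure A)%E.
Proof. by apply: integral_ge0 => x _; rewrite lee_fin. Qed.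

Let density_sigma_additive : semi_sigma_additive density_measure.
Proof.
move=> F mF tF mUF; rewrite /density_measure ge0_integral_bigcup//.
- by apply: is_cvg_ereal_nneg_natsum_cond => n _ _; exact: density_ge0.
- by apply/measurable_EFinP; exact: measurable_funTS.
- by move=> x _; rewrite lee_fin.
Qed.

Definition density_measure_pack : {measure set T -> \bar R} :=
  HB.pack density_measure
    (isMeasure.Build _ _ _ density_measure density0 density_ge0 density_sigma_additive).

End density_measure.

(** * Fubini for bounded functions and finite measures *)

Section bounded_fubini.
Context dX dY (X : measurableType dX) (Y : measurableType dY) (R : realType).
Variable m : {finite_measure set Y -> \bar R}.

Lemma bounded_integrable (h : Y -> R) (M : R) : measurable_fun setT h ->
  (forall y, `|h y| <= M) -> m.-integrable setT (EFin \o h).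
Proof.
move=> mh hM.
have ic : m.-integrable setT (EFin \o cst M) by exact: finite_measure_integrable_cst.
apply: le_integrable ic => //; first exact/measurable_EFinP.
by move=> y _; rewrite /= lee_fin (le_trans (hM y))// ler_norm.
Qed.

Lemma measurable_Rintegral_bounded (h : X * Y -> R) (M : R) : measurable_fun setT h ->
  (forall z, `|h z| <= M) -> measurable_fun setT (fun x => \int[m]_y h (x, y)).
Proof.
move=> mh hM.
have mhx x : measurable_fun setT (fun y => h (x, y)) by exact: measurableT_comp.
(* Shifting by [M] makes the integrand nonnegative, where measurability of the partial integral
   comes from Tonelli. *)
have -> : (fun x => \int[m]_y h (x, y)) =
    (fun x => fine (\int[m]_y (h (x, y) + M)%:E)%E - M * fine (m setT)).
  apply/funext => x; rewrite -/(Rintegral m setT (fun y => h (x, y) + M)) RintegralD//.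
  - by rewrite Rintegral_cst// addrK.
  - exact: (bounded_integrable (M := M)).
  - exact: finite_measure_integrable_cst.
apply: measurable_funB => //; apply: (measurableT_comp (fine_measurable measurableT)).
apply: (@measurable_fun_fubini_tonelli_F _ _ _ _ _ m (fun z => (h z + M)%:E)).
- by apply/measurable_EFinP; exact: measurable_funD.
- by move=> z; rewrite lee_fin; have := hM z; rewrite ler_norml; lra.
Qed.

Lemma Rintegral_prod_bounded (m' : {finite_measure set X -> \bar R}) (f : X -> R) (g : Y -> R) (M : R) :
  measurable_fun setT f -> measurable_fun setT g ->
  (forall x, `|f x| <= M) -> (forall x, `|g x| <= M) ->
  (m' \x m)%E.-integrable setT (fun z => (f z.1 * g z.2)%:E) /\
  \int[(m' \x m)%E]_z (f z.1 * g z.2) = (\int[m']_x f x) * (\int[m]_y g y).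
Proof.
move=> mf mg fM gM.
have mfg : measurable_fun setT (fun z : X * Y => f z.1 * g z.2).
  by apply: measurable_funM; exact: measurableT_comp.
have ig := bounded_integrable mg gM.
have if_ : m'.-integrable setT (EFin \o f).
  have ic : m'.-integrable setT (EFin \o cst M) by exact: finite_measure_integrable_cst.
  apply: le_integrable ic => //; first exact/measurable_EFinP.
  by move=> y _; rewrite /= lee_fin (le_trans (fM y))// ler_norm.
have i : (m' \x m)%E.-integrable setT (fun z => (f z.1 * g z.2)%:E).
  apply/integrable12ltyP; first exact/measurable_EFinP.
  under eq_integral => x _.
    under eq_integral do rewrite /= normrM EFinM.
    rewrite ge0_integralZl//; last first.
      by apply/measurable_EFinP; exact: measurableT_comp.
    over.
  rewrite ge0_integralZr//.
  - by rewrite lte_mul_pinfty ?integral_ge0 ?ge0_fin_numE ?integral_ge0//;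
      [move/integrableP : if_ => [] | move/integrableP : ig => []].
  - by apply/measurable_EFinP; exact: measurableT_comp.
  - exact: integral_ge0.
split => //; rewrite [LHS]/Rintegral -integral12_prod_meas1//= /fubini_F/=.
under eq_integral => x _.
  under eq_integral do rewrite EFinM.
  rewrite integralZl// -[X in (_ * X)%E]fineK ?integrable_fin_num// -EFinM.
  over.
rewrite -/(Rintegral m' setT (fun x => f x * fine (\int[m]_y (g y)%:E)%E)).
by rewrite RintegralZr.
Qed.

End bounded_fubini.

Section gaussian_fubini.
Context {R : realType} (d : nat) dY (Y : measurableType dY).
Local Notation lebn := (@lebesgue_tuple R).
Variable m : {finite_measure set Y -> \bar R}.

(** The Gaussian weight makes a bounded [h] integrable for the product of the infinite measure
    [lebn] with the finite measure [m]. *)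
Lemma gaussd_fubini e (h : d.-tuple R * Y -> R) (M : R) : 0 < e -> 0 <= M ->
  measurable_fun setT h -> (forall z, `|h z| <= M) ->
  \int[lebn d]_v (gaussd e v * \int[m]_y h (v, y)) =
  \int[m]_y \int[lebn d]_v (gaussd e v * h (v, y)).
Proof.
move=> e0 M0 mh hM.
pose F (z : d.-tuple R * Y) := gaussd e z.1 * h z.
have mF : measurable_fun setT F.
  apply: measurable_funM => //; apply: measurableT_comp => //; exact: measurable_gaussd.
have mhv v : measurable_fun setT (fun y => h (v, y)) by exact: measurableT_comp.
have mhy y : measurable_fun setT (fun v => h (v, y)) by exact: measurableT_comp.
have ihv v : m.-integrable setT (EFin \o (fun y => h (v, y))).
  by apply: (bounded_integrable _ (mhv v)) => y; exact: hM.
have iF : (lebn d \x m)%E.-integrable setT (EFin \o F).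
  apply/integrable12ltyP; first exact/measurable_EFinP.
  apply: (@le_lt_trans _ _ (\int[lebn d]_v ((gaussd e v)%:E * (M * fine (m setT))%:E))%E).
    apply: ge0_le_integral => //.
    - by move=> v _; exact: integral_ge0.
    - apply: (@measurable_fun_fubini_tonelli_F _ _ _ _ _ m (fun z => `|(EFin \o F) z|%E)) => //.
      by apply: measurableT_comp => //; exact/measurable_EFinP.
    - by apply/measurable_EFinP; apply: measurable_funM => //; exact: measurable_gaussd.
    - move=> v _; rewrite /F/=.
      under eq_integral do rewrite normrM ger0_norm ?gaussd_ge0// EFinM.
      rewrite ge0_integralZl//; last 2 first.
      + by apply/measurable_EFinP; exact: measurableT_comp.
      + by rewrite lee_fin gaussd_ge0.
      rewrite lee_wpmul2l ?lee_fin ?gaussd_ge0//.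
      rewrite EFinM fineK ?fin_num_measure// -integral_cst//.
      apply: ge0_le_integral => //.
      + by apply/measurable_EFinP; exact: measurableT_comp.
      + by move=> y _; rewrite lee_fin.
  rewrite integralZr//; last exact: integrable_gaussd.
  rewrite -[X in (X * _)%E]fineK ?ltry//.
  by apply: integrable_fin_num => //; exact: integrable_gaussd.
have := Fubini iF; rewrite /F/= => FF.
rewrite /Rintegral; congr fine.
transitivity (\int[lebn d]_x \int[m]_y (gaussd e x * h (x, y))%:E)%E.
  apply: eq_integral => v _; under [RHS]eq_integral do rewrite EFinM.
  rewrite integralZl//; last exact: ihv.
  by rewrite -[X in (_ * X)%E]fineK; [|apply: integrable_fin_num => //; exact: ihv].
rewrite FF; apply: eq_integral => y _.
by rewrite fineK//; apply: integrable_fin_num => //; apply: (integrable_gaussd_bounded (M := M)).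
Qed.

End gaussian_fubini.

Lemma measurable_fun_cos {R : realType} dT (T : measurableType dT) (f : T -> R) :
  measurable_fun setT f -> measurable_fun setT (fun t => cos (f t)).
Proof. exact: (measurableT_comp (continuous_measurable_fun (@continuous_cos R))). Qed.

Lemma measurable_fun_sin {R : realType} dT (T : measurableType dT) (f : T -> R) :
  measurable_fun setT f -> measurable_fun setT (fun t => sin (f t)).
Proof. exact: (measurableT_comp (continuous_measurable_fun (@continuous_sin R))). Qed.

(** * Fourier transform, energy and mollification of a finite measure *)

Section finite_measure_fourier.
Context {R : realType} {d : nat}.
Variable mu : {finite_measure set (d.-tuple R) -> \bar R}.
Local Notation lebn := (@lebesgue_tuple R d).

(** The product measure under a name of its own, to carry the structure of a finite measure. *)
Definition square_measure : set (d.-tuple R * d.-tuple R) -> \bar R := (mu \x mu)%E.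
HB.instance Definition _ := Measure.on square_measure.

Let square_measure_fin : fin_num_fun square_measure.
Proof.
move=> A mA; rewrite ge0_fin_numE ?measure_ge0//.
apply: (@le_lt_trans _ _ ((mu \x mu)%E setT)).
  by apply: le_measure; rewrite ?inE.
rewrite -setXTT product_measure1E// lte_mul_pinfty ?measure_ge0 ?fin_num_measure//.
by rewrite ltey_eq fin_num_measure.
Qed.

HB.instance Definition _ := Measure_isFinite.Build _ _ _ square_measure square_measure_fin.

Local Notation mu2 := square_measure.

(** Real part of [mu^]; [fourier_sin] is its imaginary part and [fourier_sqr] its squared
    modulus. *)
Definition fourier_cos v := \int[mu]_y cos (dotp v y).
Definition fourier_sin v := \int[mu]_y sin (dotp v y).
Definition fourier_sqr v := fourier_cos v ^+ 2 + fourier_sin v ^+ 2.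

Definition mollify e x := \int[mu]_y hkd e (tsub y x).

Let measurable_cos_dotp2 : measurable_fun setT
  (fun z : d.-tuple R * d.-tuple R => cos (dotp z.1 z.2)).
Proof.
apply: measurable_fun_cos.
exact: measurable_dotp.
Qed.

Let measurable_sin_dotp2 : measurable_fun setT
  (fun z : d.-tuple R * d.-tuple R => sin (dotp z.1 z.2)).
Proof.
apply: measurable_fun_sin.
exact: measurable_dotp.
Qed.

Lemma measurable_fourier_cos : measurable_fun setT fourier_cos.
Proof.
apply: (measurable_Rintegral_bounded (M := 1) mu measurable_cos_dotp2) => z.
exact: cos_max.
Qed.

Lemma measurable_fourier_sin : measurable_fun setT fourier_sin.
Proof.
apply: (measurable_Rintegral_bounded (M := 1) mu measurable_sin_dotp2) => z.
exact: sin_max.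
Qed.

Lemma measurable_fourier_sqr : measurable_fun setT fourier_sqr.
Proof.
apply: measurable_funD; apply: measurable_funX.
  exact: measurable_fourier_cos.
exact: measurable_fourier_sin.
Qed.

Lemma fourier_sqr_ge0 v : 0 <= fourier_sqr v.
Proof. by rewrite addr_ge0 ?sqr_ge0. Qed.

Let norm_Rintegral_le (h : d.-tuple R -> R) (M : R) : measurable_fun setT h -> 0 <= M ->
  (forall y, `|h y| <= M) -> `|\int[mu]_y h y| <= M * fine (mu setT).
Proof.
move=> mh M0 hM; have ih := bounded_integrable mu mh hM.
apply: (le_trans (le_normr_Rintegral measurableT ih)).
rewrite -Rintegral_cst//; apply: le_Rintegral => //.
- exact: (integrable_abse ih).
- exact: finite_measure_integrable_cst.
Qed.

Lemma fourier_cos_le v : `|fourier_cos v| <= fine (mu setT).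
Proof.
rewrite -[leRHS]mul1r; apply: norm_Rintegral_le => //; last by move=> y; exact: cos_max.
by apply: measurable_fun_cos; exact: measurable_dotp.
Qed.

Lemma fourier_sin_le v : `|fourier_sin v| <= fine (mu setT).
Proof.
rewrite -[leRHS]mul1r; apply: norm_Rintegral_le => //; last by move=> y; exact: sin_max.
by apply: measurable_fun_sin; exact: measurable_dotp.
Qed.

Lemma fourier_sqr_le v : `|fourier_sqr v| <= 2 * fine (mu setT) ^+ 2.
Proof.
rewrite ger0_norm ?fourier_sqr_ge0// /fourier_sqr.
have := fourier_cos_le v; have := fourier_sin_le v.
have sq (x y : R) : `|x| <= y -> x ^+ 2 <= y ^+ 2.
  by move=> xy; rewrite -(real_normK (num_real x)) lerXn2r ?nnegrE// (le_trans _ xy).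
move=> /sq h1 /sq h2; lra.
Qed.

Lemma fourier_sqrE v : fourier_sqr v = \int[mu2]_p cos (dotp v (tsub p.1 p.2)).
Proof.
have mc : measurable_fun setT (fun y => cos (dotp v y)).
  by apply: measurable_fun_cos; exact: measurable_dotp.
have ms : measurable_fun setT (fun y => sin (dotp v y)).
  by apply: measurable_fun_sin; exact: measurable_dotp.
have bc y : `|cos (dotp v y)| <= 1 by exact: cos_max.
have bs y : `|sin (dotp v y)| <= 1 by exact: sin_max.
have [ic Ec] := Rintegral_prod_bounded mu mu mc mc bc bc.
have [is_ Es] := Rintegral_prod_bounded mu mu ms ms bs bs.
rewrite /fourier_sqr !expr2 -Ec -Es -RintegralD//.
by apply: eq_Rintegral => p _; rewrite dotp_tsub cosB.
Qed.

Lemma mollify_ge0 e x : 0 <= mollify e x.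
Proof. by apply: Rintegral_ge0 => y _; exact: hkd_ge0. Qed.

Let hkd_bounded e : 0 < e -> forall x : d.-tuple R, `|hkd e x| <= (Num.sqrt (4 * pi * e))^-1 ^+ d.
Proof. by move=> e0 x; rewrite ger0_norm ?hkd_ge0// hkd_le// ltW. Qed.

Let measurable_hkd2 e : measurable_fun setT
  (fun z : d.-tuple R * d.-tuple R => hkd e (tsub z.2 z.1)).
Proof. exact: measurable_hkd_tsub. Qed.

Lemma measurable_mollify e : 0 < e -> measurable_fun setT (mollify e).
Proof.
move=> e0; apply: (measurable_Rintegral_bounded mu (measurable_hkd2 e)) => z.
exact: hkd_bounded.
Qed.

Lemma integrable_mollify e x : 0 < e -> mu.-integrable setT (EFin \o (fun y => hkd e (tsub y x))).
Proof.
move=> e0; apply: bounded_integrable; last by move=> y; exact: hkd_bounded.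
exact: measurable_hkd_tsub.
Qed.

(** Integrating [x] out first, by Tonelli, the semigroup property merges the two kernels into the
    one of time [a + b]. *)
Lemma integral_mollifyM a b : 0 < a -> 0 < b ->
  (\int[lebn]_x (mollify a x * mollify b x)%:E =
   \int[mu2]_p (hkd (a + b) (tsub p.1 p.2))%:E)%E.
Proof.
move=> a0 b0.
pose M := Num.max ((Num.sqrt (4 * pi * a))^-1 ^+ d) ((Num.sqrt (4 * pi * b))^-1 ^+ d).
have mF : measurable_fun setT (fun z : d.-tuple R * (d.-tuple R * d.-tuple R) =>
    (hkd a (tsub z.2.1 z.1) * hkd b (tsub z.1 z.2.2))%:E).
  apply/measurable_EFinP; apply: measurable_funM.
    by apply: measurable_hkd_tsub => //; apply: measurableT_comp.
  by apply: measurable_hkd_tsub => //; apply: measurableT_comp.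
transitivity (\int[lebn]_x \int[mu2]_p (hkd a (tsub p.1 x) * hkd b (tsub x p.2))%:E)%E.
  apply: eq_integral => x _.
  have ma : measurable_fun setT (fun y => hkd a (tsub y x)) by exact: measurable_hkd_tsub.
  have mb : measurable_fun setT (fun y => hkd b (tsub y x)) by exact: measurable_hkd_tsub.
  have ba y : `|hkd a (tsub y x)| <= M by rewrite /M le_max hkd_bounded.
  have bb y : `|hkd b (tsub y x)| <= M by rewrite /M le_max hkd_bounded ?orbT.
  have [i E] := Rintegral_prod_bounded mu mu ma mb ba bb.
  rewrite /mollify -E /Rintegral fineK; last exact: integrable_fin_num.
  by apply: eq_integral => p _; rewrite (hkd_sym b).
rewrite (@fubini_tonelli _ _ _ _ _ _ _ _ mF)/=; last first.
  by move=> z; rewrite lee_fin mulr_ge0 ?hkd_ge0.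
by apply: eq_integral => p _ /=; rewrite hkd_convol.
Qed.

(** The squared modulus of [mu^] is a double integral of cosines; Fubini brings the Gaussian
    integral inside, where its explicit transform applies. *)
Lemma energy_fourier e : 0 < e ->
  \int[lebn]_v (gaussd e v * fourier_sqr v) =
  (2 * pi) ^+ d * \int[mu2]_p hkd e (tsub p.1 p.2).
Proof.
move=> e0; have mh : measurable_fun setT (fun z : d.-tuple R * (d.-tuple R * d.-tuple R) =>
    cos (dotp z.1 (tsub z.2.1 z.2.2))).
  apply: measurable_fun_cos.
  by apply: measurable_dotp => //; apply: measurable_tsub; apply: measurableT_comp.
transitivity (\int[lebn]_v (gaussd e v * \int[mu2]_p cos (dotp v (tsub p.1 p.2)))).
  by apply: eq_Rintegral => v _; rewrite fourier_sqrE.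
rewrite (gaussd_fubini mu2 (M := 1) e0 ler01 mh); last by move=> z; exact: cos_max.
under eq_Rintegral do rewrite /= fourier_gaussd//.
rewrite RintegralZl//; apply: (bounded_integrable mu2 (M := (Num.sqrt (4 * pi * e))^-1 ^+ d)).
  exact: measurable_hkd_tsub.
by move=> p; exact: hkd_bounded.
Qed.

Lemma integrable_gaussd_fourier_sqr e : 0 < e ->
  lebn.-integrable setT (EFin \o (fun v => gaussd e v * fourier_sqr v)).
Proof.
move=> e0; apply: integrable_gaussd_bounded => //; first exact: measurable_fourier_sqr.
exact: fourier_sqr_le.
Qed.

Lemma integrable_mollifyM a b : 0 < a -> 0 < b ->
  lebn.-integrable setT (EFin \o (fun x => mollify a x * mollify b x)).
Proof.
move=> a0 b0; apply/integrableP; split.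
  by apply/measurable_EFinP; apply: measurable_funM; exact: measurable_mollify.
under eq_integral do rewrite /= ger0_norm ?mulr_ge0 ?mollify_ge0//.
rewrite integral_mollifyM//.
have ab : 0 < a + b by rewrite addr_gt0.
have ih : mu2.-integrable setT (EFin \o (fun p => hkd (a + b) (tsub p.1 p.2))).
  apply: (bounded_integrable mu2 (M := (Num.sqrt (4 * pi * (a + b)))^-1 ^+ d)).
    exact: measurable_hkd_tsub.
  by move=> p; exact: hkd_bounded.
by rewrite -ge0_fin_numE ?integral_ge0//; [exact: integrable_fin_num|move=> p _; rewrite lee_fin hkd_ge0].
Qed.

Let Rintegral_mollifyM a b : 0 < a -> 0 < b ->
  \int[lebn]_x (mollify a x * mollify b x) =
  (2 * pi) ^- d * \int[lebn]_v (gaussd (a + b) v * fourier_sqr v).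
Proof.
move=> a0 b0; rewrite energy_fourier ?addr_gt0// mulKf; last first.
  by rewrite expf_neq0// mulf_neq0// gt_eqF ?pi_gt0.
by rewrite /Rintegral integral_mollifyM.
Qed.

Lemma gaussdD a b (v : d.-tuple R) : gaussd (a + b) v = gaussd a v * gaussd b v.
Proof. by rewrite !gaussdE -expRD; congr expR; ring. Qed.

(** Expanding the square, each of the three inner products is a Gaussian integral of [fourier_sqr];
    the weights recombine into a square because [gaussd (a + b)] is the product of [gaussd a] and
    [gaussd b]. *)
Lemma integral_mollifyB_sqr a b : 0 < a -> 0 < b ->
  (\int[lebn]_x ((mollify a x - mollify b x) ^+ 2)%:E =
   ((2 * pi) ^- d * \int[lebn]_v ((gaussd a v - gaussd b v) ^+ 2 * fourier_sqr v))%:E)%E.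
Proof.
move=> a0 b0.
have iaa := integrable_mollifyM a0 a0; have ibb := integrable_mollifyM b0 b0.
have iab := integrable_mollifyM a0 b0.
have jaa := integrable_gaussd_fourier_sqr (addr_gt0 a0 a0).
have jbb := integrable_gaussd_fourier_sqr (addr_gt0 b0 b0).
have jab := integrable_gaussd_fourier_sqr (addr_gt0 a0 b0).
have sM (f : d.-tuple R -> R) (k : R) : lebn.-integrable setT (EFin \o f) ->
    lebn.-integrable setT (EFin \o (fun t => k * f t)).
  by move=> fi; rewrite /comp; under eq_fun do rewrite EFinM; exact: integrableZl.
have sD (f g : d.-tuple R -> R) : lebn.-integrable setT (EFin \o f) ->
    lebn.-integrable setT (EFin \o g) -> lebn.-integrable setT (EFin \o (fun t => f t + g t)).
  by move=> fi gi; rewrite /comp; under eq_fun do rewrite EFinD; exact: integrableD.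
have lin (f g h : d.-tuple R -> R) : lebn.-integrable setT (EFin \o f) ->
    lebn.-integrable setT (EFin \o g) -> lebn.-integrable setT (EFin \o h) ->
    \int[lebn]_t (f t + g t + (-2) * h t) =
    \int[lebn]_t f t + \int[lebn]_t g t + (-2) * \int[lebn]_t h t.
  by move=> fi gi hi; rewrite RintegralD ?RintegralD ?RintegralZl//; [exact: sD|exact: sM].
transitivity (\int[lebn]_x (mollify a x * mollify a x + mollify b x * mollify b x +
    (-2) * (mollify a x * mollify b x)))%:E.
  rewrite /Rintegral fineK; last first.
    by apply: integrable_fin_num => //; apply: (sD _ _); [exact: sD|exact: sM].
  by apply: eq_integral => x _; congr EFin; ring.
rewrite lin// !Rintegral_mollifyM//; congr EFin.
rewrite [X in _ = _ * X](_ : _ = \int[lebn]_v (gaussd (a + a) v * fourier_sqr v +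
    gaussd (b + b) v * fourier_sqr v + (-2) * (gaussd (a + b) v * fourier_sqr v))).
  by rewrite lin//; ring.
by apply: eq_Rintegral => v _; rewrite !gaussdD; ring.
Qed.

End finite_measure_fourier.

(** * Tents, and the rate of approximation by the heat kernel *)

Section tent.
Context {R : realType}.
Local Notation leb := (@lebesgue_measure R).
Implicit Types a b r : R.

(** A trapezoid of slope [k] vanishing off []a, b[]: it increases with [k] to the indicator of the
    open interval while being Lipschitz for each [k]. *)
Definition tent a b (k : nat) r : R :=
  Num.max 0 (Num.min 1 (k%:R * Num.min (r - a) (b - r))).

Lemma tent_ge0 a b k r : 0 <= tent a b k r.
Proof. by rewrite /tent le_max lexx. Qed.

Lemma tent_le1 a b k r : tent a b k r <= 1.
Proof. by rewrite /tent ge_max ler01 ge_min lexx. Qed.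

Lemma tent_out a b k r : ~~ (a < r < b) -> tent a b k r = 0.
Proof.
rewrite negb_and -!leNgt => h; rewrite /tent; apply/max_idPl.
rewrite ge_min; apply/orP; right; rewrite mulr_ge0_le0// ge_min.
by case/orP: h => h; apply/orP; [left|right]; rewrite subr_le0.
Qed.

Lemma tent_nd a b r k l : (k <= l)%N -> tent a b k r <= tent a b l r.
Proof.
move=> kl; have [rab|rab] := boolP (a < r < b); last by rewrite !tent_out.
rewrite /tent ge_max !le_max lexx/= ge_min; apply/orP; right.
rewrite /=; case/andP: rab => ar rb.
have m0 : 0 <= Num.min (r - a) (b - r) by rewrite le_min !subr_ge0 !ltW.
have h : k%:R * Num.min (r - a) (b - r) <= l%:R * Num.min (r - a) (b - r).
  by rewrite ler_wpM2r// ler_nat.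
by rewrite le_min ge_min lexx ge_min h orbT.
Qed.

Lemma tent_cvg a b r : tent a b k r @[k --> \oo] --> ((nat_of_bool (a < r < b)%R)%:R : R).
Proof.
have [rab|rab] := boolP (a < r < b); last first.
  by under eq_fun do rewrite tent_out//; exact: cvg_cst.
case/andP: rab => ar rb; set m := Num.min (r - a) (b - r).
have m0 : 0 < m by rewrite /m lt_min !subr_gt0 ar.
apply: cvg_near_cst; near=> k; rewrite /tent -/m.
have km : 1 <= k%:R * m.
  rewrite -ler_pdivrMr//; near: k; exact: nbhs_infty_ger.
by rewrite (min_idPl km); apply/max_idPr.
Unshelve. all: by end_near.
Qed.

Lemma tent_lip a b k r r' : `|tent a b k r - tent a b k r'| <= k%:R * `|r - r'|.
Proof.
have minlip (x y x' y' c : R) : `|x - x'| <= c -> `|y - y'| <= c ->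
    `|Num.min x y - Num.min x' y'| <= c.
  by rewrite !ler_norml /Num.min; case: ifPn; case: ifPn; rewrite -?leNgt; lra.
have maxlip (x y x' y' c : R) : `|x - x'| <= c -> `|y - y'| <= c ->
    `|Num.max x y - Num.max x' y'| <= c.
  by rewrite !ler_norml /Num.max; case: ifPn; case: ifPn; rewrite -?leNgt; lra.
rewrite /tent; apply: maxlip; first by rewrite subrr normr0.
apply: (minlip _ _ _ _ _); first by rewrite subrr normr0.
rewrite -mulrBr normrM ger0_norm// ler_wpM2l//.
apply: minlip; first by rewrite opprB addrA subrK.
rewrite (_ : b - r - (b - r') = r' - r); first by rewrite distrC.
ring.
Qed.

Lemma measurable_tent a b k : measurable_fun setT (tent a b k).
Proof.
apply: measurable_maxr => //; apply: measurable_minr => //.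
apply: measurable_funM => //; apply: measurable_minr => //.
  exact: measurable_funB.
exact: measurable_funB.
Qed.

(** Doubling the time absorbs the polynomial factor: [r^2 exp(- r^2 / (8 e)) <= 8 e] and
    [sqrt 2 <= 2] give [r^2 G_e(r) <= 16 e G_(2 e)(r)], to be combined with
    [|r| <= sqrt e + r^2 / sqrt e]. *)
Lemma heat_kernelM_norm_le (e r : R) : 0 < e ->
  heat_kernel e r * `|r| <= Num.sqrt e * (heat_kernel e r + 16 * heat_kernel (2 * e) r).
Proof.
move=> e0; have s0 : 0 < Num.sqrt e by rewrite sqrtr_gt0.
have E2 : Num.sqrt e ^+ 2 = e by rewrite sqr_sqrtr// ltW.
have rle : `|r| <= Num.sqrt e + r ^+ 2 / Num.sqrt e.
  rewrite -(ler_pM2r s0) mulrDl divfK ?gt_eqF// -expr2 -(real_normK (num_real r)).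
  by have := sqr_ge0 (`|r| - Num.sqrt e / 2); have := sqr_ge0 (Num.sqrt e); rewrite E2; nra.
have H : heat_kernel e r * r ^+ 2 <= 16 * e * heat_kernel (2 * e) r.
  have h1 : heat_kernel e r = Num.sqrt 2 * heat_kernel (2 * e) r * expR (- (r ^+ 2 / (8 * e))).
    have s2 : (Num.sqrt (4 * pi * e))^-1 = Num.sqrt 2 * (Num.sqrt (4 * pi * (2 * e)))^-1.
      rewrite (_ : 4 * pi * (2 * e) = 2 * (4 * pi * e)); last by ring.
      by rewrite (sqrtrM (4 * pi * e))// invfM mulrA divff ?mul1r ?gt_eqF ?sqrtr_gt0.
    rewrite /heat_kernel s2 [RHS]mulrAC -(mulrA (Num.sqrt 2)) -[RHS]mulrA; congr (_ * _).
    rewrite [RHS]mulrCA -expRD; congr (_ * expR _).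
    by field; rewrite gt_eqF.
  have h2 : r ^+ 2 * expR (- (r ^+ 2 / (8 * e))) <= 8 * e.
    rewrite expRN ler_pdivrMr ?expR_gt0//.
    have := @expR_ge1Dx R (r ^+ 2 / (8 * e)).
    rewrite -(ler_pM2l (_ : 0 < 8 * e)) ?mulr_gt0// mulrDr mulr1 mulrCA divff ?mulr1 ?gt_eqF ?mulr_gt0//.
    by apply: le_trans; rewrite lerDr mulr_ge0 ?ltW.
  have h3 : Num.sqrt (2 : R) <= 2.
    rewrite -[leRHS]ger0_norm// -sqrtr_sqr ler_wsqrtr// expr2; lra.
  have q0 : 0 <= r ^+ 2 * expR (- (r ^+ 2 / (8 * e))) by rewrite mulr_ge0 ?sqr_ge0 ?expR_ge0.
  have h4 : Num.sqrt 2 * (r ^+ 2 * expR (- (r ^+ 2 / (8 * e)))) <= 2 * (8 * e) by apply: ler_pM.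
  have := ler_wpM2r (heat_kernel_ge0 (2 * e) r) h4; rewrite h1.
  by congr (_ <= _); ring.
apply: (@le_trans _ _ (heat_kernel e r * (Num.sqrt e + r ^+ 2 / Num.sqrt e))).
  by rewrite ler_wpM2l ?heat_kernel_ge0.
rewrite mulrDr [leRHS]mulrDr mulrC lerD2l mulrA ler_pdivrMr//.
rewrite [leRHS](_ : _ = 16 * Num.sqrt e ^+ 2 * heat_kernel (2 * e) r); last by ring.
by rewrite E2.
Qed.

(** The error is at most [C] times the mean of the displacement under the kernel; [17 = 1 + 16] adds
    the masses of the two kernels in the preceding bound. *)
Lemma heat_kernel_approx (e C : R) (f : R -> R) y : 0 < e -> measurable_fun setT f ->
  (forall r, 0 <= f r <= 1) -> (forall r r', `|f r - f r'| <= C * `|r - r'|) ->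
  `|\int[leb]_x (heat_kernel e (y - x) * f x) - f y| <= C * (17 * Num.sqrt e).
Proof.
move=> e0 mf f01 fC.
have C0 : 0 <= C by have := fC 0 1; rewrite sub0r normrN1 mulr1; exact: le_trans.
have mk e' : measurable_fun [set: R] (fun x => heat_kernel e' (y - x)).
  exact: measurable_heat_kernelB.
have ik e' : 0 < e' -> leb.-integrable setT (EFin \o (fun x => heat_kernel e' (y - x))).
  move=> e'0; apply/integrableP; split; first by apply/measurable_EFinP; exact: mk.
  under eq_integral do rewrite /= ger0_norm ?heat_kernel_ge0//.
  by rewrite integral_heat_kernel// ltry.
have ikf : leb.-integrable setT (EFin \o (fun x => heat_kernel e (y - x) * f x)).
  apply: le_integrable (ik e e0) => //.
    by apply/measurable_EFinP; apply: measurable_funM; [exact: mk|exact: mf].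
  move=> x _; rewrite /= lee_fin normrM ler_piMr//.
  by have /andP[? ?] := f01 x; rewrite ger0_norm.
have iky : leb.-integrable setT (EFin \o (fun x => heat_kernel e (y - x) * f y)).
  by rewrite /comp; under eq_fun do rewrite EFinM; apply: integrableZr => //; exact: ik.
have I1 e' : 0 < e' -> \int[leb]_x heat_kernel e' (y - x) = 1.
  by move=> e'0; rewrite /Rintegral integral_heat_kernel.
have -> : f y = \int[leb]_x (heat_kernel e (y - x) * f y).
  by rewrite RintegralZr ?I1 ?mul1r//; exact: ik.
have idiff : leb.-integrable setT (EFin \o (fun x => heat_kernel e (y - x) * f x - heat_kernel e (y - x) * f y)).
  by rewrite /comp; under eq_fun do rewrite EFinB; exact: integrableB.
rewrite -RintegralB//; apply: (le_trans (le_normr_Rintegral measurableT idiff)).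
have e20 : 0 < 2 * e by rewrite mulr_gt0.
have ib1 := ik e e0; have ib2 := ik (2 * e) e20.
have sM (g : R -> R) (k : R) : leb.-integrable setT (EFin \o g) ->
    leb.-integrable setT (EFin \o (fun t => k * g t)).
  by move=> gi; rewrite /comp; under eq_fun do rewrite EFinM; exact: integrableZl.
have ib : leb.-integrable setT (EFin \o (fun x =>
    heat_kernel e (y - x) + 16 * heat_kernel (2 * e) (y - x))).
  by rewrite /comp; under eq_fun do rewrite EFinD; apply: integrableD => //; exact: sM.
apply: (@le_trans _ _ (\int[leb]_x ((C * Num.sqrt e) *
    (heat_kernel e (y - x) + 16 * heat_kernel (2 * e) (y - x))))).
  apply: le_Rintegral => //.
  - exact: (integrable_abse idiff).
  - exact: sM.
  - move=> x _; rewrite -mulrBr normrM ger0_norm ?heat_kernel_ge0//.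
    apply: (@le_trans _ _ (heat_kernel e (y - x) * (C * `|y - x|))).
      by rewrite ler_wpM2l ?heat_kernel_ge0// distrC fC.
    by rewrite mulrCA -mulrA ler_wpM2l// heat_kernelM_norm_le.
rewrite RintegralZl// RintegralD//; last exact: sM.
by rewrite RintegralZl// !I1//; lra.
Qed.

End tent.

Lemma prodr_le1 {R : realType} n (f : 'I_n -> R) :
  (forall i, 0 <= f i <= 1) -> \prod_(i < n) f i <= 1.
Proof.
move=> f01; apply: (@le_trans _ _ (\prod_(i < n) (1 : R))); last by rewrite big1.
by apply: ler_prod => i _; exact: f01.
Qed.

(** * Limits in [L^2] against a test function *)

Section L2_test.
Context dT (T : measurableType dT) (R : realType).
Variable mu : {measure set T -> \bar R}.

(** The inequality [g phi <= h phi + eta phi^2 + (g - h)^2 / eta] between nonnegative functions,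
    applied with the roles of [f n] and [L] in both orders, encloses the integral of [L phi], which
    is not known to be finite beforehand. *)
Lemma L2_limit_test (f : nat -> T -> R) (L phi : T -> R) (delta : nat -> R) (F A : R) :
  (forall n, measurable_fun setT (f n)) -> measurable_fun setT L ->
  measurable_fun setT phi ->
  (forall n x, 0 <= f n x) -> (forall x, 0 <= L x) -> (forall x, 0 <= phi x) ->
  (\int[mu]_x ((phi x) ^+ 2)%:E <= F%:E)%E ->
  (forall n, \int[mu]_x ((f n x - L x) ^+ 2)%:E <= (delta n)%:E)%E ->
  delta n @[n --> \oo] --> 0 ->
  (\int[mu]_x (f n x * phi x)%:E)%E @[n --> \oo] --> A%:E ->
  (\int[mu]_x (L x * phi x)%:E = A%:E)%E.
Proof.
move=> mf mL mphi f0 L0 phi0 phiF fL d0 fA.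
have dge n : 0 <= delta n.
  by rewrite -lee_fin; apply: le_trans (fL n); apply: integral_ge0 => x _; rewrite lee_fin sqr_ge0.
have F0 : 0 <= F.
  by rewrite -lee_fin; apply: le_trans phiF; apply: integral_ge0 => x _; rewrite lee_fin sqr_ge0.
(* It tends to [0] while [delta / eta <= sqrt delta]; the term [1 / (n + 1)] keeps it positive when
   [delta n] is zero. *)
pose eta n : R := Num.sqrt (delta n) + n.+1%:R^-1.
have eta0 n : 0 < eta n by rewrite ltr_wpDl// sqrtr_ge0.
pose eps n := eta n * F + Num.sqrt (delta n).
have sd0 : Num.sqrt (delta n) @[n --> \oo] --> (0 : R).
  rewrite -[X in _ --> X]sqrtr0; apply: (cvg_comp _ (@Num.sqrt R) d0).
  exact: sqrt_continuous.
have eps0 : eps n @[n --> \oo] --> (0 : R).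
  rewrite -[X in _ --> X]addr0; apply: cvgD => //.
  rewrite -[X in _ --> X](mul0r F); apply: cvgMl.
  rewrite -[X in _ --> X]addr0; apply: cvgD => //; exact: cvg_harmonic.
have amgm n (g h : T -> R) : measurable_fun setT g -> measurable_fun setT h ->
    (forall x, 0 <= g x) -> (forall x, 0 <= h x) ->
    (\int[mu]_x ((g x - h x) ^+ 2)%:E <= (delta n)%:E)%E ->
    (\int[mu]_x (g x * phi x)%:E <= \int[mu]_x (h x * phi x)%:E + (eps n)%:E)%E.
  move=> mg mh g0 h0 gh.
  have mhp : measurable_fun setT (fun x => (h x * phi x)%:E).
    by apply/measurable_EFinP; exact: measurable_funM.
  have mp2 : measurable_fun setT (fun x => ((phi x) ^+ 2)%:E).
    by apply/measurable_EFinP; exact: measurable_funX.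
  have mg2 : measurable_fun setT (fun x => ((g x - h x) ^+ 2)%:E).
    by apply/measurable_EFinP; apply: measurable_funX; exact: measurable_funB.
  have m1 : measurable_fun setT (fun x => (eta n)%:E * ((phi x) ^+ 2)%:E)%E.
    by apply/measurable_EFinP; apply: measurable_funM => //; exact: measurable_funX.
  have m2 : measurable_fun setT (fun x => (eta n)^-1%:E * ((g x - h x) ^+ 2)%:E)%E.
    apply/measurable_EFinP; apply: measurable_funM => //.
    by apply: measurable_funX; exact: measurable_funB.
  apply: (@le_trans _ _ (\int[mu]_x ((h x * phi x)%:E + ((eta n)%:E * ((phi x) ^+ 2)%:E +
      (eta n)^-1%:E * ((g x - h x) ^+ 2)%:E)))%E).
    apply: ge0_le_integral => //.
    - by move=> x _; rewrite lee_fin mulr_ge0.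
    - by apply/measurable_EFinP; exact: measurable_funM.
    - by apply: emeasurable_funD => //; exact: emeasurable_funD.
    - move=> x _; rewrite -!EFinM -!EFinD lee_fin -lerBlDl.
      rewrite -(ler_pM2l (eta0 n)) [leRHS]mulrDr mulVKf ?gt_eqF//.
      have := sqr_ge0 ((g x - h x) - eta n * phi x / 2); have := sqr_ge0 (eta n * phi x); nra.
  rewrite ge0_integralD//; first last.
  - exact: emeasurable_funD.
  - by move=> x _; rewrite adde_ge0 ?mule_ge0 ?lee_fin ?sqr_ge0 ?invr_ge0 ?(ltW (eta0 n)).
  - by move=> x _; rewrite lee_fin mulr_ge0.
  rewrite leeD2l// ge0_integralD//; first last.
  - by move=> x _; rewrite mule_ge0 ?lee_fin ?sqr_ge0 ?invr_ge0 ?(ltW (eta0 n)).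
  - by move=> x _; rewrite mule_ge0 ?lee_fin ?sqr_ge0 ?(ltW (eta0 n)).
  rewrite ge0_integralZl//; last 2 first.
  - by move=> x _; rewrite lee_fin sqr_ge0.
  - by rewrite lee_fin ltW.
  rewrite ge0_integralZl//; last 2 first.
  - by move=> x _; rewrite lee_fin sqr_ge0.
  - by rewrite lee_fin invr_ge0 ltW.
  have -> : (eps n)%:E = ((eta n * F)%:E + (Num.sqrt (delta n))%:E)%E by [].
  apply: leeD.
    by rewrite EFinM lee_wpmul2l// lee_fin ltW.
  apply: (@le_trans _ _ ((eta n)^-1%:E * (delta n)%:E)%E).
    by rewrite lee_wpmul2l// lee_fin invr_ge0 ltW.
  rewrite -EFinM lee_fin ler_pdivrMl// -[leLHS](sqr_sqrtr (dge n)) expr2.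
  by rewrite ler_wpM2r ?sqrtr_ge0// /eta lerDl invr_ge0.
have Aeps : (\int[mu]_x (f n x * phi x)%:E + (eps n)%:E)%E @[n --> \oo] --> A%:E.
  rewrite -[A%:E]adde0; apply: cvgeD => //; apply: cvg_EFin => //.
  by apply: nearW.
have BA : (\int[mu]_x (L x * phi x)%:E <= A%:E)%E.
  rewrite -(cvg_lim _ Aeps)//; apply: lime_ge; first exact: cvgP Aeps.
  apply: nearW => n; apply: amgm => //.
  rewrite (_ : (fun x => _) = (fun x => ((f n x - L x) ^+ 2)%:E)); first exact: fL.
  by apply/funext => x; rewrite -sqrrN opprB.
apply/eqP; rewrite eq_le BA/=.
have Bfin : (\int[mu]_x (L x * phi x)%:E)%E \is a fin_num.
  rewrite ge0_fin_numE; first exact: le_lt_trans BA (ltry _).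
  by apply: integral_ge0 => x _; rewrite lee_fin mulr_ge0.
have Beps : (\int[mu]_x (L x * phi x)%:E + (eps n)%:E)%E @[n --> \oo] --> (\int[mu]_x (L x * phi x)%:E)%E.
  rewrite -[X in _ --> X]adde0; apply: cvgeD => //; first by rewrite fin_num_adde_defl.
    exact: cvg_cst.
  by apply: cvg_EFin => //; apply: nearW.
rewrite -(cvg_lim _ fA)// -(cvg_lim _ Beps)//; apply: lee_lim; [exact: cvgP fA|exact: cvgP Beps|].
by apply: nearW => n; apply: amgm.
Qed.

End L2_test.

(** * Mollified measures against products of Lipschitz functions *)

Section mollify_test.
Context {R : realType} {d : nat}.
Variable mu : {finite_measure set (d.-tuple R) -> \bar R}.
Local Notation leb := (@lebesgue_measure R).
Local Notation lebn := (@lebesgue_tuple R d).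

Variables (f : 'I_d -> R -> R) (C : R).
Hypotheses (mf : forall i, measurable_fun setT (f i))
  (f01 : forall i r, 0 <= f i r <= 1)
  (fC : forall i r r', `|f i r - f i r'| <= C * `|r - r'|).

Let phi (x : d.-tuple R) := \prod_(i < d) f i (tnth x i).
Let T e i r := \int[leb]_x (heat_kernel e (r - x) * f i x).

Let ihk e r : 0 < e -> leb.-integrable setT (EFin \o (fun x => heat_kernel e (r - x))).
Proof.
move=> e0; apply/integrableP; split; first by apply/measurable_EFinP; exact: measurable_heat_kernelB.
under eq_integral do rewrite /= ger0_norm ?heat_kernel_ge0//.
by rewrite integral_heat_kernel// ltry.
Qed.

Let ihkf e i r : 0 < e -> leb.-integrable setT (EFin \o (fun x => heat_kernel e (r - x) * f i x)).
Proof.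
move=> e0; apply: le_integrable (ihk r e0) => //.
  by apply/measurable_EFinP; apply: measurable_funM; [exact: measurable_heat_kernelB|exact: mf].
move=> x _; rewrite /= lee_fin normrM ler_piMr//.
by have /andP[? ?] := f01 i x; rewrite ger0_norm.
Qed.

Let T01 e i r : 0 < e -> 0 <= T e i r <= 1.
Proof.
move=> e0; apply/andP; split.
  by apply: Rintegral_ge0 => x _; rewrite mulr_ge0 ?heat_kernel_ge0//; have /andP[] := f01 i x.
have -> : 1 = \int[leb]_x heat_kernel e (r - x) by rewrite /Rintegral integral_heat_kernel.
apply: le_Rintegral => //; [exact: ihkf|exact: ihk|].
move=> x _; rewrite ler_piMr ?heat_kernel_ge0//; by have /andP[] := f01 i x.
Qed.

Let mT e i : 0 < e -> measurable_fun setT (T e i).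
Proof.
move=> e0; apply: (measurableT_comp (fine_measurable measurableT)).
apply: (@measurable_fun_fubini_tonelli_F _ _ (measurableTypeR R) (measurableTypeR R) R leb
  (fun z => (heat_kernel e (z.1 - z.2) * f i z.2)%:E)).
  apply/measurable_EFinP; apply: measurable_funM.
    apply: (measurableT_comp (measurable_heat_kernel e)).
    by apply: measurable_funB; [exact: measurable_fst|exact: measurable_snd].
  by apply: (measurableT_comp (mf i)); exact: measurable_snd.
by move=> z; rewrite lee_fin mulr_ge0 ?heat_kernel_ge0//; have /andP[] := f01 i z.2.
Qed.

(** Tonelli moves the mollification from [mu] to the test function, where it acts as the
    one-dimensional heat semigroup [T] on each factor. *)
Let mollify_phi e : 0 < e ->
  (\int[lebn]_x (mollify mu e x * phi x)%:E = \int[mu]_y (\prod_(i < d) T e i (tnth y i))%:E)%E.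
Proof.
move=> e0.
have mphi : measurable_fun setT phi by exact: measurable_prod_tnth.
have phi0 x : 0 <= phi x by apply: prodr_ge0 => i _; have /andP[] := f01 i (tnth x i).
have mF : measurable_fun setT (fun z : d.-tuple R * d.-tuple R =>
    (hkd e (tsub z.2 z.1) * phi z.1)%:E).
  apply/measurable_EFinP; apply: measurable_funM; first exact: measurable_hkd_tsub.
  by apply: (measurableT_comp mphi).
transitivity (\int[lebn]_x \int[mu]_y (hkd e (tsub y x) * phi x)%:E)%E.
  apply: eq_integral => x _.
  under eq_integral do rewrite EFinM.
  rewrite ge0_integralZr//; last 2 first.
  - by move=> y _; rewrite lee_fin hkd_ge0.
  - by rewrite lee_fin.
  - by rewrite EFinM /mollify /Rintegral fineK// integrable_fin_num//; exact: integrable_mollify.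
  - by apply/measurable_EFinP; exact: measurable_hkd_tsub.
rewrite (@fubini_tonelli _ _ _ _ _ lebn mu _ mF)/=; last first.
  by move=> z; rewrite lee_fin mulr_ge0 ?hkd_ge0.
apply: eq_integral => y _.
under eq_integral do (rewrite /hkd /phi -big_split/=; under eq_bigr do rewrite tnth_tsub).
rewrite (integral_prod_tnth (f := fun i r => heat_kernel e (tnth y i - r) * f i r)).
- rewrite -prodEFin; apply: eq_bigr => i _.
  by rewrite /T /Rintegral fineK// integrable_fin_num//; exact: ihkf.
- by move=> i; apply: measurable_funM; [exact: measurable_heat_kernelB|exact: mf].
- by move=> i r; rewrite mulr_ge0 ?heat_kernel_ge0//; have /andP[] := f01 i r.
Qed.

(** The factors [T] tend to [f] at rate [sqrt e] by the Lipschitz bound, and their products are at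
    most [1], which is integrable for the finite measure [mu]. *)
Lemma cvg_mollify_test :
  (\int[lebn]_x (mollify mu n.+1%:R^-1 x * \prod_(i < d) f i (tnth x i))%:E)%E @[n --> \oo] -->
  (\int[mu]_y (\prod_(i < d) f i (tnth y i))%:E)%E.
Proof.
under eq_fun do rewrite -/(phi _) mollify_phi//.
apply: (@dominated_cvg _ _ _ mu setT measurableT
  (fun n y => (\prod_(i < d) T n.+1%:R^-1 i (tnth y i))%:E) (fun y => (phi y)%:E) (fun=> 1%:E)) => //.
- by move=> n; apply/measurable_EFinP; apply: measurable_prod_tnth => i; exact: mT.
- move=> y _; apply: cvg_EFin; first exact: nearW.
  rewrite /phi; elim: (index_enum _) => [|i r IH].
    by under eq_fun do rewrite big_nil; rewrite big_nil; exact: cvg_cst.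
  under eq_fun do rewrite big_cons.
  rewrite big_cons; apply: cvgM => //.
  apply/cvgrPdist_le => eps eps0.
  have : C * (17 * Num.sqrt n.+1%:R^-1) @[n --> \oo] --> (0 : R).
    rewrite -[X in _ --> X](mulr0 C); apply: cvgMr.
    rewrite -[X in _ --> X](mulr0 17); apply: cvgMr.
    rewrite -[X in _ --> X]sqrtr0; apply: (cvg_comp _ (@Num.sqrt R) cvg_harmonic).
    exact: sqrt_continuous.
  move=> /cvgr0_norm_le/(_ _ eps0); apply: filterS => n.
  apply: le_trans; rewrite distrC; apply: le_trans (ler_norm _).
  exact: heat_kernel_approx.
- exact: finite_measure_integrable_cst.
- move=> n y _; rewrite /= lee_fin ger0_norm.
    by apply: prodr_le1 => i; exact: T01.
  by apply: prodr_ge0 => i _; have /andP[] := @T01 n.+1%:R^-1 i (tnth y i) ltac:(by []).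
Qed.

End mollify_test.

(** * Singular kernels on the line *)

Section singular_kernel.
Context {R : realType}.
Local Notation leb := (@lebesgue_measure R).
Implicit Types a r s L p q : R.

(* infinite at 0, where [powR] would give the junk value 0 *)
Definition singk a r : \bar R := if r == 0 then +oo%E else (`|r| `^ (- a))%:E.

Lemma singk_ge0 a r : (0 <= singk a r)%E.
Proof. by rewrite /singk; case: ifPn => // _; rewrite lee_fin powR_ge0. Qed.

Lemma singk_gt0 a r : (0 < singk a r)%E.
Proof. by rewrite /singk; case: ifPn => // r0; rewrite lte_fin powR_gt0// normr_gt0. Qed.

Lemma measurable_singk a : measurable_fun [set: R] (singk a).
Proof.
apply: measurable_fun_ifT => //; first exact: measurable_fun_eqr.
apply/measurable_EFinP.
apply: (@measurableT_comp _ _ _ _ _ _ (@powR R ^~ (- a))) => //.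
Qed.

(** The sign [sg] treats both sides of the singularity [s] at once, with the primitive
    [sg (sg (r - s))^(1 - a) / (1 - a)]. *)
Let singk_FTC a s p q (sg : R) : 0 < a < 1 -> sg ^+ 2 = 1 -> p < q ->
  (forall r, p <= r <= q -> 0 < sg * (r - s)) ->
  (\int[leb]_(r in `[p, q]) ((sg * (r - s)) `^ (- a))%:E =
   (sg * (sg * (q - s)) `^ (1 - a) / (1 - a) - sg * (sg * (p - s)) `^ (1 - a) / (1 - a))%:E)%E.
Proof.
move=> /andP[a0 a1] sg2 pq sg0.
pose f r := (sg * (r - s)) `^ (- a).
pose F r := sg * (sg * (r - s)) `^ (1 - a) / (1 - a).
have dlin r : is_derive r (1 : R) (fun r => sg * (r - s)) sg.
  by apply: is_derive_eq; rewrite /GRing.scale /=; ring.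
have dF r : p <= r <= q -> is_derive r (1 : R) F (f r).
  move=> prq; have d1 := is_derive1_powR (1 - a) (sg0 r prq).
  have d2 := @is_derive1_comp _ (fun x : R => x `^ (1 - a)) (fun r => sg * (r - s)) r _ _ d1 (dlin r).
  apply: is_derive_eq; rewrite /GRing.scale /= /f.
  have -> : 1 - a - 1 = - a by ring.
  transitivity (sg ^+ 2 * (sg * (r - s)) `^ (- a)); last by rewrite sg2 mul1r.
  by field; rewrite subr_eq0 gt_eqF.
have df r : p <= r <= q -> {for r, continuous f}.
  move=> prq; have d1 := is_derive1_powR (- a) (sg0 r prq).
  have d2 := @is_derive1_comp _ (fun x : R => x `^ (- a)) (fun r => sg * (r - s)) r _ _ d1 (dlin r).
  apply: differentiable_continuous; apply/derivable1_diffP.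
  exact: (@ex_derive _ _ _ _ _ _ _ d2).
have cF r : p <= r <= q -> {for r, continuous F}.
  move=> prq; apply: differentiable_continuous; apply/derivable1_diffP.
  exact: (@ex_derive _ _ _ _ _ _ _ (dF r prq)).
rewrite (@continuous_FTC2 _ f F) ?EFinB//.
- apply: continuous_in_subspaceT => r; rewrite inE/= in_itv/= => prq; exact: df.
- split=> [r||].
  + rewrite in_itv/= => /andP[pr rq].
    by apply: (@ex_derive _ _ _ _ _ _ _ (dF r _)); rewrite !ltW.
  + by apply: cvg_at_right_filter; apply: cF; rewrite lexx ltW.
  + by apply: cvg_at_left_filter; apply: cF; rewrite lexx ltW.
- move=> r; rewrite in_itv/= => /andP[pr rq]; rewrite derive1E.
  by apply: (@derive_val _ _ _ _ _ _ _ (dF r _)); rewrite !ltW.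
Qed.

(** For [0 < a < 1], the integral of [r^(-a)] over []0, L]]. *)
Definition singk_cst a L : R := L `^ (1 - a) / (1 - a).

Lemma singk_cst_ge0 a L : 0 < a < 1 -> 0 <= singk_cst a L.
Proof. by move=> /andP[a0 a1]; rewrite divr_ge0 ?powR_ge0//; lra. Qed.

Let singk_half_n a s L (sg : R) p q (n : nat) : 0 < a < 1 -> sg ^+ 2 = 1 ->
  (forall r, p <= r <= q -> 0 < sg * (r - s) <= L) ->
  (\int[leb]_(r in `[p, q]) singk a (r - s) <= (singk_cst a L)%:E)%E.
Proof.
move=> a01 sg2 sgL; have /andP[a0 a1] := a01.
have c0 := singk_cst_ge0 L a01.
have [pq|qp] := ltP p q; last first.
  rewrite (@integral_Sset1 _ (fun r => singk a (r - s)) _ q) ?lee_fin//.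
  by move=> r/=; rewrite in_itv/= => /andP[? ?]; lra.
have sg0 r : p <= r <= q -> 0 < sg * (r - s) by move=> /sgL/andP[].
have sg1 : `|sg| = 1.
  by apply/eqP; rewrite -(@eqrXn2 _ 2)// ?ler01// real_normK ?num_real// sg2 expr1n.
have -> : (\int[leb]_(r in `[p, q]) singk a (r - s) =
    \int[leb]_(r in `[p, q]) ((sg * (r - s)) `^ (- a))%:E)%E.
  apply: eq_integral => r; rewrite inE/= in_itv/= => /sg0 h.
  have rs : r - s != 0 by apply/eqP => E; move: h; rewrite E mulr0 ltxx.
  by rewrite /singk (negbTE rs) -(gtr0_norm h) normrM sg1 mul1r.
rewrite singk_FTC// lee_fin /singk_cst.
(* Up to the sign [sg], both values of the primitive lie between [0] and the constant, so their
   difference is at most the constant for either sign. *)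
have bnd x y : 0 <= x <= L -> 0 <= y <= L ->
    sg * x `^ (1 - a) / (1 - a) - sg * y `^ (1 - a) / (1 - a) <= L `^ (1 - a) / (1 - a).
  move=> /andP[x0 xL] /andP[y0 yL]; rewrite -mulrBl ler_pM2r ?invr_gt0; last by lra.
  rewrite -mulrBr.
  have hx : x `^ (1 - a) <= L `^ (1 - a) by rewrite ge0_ler_powR ?nnegrE//; lra.
  have hy : y `^ (1 - a) <= L `^ (1 - a) by rewrite ge0_ler_powR ?nnegrE//; lra.
  have px := powR_ge0 x (1 - a); have py := powR_ge0 y (1 - a).
  apply: (le_trans (ler_norm _)); rewrite normrM sg1 mul1r ler_norml; lra.
apply: bnd.
  by have /andP[? ?] := sgL q ltac:(by rewrite lexx ltW); apply/andP; split => //; exact: ltW.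
by have /andP[? ?] := sgL p ltac:(by rewrite lexx ltW); apply/andP; split => //; exact: ltW.
Qed.

Lemma measurable_singkB a s (D : set R) : measurable_fun D (fun r => singk a (r - s)).
Proof.
apply: measurable_funTS; apply: (measurableT_comp (measurable_singk a)).
exact: measurable_funB.
Qed.

(** A half-open interval adjacent to the singularity is exhausted by closed intervals that avoid it;
    monotone convergence preserves their common bound. *)
Let singk_half a s L (sg : R) (p q : nat -> R) (D : set R) : 0 < a < 1 -> sg ^+ 2 = 1 ->
  (forall n r, p n <= r <= q n -> 0 < sg * (r - s) <= L) ->
  {homo p : n m / (n <= m)%N >-> m <= n} -> {homo q : n m / (n <= m)%N >-> n <= m} ->
  D = \bigcup_n `[p n, q n]%classic ->
  (\int[leb]_(r in D) singk a (r - s) <= (singk_cst a L)%:E)%E.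
Proof.
move=> a01 sg2 sgL hp hq ->.
have h : (\int[leb]_(r in `[p n, q n]) singk a (r - s))%E @[n --> \oo] -->
    (\int[leb]_(r in \bigcup_n `[p n, q n]%classic) singk a (r - s))%E.
  apply: (@ge0_nondecreasing_set_cvg_integral _ (measurableTypeR R) R
    (fun n => `[p n, q n]%classic) (fun r => singk a (r - s))).
  - move=> n m nm; apply/subsetPset => r /=; rewrite !in_itv/= => /andP[pr rq].
    by rewrite (le_trans (hp _ _ nm))// (le_trans rq)// hq.
  - by move=> n; exact: measurable_itv.
  - by move=> n; exact: measurable_singkB.
  - by move=> n r _; exact: singk_ge0.
rewrite -(cvg_lim _ h)//; apply: lime_le; first exact: cvgP h.
by apply: nearW => n; apply: (singk_half_n 0 a01 sg2); exact: sgL.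
Qed.

Lemma integral_singk_le a s L (D : set R) : 0 < a < 1 -> 0 < L -> measurable D ->
  D `<=` `[s - L, s + L]%classic ->
  (\int[leb]_(r in D) singk a (r - s) <= (2 * singk_cst a L)%:E)%E.
Proof.
move=> a01 L0 mD DL.
have hr : (\int[leb]_(r in `]s, (s + L)%R]) singk a (r - s) <= (singk_cst a L)%:E)%E.
  apply: (@singk_half a s L 1 (fun n => s + n.+1%:R^-1) (fun=> s + L)) => //.
  - by rewrite expr1n.
  - move=> n r /andP[h1 h2]; rewrite mul1r.
    have n0 : 0 < n.+1%:R^-1 :> R by rewrite invr_gt0.
    by move: n0 h1 h2; move: (n.+1%:R^-1) => e *; lra.
  - by move=> n m nm; rewrite lerD2l lef_pV2 ?posrE// ler_nat.
  - apply/seteqP; split => r /=; rewrite in_itv/=.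
      move=> /andP[sr rL]; have rs : 0 < r - s by rewrite subr_gt0.
      have [n _ /(_ n (leqnn n))/= nr] : \forall n \near \oo, n.+1%:R^-1 <= r - s.
        have /cvgr0_norm_le/(_ _ rs) := @cvg_harmonic R.
        by apply: filterS => n; apply: le_trans; exact: ler_norm.
      by exists n => //=; rewrite in_itv/=; move: nr; move: (n.+1%:R^-1) => e ?; lra.
    move=> [n _] /=; rewrite in_itv/= => /andP[h1 h2].
    have n0 : 0 < n.+1%:R^-1 :> R by rewrite invr_gt0.
    by move: n0 h1 h2; move: (n.+1%:R^-1) => e *; lra.
have hl : (\int[leb]_(r in `[(s - L)%R, s[) singk a (r - s) <= (singk_cst a L)%:E)%E.
  apply: (@singk_half a s L (-1) (fun=> s - L) (fun n => s - n.+1%:R^-1)) => //.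
  - by rewrite sqrrN expr1n.
  - move=> n r /andP[h1 h2]; rewrite mulN1r.
    have n0 : 0 < n.+1%:R^-1 :> R by rewrite invr_gt0.
    by move: n0 h1 h2; move: (n.+1%:R^-1) => e *; lra.
  - by move=> n m nm; rewrite lerD2l lerN2 lef_pV2 ?posrE// ler_nat.
  - apply/seteqP; split => r /=; rewrite in_itv/=.
      move=> /andP[sr rL]; have rs : 0 < s - r by rewrite subr_gt0.
      have [n _ /(_ n (leqnn n))/= nr] : \forall n \near \oo, n.+1%:R^-1 <= s - r.
        have /cvgr0_norm_le/(_ _ rs) := @cvg_harmonic R.
        by apply: filterS => n; apply: le_trans; exact: ler_norm.
      by exists n => //=; rewrite in_itv/=; move: nr; move: (n.+1%:R^-1) => e ?; lra.
    move=> [n _] /=; rewrite in_itv/= => /andP[h1 h2].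
    have n0 : 0 < n.+1%:R^-1 :> R by rewrite invr_gt0.
    by move: n0 h1 h2; move: (n.+1%:R^-1) => e *; lra.
apply: (@le_trans _ _ (\int[leb]_(r in `[(s - L)%R, (s + L)%R]) singk a (r - s))%E).
  apply: ge0_subset_integral => //; first exact: measurable_singkB.
  by move=> r _; exact: singk_ge0.
(* The singular point is negligible; once it is removed, each side contributes [singk_cst a L]. *)
rewrite -(@integral_setD1 _ _ s); last 2 first.
- by apply: measurableD.
- exact: measurable_singkB.
have -> : `[s - L, s + L]%classic `\ s = `[s - L, s[%classic `|` `]s, s + L]%classic.
  apply/seteqP; split => r /=; rewrite !in_itv/=.
    move=> [/andP[h1 h2] /eqP rs]; have [rs'|rs'|E] := ltgtP r s; last by rewrite E eqxx in rs.
      by left; rewrite h1.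
    by right; rewrite h2 andbT.
  by move=> [/andP[h1 h2]|/andP[h1 h2]]; split; first [lra|apply/eqP; lra].
rewrite ge0_integral_setU//.
- by rewrite mulr_natl mulr2n EFinD leeD.
- exact: measurable_singkB.
- by move=> r _; exact: singk_ge0.
- rewrite disj_set2E; apply/eqP/seteqP; split => r //= [].
  by rewrite !in_itv/= => /andP[? ?] /andP[? ?]; lra.
Qed.

End singular_kernel.

(** * Variance of the increments of the noise *)

Section heat_integrand.
Context {R : realType}.
Local Notation leb := (@lebesgue_measure R).
Local Notation hk := (@heat_kernel R).
Local Notation hi := (@heat_integrand R).
Implicit Types t s x y r w tau h m : R.

Lemma measurable_spacetime : measurable (@spacetime R).
Proof.
rewrite (_ : spacetime = [set` `[0 : R, +oo[] `*` setT); last first.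
  by apply/seteqP; split => z; rewrite /spacetime /= in_itv/= andbT => // -[].
by apply: measurableX.
Qed.

Lemma measurable_heat_kernel_comp dT (T : measurableType dT) (f g : T -> R) :
  measurable_fun setT f -> measurable_fun setT g ->
  measurable_fun setT (fun z => hk (f z) (g z)).
Proof.
move=> mf mg.
have : measurable_fun setT ((fun z : R * R => hk z.1 z.2) \o (fun z => (f z, g z))).
  by apply: measurableT_comp; [exact: measurable_heat_kernel2|exact/measurable_fun_pairP].
exact.
Qed.

Lemma measurable_heat_integrand t x : measurable_fun setT (hi t x).
Proof.
apply: measurable_fun_ifT => //.
  by apply: measurable_fun_ltr.
by apply: measurable_heat_kernel_comp; apply: measurable_funB.
Qed.

Lemma integral_heat_kernel_sqr_le tau x : 0 < tau ->
  (\int[leb]_y ((hk tau (x - y)) ^+ 2)%:E <= ((Num.sqrt (4 * pi * tau))^-1)%:E)%E.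
Proof.
move=> tau0; set c := (Num.sqrt _)^-1.
apply: (@le_trans _ _ (\int[leb]_y (c%:E * (hk tau (x - y))%:E))%E).
  apply: ge0_le_integral => //.
  - by move=> y _; rewrite lee_fin sqr_ge0.
  - by apply/measurable_EFinP; apply: measurable_funX; exact: measurable_heat_kernelB.
  - by apply/measurable_EFinP; apply: measurable_funM => //; exact: measurable_heat_kernelB.
  - move=> y _; rewrite -EFinM lee_fin expr2 ler_wpM2r ?heat_kernel_ge0//.
    by apply: heat_kernel_le; exact: ltW.
rewrite ge0_integralZl//.
- by rewrite integral_heat_kernel// mule1.
- by apply/measurable_EFinP; exact: measurable_heat_kernelB.
- by move=> y _; rewrite lee_fin heat_kernel_ge0.
- by rewrite lee_fin invr_ge0.
Qed.

Lemma integral_lebesgue2 (f : R * R -> \bar R) : measurable_fun setT f ->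
  (forall z, 0 <= f z)%E ->
  (\int[lebesgue2]_z f z = \int[leb]_r \int[leb]_y f (r, y))%E.
Proof. by move=> mf f0; rewrite /lebesgue2 fubini_tonelli1. Qed.

Lemma measurable_integral_snd (f : R * R -> \bar R) : measurable_fun setT f ->
  (forall z, 0 <= f z)%E -> measurable_fun setT (fun r => \int[leb]_y f (r, y))%E.
Proof.
move=> mf f0; exact: (@measurable_fun_fubini_tonelli_F _ _ _ (measurableTypeR R) R leb f).
Qed.

(** At time [r < t] the space integral of the square is at most the supremum of the kernel times its
    mass, hence at most [(t - r)^(-1/2)], an integrable singularity. *)
Lemma heat_integrand_L2 t x : L2_spacetime (hi t x).
Proof.
rewrite /L2_spacetime.
have mS : measurable_fun setT (hi t x \_ spacetime).
  apply/(measurable_restrictT _ measurable_spacetime).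
  by apply: measurable_funTS; exact: measurable_heat_integrand.
apply: integrable_sqr_Lfun2 => //.
have mS2 : measurable_fun setT (fun z => (((hi t x \_ spacetime) z) ^+ 2)%:E).
  by apply/measurable_EFinP; exact: measurable_funX.
rewrite integral_lebesgue2//; last by move=> z; rewrite lee_fin sqr_ge0.
have [t0|t0] := ltP 0 t; last first.
  rewrite (eq_integral (cst 0%E)) ?integral0 ?ltry// => r _.
  rewrite (eq_integral (cst 0%E)) ?integral0// => y _.
  rewrite patchE; case: ifPn => [|_]; last by rewrite expr0n.
  rewrite inE /spacetime/= /heat_integrand /= => r0; case: ifPn => //; last by rewrite expr0n.
  by move=> /(le_lt_trans r0); rewrite ltNge t0.
apply: (@le_lt_trans _ _ (\int[leb]_(r in `[0%R, t]) singk (2^-1) (r - t))%E); last first.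
  apply: le_lt_trans (integral_singk_le (L := t) _ _ _ _) _; rewrite ?ltry//.
  - lra.
  - by move=> r; rewrite /= !in_itv/=; lra.
rewrite [leRHS]integral_mkcond; apply: ge0_le_integral => //.
- by move=> r _; apply: integral_ge0 => y _; rewrite lee_fin sqr_ge0.
- by apply: (measurable_integral_snd mS2) => z; rewrite lee_fin sqr_ge0.
- apply/(measurable_restrictT _ (measurable_itv _)); exact: measurable_singkB.
move=> r _; rewrite patchE.
have [r0|r0] := ltP r 0.
  rewrite (eq_integral (cst 0%E)) ?integral0 => [|y _].
    by case: ifPn => // _; exact: singk_ge0.
  by rewrite patchE memNset ?expr0n// /spacetime /=; lra.
have [tr|rt] := leP t r.
  rewrite (eq_integral (cst 0%E)) ?integral0 => [|y _].
    by case: ifPn => // _; exact: singk_ge0.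
  by rewrite patchE; case: ifPn => _; rewrite ?expr0n// /heat_integrand/= ltNge tr expr0n.
rewrite mem_set/=; last by rewrite in_itv/= r0 ltW.
have tr0 : 0 < t - r by rewrite subr_gt0.
have -> : (\int[leb]_y (((hi t x \_ spacetime) (r, y)) ^+ 2)%:E =
    \int[leb]_y ((hk (t - r) (x - y)) ^+ 2)%:E)%E.
  by apply: eq_integral => y _; rewrite patchE mem_set// /heat_integrand /= rt.
apply: le_trans (integral_heat_kernel_sqr_le x tr0) _.
rewrite /singk subr_eq0 lt_eqF// lee_fin distrC gtr0_norm// powRN powR12_sqrt; last exact: ltW.
rewrite lef_pV2 ?posrE ?sqrtr_gt0 ?mulr_gt0 ?pi_gt0// ler_wsqrtr// ler_peMl ?(ltW tr0)//.
by have := @pi_ge2 R; lra.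
Qed.

(** For [r^2 <= 2 tau] the exponential is at least [exp(- 1/2) >= 1/2], and the normalisation is
    smallest at [tau = h]. *)
Lemma heat_kernel_lower tau h r : 0 < tau <= h -> r ^+ 2 <= 2 * tau ->
  (2 * Num.sqrt (4 * pi * h))^-1 <= hk tau r.
Proof.
move=> /andP[tau0 tauh] r2; have h0 : 0 < h by exact: lt_le_trans tauh.
rewrite invfM mulrC /heat_kernel; apply: ler_pM; rewrite ?invr_ge0//.
- rewrite lef_pV2 ?posrE ?sqrtr_gt0 ?mulr_gt0 ?pi_gt0// ler_wsqrtr//.
  by rewrite ler_pM2l ?mulr_gt0 ?pi_gt0.
- apply: (@le_trans _ _ (expR (- 2^-1))).
    by apply: le_trans (expR_ge1Dx _); lra.
  rewrite ler_expR lerN2 ler_pdivrMr ?mulr_gt0//; lra.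
Qed.

(** Uniform in [tau]: with [q = r / sqrt tau] the claim is [q exp(- q^2 / 4) <= 1], which follows
    from [q <= 1 + q^2 / 4]. *)
Lemma heat_kernel_upper tau r : 0 < tau -> 0 < r -> hk tau r <= (Num.sqrt (4 * pi) * r)^-1.
Proof.
move=> tau0 r0; have s0 : 0 < Num.sqrt tau by rewrite sqrtr_gt0.
have p0 : 0 < Num.sqrt (4 * pi : R) by rewrite sqrtr_gt0 mulr_gt0 ?pi_gt0.
rewrite /heat_kernel sqrtrM ?mulr_ge0 ?pi_ge0// !invfM -mulrA ler_pM2l ?invr_gt0//.
rewrite expRN -[leLHS]invfM lef_pV2 ?posrE ?mulr_gt0 ?expR_gt0//.
rewrite -ler_pdivrMl// mulrC.
apply: le_trans (expR_ge1Dx _).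
have -> : r ^+ 2 * (4^-1 / tau) = (r / Num.sqrt tau) ^+ 2 / 4.
  by rewrite -{1}(sqr_sqrtr (ltW tau0)); field; rewrite gt_eqF.
by have := sqr_ge0 (r / Num.sqrt tau / 2 - 1); lra.
Qed.

Lemma integral_sqr_box_ge (f : R * R -> R) r1 r2 y1 y2 (k : R) :
  measurable_fun setT f -> 0 <= r1 -> r1 <= r2 -> y1 <= y2 -> 0 <= k ->
  (forall r y, r1 <= r <= r2 -> y1 <= y <= y2 -> k <= `|f (r, y)|) ->
  (((r2 - r1) * (y2 - y1) * k ^+ 2)%:E <= \int[lebesgue2]_(z in spacetime) ((f z) ^+ 2)%:E)%E.
Proof.
move=> mf r10 r12 y12 k0 fk.
pose D : set (R * R) := `[r1, r2]%classic `*` `[y1, y2]%classic.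
have mD : measurable D by apply: measurableX; exact: measurable_itv.
have mf2 E : measurable_fun E (fun z => ((f z) ^+ 2)%:E).
  by apply: measurable_funTS; apply/measurable_EFinP; exact: measurable_funX.
apply: (@le_trans _ _ (\int[lebesgue2]_(z in D) ((f z) ^+ 2)%:E)%E); last first.
  apply: ge0_subset_integral => //; first exact: measurable_spacetime.
  - exact: mf2.
  - by move=> z _; rewrite lee_fin sqr_ge0.
  - by move=> z [/=]; rewrite in_itv/= => /andP[rz _] _; rewrite /spacetime/= (le_trans r10).
apply: (@le_trans _ _ (\int[lebesgue2]_(z in D) (k ^+ 2)%:E)%E).
  rewrite integral_cst//.
  have -> : lebesgue2 D = (leb `[r1, r2]%classic * leb `[y1, y2]%classic)%E.
    by apply: product_measure1E; exact: measurable_itv.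
  rewrite !lebesgue_measure_itv/= !lte_fin.
  have h (a b : R) : a <= b -> (if a < b then (b%:E - a%:E)%E else 0%E) = (b - a)%:E.
    by rewrite le_eqVlt => /predU1P[->|->]; rewrite ?ltxx ?subrr// EFinB.
  by rewrite !h// -!EFinM mulrC.
apply: ge0_le_integral => //.
- by move=> z _; rewrite lee_fin sqr_ge0.
- exact: mf2.
- move=> [r y] [/=]; rewrite !in_itv/= => rr yy; rewrite lee_fin -(real_normK (num_real (f _))).
  by rewrite lerXn2r ?nnegrE//; exact: fk.
Qed.

(* With [h = t - s], the box [s, (s + t) / 2] x [x - sqrt h, x + sqrt h] contributes
   [sqrt h / (16 pi)]; with [m = min(|x - y|, sqrt s)], the box
   [s - m^2 / 16, s - m^2 / 32] x [y - m / 8, y + m / 8] contributes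
   [m / (128 * 16 pi)]. *)
Definition vcst : R := (128 * 16 * pi)^-1.

Let vcst_gt0 : 0 < vcst. Proof. by rewrite invr_gt0 mulr_gt0 ?pi_gt0. Qed.

Let variance_time t x s y : 0 <= s -> s < t ->
  ((vcst * Num.sqrt (t - s))%:E <=
   \int[lebesgue2]_(z in spacetime) ((hi t x z - hi s y z) ^+ 2)%:E)%E.
Proof.
move=> s0 st; have [h hE] : exists h, h = t - s by exists (t - s).
rewrite -hE; have h0 : 0 < h by rewrite hE subr_gt0.
have [q qE] : exists q, q = Num.sqrt h by exists (Num.sqrt h).
rewrite -qE; have q0 : 0 < q by rewrite qE sqrtr_gt0.
have q2 : q ^+ 2 = h by rewrite qE sqr_sqrtr// ltW.
pose k := (2 * Num.sqrt (4 * pi * h))^-1.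
have pi0 := @pi_gt0 R.
apply: le_trans (@integral_sqr_box_ge (fun z => hi t x z - hi s y z) s ((s + t) / 2) (x - q) (x + q) k _ _ _ _ _ _).
- rewrite lee_fin /k exprVn exprMn sqr_sqrtr; last by rewrite !mulr_ge0// ltW.
  rewrite (_ : (s + t) / 2 - s = h / 2); last by rewrite hE; field.
  rewrite (_ : x + q - (x - q) = 2 * q); last by ring.
  rewrite (_ : _ * _ * _ = q / (16 * pi)); last first.
    by move: (@pi R) pi0 => p p0; field; rewrite !gt_eqF.
  by rewrite /vcst mulrC ler_pM2l// lef_pV2 ?posrE ?mulr_gt0// ler_pM2r//; lra.
- by apply: measurable_funB; exact: measurable_heat_integrand.
- by [].
- lra.
- lra.
- by rewrite invr_ge0 mulr_ge0.
- move=> r w /andP[sr rt] /andP[w1 w2].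
  (* On this box the second integrand vanishes, since [r >= s], and [t - r] lies between [h / 2] and
     [h]. *)
  rewrite /heat_integrand /= [r < s]ltNge sr/= subr0.
  have -> : r < t by lra.
  rewrite ger0_norm ?heat_kernel_ge0//; apply: heat_kernel_lower; first by rewrite hE; lra.
  apply: (@le_trans _ _ h); last by rewrite hE; lra.
  rewrite -q2 -[leLHS](real_normK (num_real _)) lerXn2r ?nnegrE ?(ltW q0)//.
  by rewrite ler_norml; apply/andP; split; lra.
Qed.

(** Just before time [s] and close to [y], the kernel issued from [(s, y)] is at least [2 / (c m)],
    while the one from [(t, x)], seen from a distance of at least [3 m / 4], is at most
    [(4/3) / (c m)]; the difference exceeds [k = (1/2) / (c m)]. The inequality [m^2 <= s] keeps the
    box in nonnegative times. *)
Let variance_space t x s y : 0 < s -> s <= t -> x != y ->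
  ((vcst * Num.min `|x - y| (Num.sqrt s))%:E <=
   \int[lebesgue2]_(z in spacetime) ((hi t x z - hi s y z) ^+ 2)%:E)%E.
Proof.
move=> s0 st xy; have [m mE] : exists m, m = Num.min `|x - y| (Num.sqrt s).
  by exists (Num.min `|x - y| (Num.sqrt s)).
rewrite -mE; have m0 : 0 < m by rewrite mE lt_min normr_gt0 subr_eq0 xy sqrtr_gt0.
have mxy : m <= `|x - y| by rewrite mE ge_min lexx.
have ms : m ^+ 2 <= s.
  rewrite -[leRHS](sqr_sqrtr (ltW s0)) lerXn2r ?nnegrE ?(ltW m0) ?sqrtr_ge0//.
  by rewrite mE ge_min lexx orbT.
have pi0 := @pi_gt0 R.
have c0 : 0 < Num.sqrt (4 * pi : R) by rewrite sqrtr_gt0 mulr_gt0.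
have [c cE] : exists c, c = Num.sqrt (4 * pi : R) by exists (Num.sqrt (4 * pi)).
rewrite -cE in c0; have c2 : c ^+ 2 = 4 * pi by rewrite cE sqr_sqrtr// mulr_ge0// ltW.
have cm0 : 0 < c * m by rewrite mulr_gt0.
pose k := 2^-1 / (c * m).
have m20 : 0 < m ^+ 2 by rewrite exprn_gt0.
apply: le_trans (@integral_sqr_box_ge (fun z => hi t x z - hi s y z)
  (s - m ^+ 2 / 16) (s - m ^+ 2 / 32) (y - m / 8) (y + m / 8) k _ _ _ _ _ _).
- rewrite lee_fin le_eqVlt; apply/orP; left; apply/eqP.
  transitivity (m ^+ 2 / 32 * (m / 4) * (4^-1 / (c ^+ 2 * m ^+ 2))).
    by rewrite c2 /vcst; move: (@pi R) pi0 => p p0; field; rewrite !gt_eqF.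
  by rewrite /k; field; rewrite !gt_eqF//.
- by apply: measurable_funB; exact: measurable_heat_integrand.
- lra.
- lra.
- lra.
- by rewrite divr_ge0// (ltW cm0).
- move=> r w /andP[r1 r2] /andP[w1 w2].
  have rs : r < s by lra.
  rewrite /heat_integrand /= rs (lt_le_trans rs st).
  have L : 2 / (c * m) <= hk (s - r) (y - w).
    have := @heat_kernel_lower (s - r) (m ^+ 2 / 16) (y - w).
    have -> : Num.sqrt (4 * pi * (m ^+ 2 / 16)) = c * (m / 4).
      rewrite (_ : m ^+ 2 / 16 = (m / 4) ^+ 2); last by field.
      rewrite sqrtrM ?mulr_ge0 ?(ltW pi0)// -cE sqrtr_sqr ger0_norm//.
      by rewrite divr_ge0// (ltW m0).
    rewrite (_ : (2 * _)^-1 = 2 / (c * m)); last by field; rewrite !gt_eqF//.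
    apply; first lra.
    apply: (@le_trans _ _ ((m / 8) ^+ 2)).
      rewrite -[leLHS](real_normK (num_real _)) lerXn2r ?nnegrE//.
        by rewrite divr_ge0// (ltW m0).
      by rewrite ler_norml; apply/andP; split; lra.
    rewrite (_ : (m / 8) ^+ 2 = m ^+ 2 / 64); [lra|by field].
  have U : hk (t - r) (x - w) <= (4 / 3) / (c * m).
    have xw : 3 * m / 4 <= `|x - w|.
      have E : x - w = (x - y) + (y - w) by ring.
      have : `|y - w| <= m / 8 by rewrite ler_norml; apply/andP; split; lra.
      by have := lerB_normD (x - y) (y - w); rewrite -E; lra.
    have -> : hk (t - r) (x - w) = hk (t - r) `|x - w|.
      by rewrite /heat_kernel real_normK ?num_real.
    apply: (le_trans (heat_kernel_upper _ _)); [lra|lra|].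
    rewrite -cE (_ : (4 / 3) / (c * m) = (c * (3 * m / 4))^-1); last by field; rewrite !gt_eqF//.
    have m34 : 0 < 3 * m / 4 by lra.
    rewrite lef_pV2 ?posrE ?(mulr_gt0 c0 m34) ?(mulr_gt0 c0 (lt_le_trans m34 xw))//.
    by rewrite ler_pM2l.
  rewrite distrC (le_trans _ (ler_norm _))//.
  move: L U; rewrite /k ![_ / (c * m)]mulrC.
  have : 0 < (c * m)^-1 by rewrite invr_gt0.
  by move: ((c * m)^-1) => v *; lra.
Qed.

Lemma variance_ge t x s y : 0 < s -> 0 < t ->
  ((vcst * Num.sqrt `|t - s|)%:E <=
   \int[lebesgue2]_(z in spacetime) ((hi t x z - hi s y z) ^+ 2)%:E)%E /\
  ((vcst * Num.min `|x - y| (Num.sqrt (Num.min t s)))%:E <=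
   \int[lebesgue2]_(z in spacetime) ((hi t x z - hi s y z) ^+ 2)%:E)%E.
Proof.
wlog st : t x s y / s <= t => [H s0 t0|s0 t0].
  have /orP[st|ts] := le_total s t; first exact: H.
  have [h1 h2] := H s y t x ts t0 s0.
  rewrite distrC (distrC x) (minC t s).
  have -> : (\int[lebesgue2]_(z in spacetime) ((hi t x z - hi s y z) ^+ 2)%:E =
     \int[lebesgue2]_(z in spacetime) ((hi s y z - hi t x z) ^+ 2)%:E)%E.
    by apply: eq_integral => z _; rewrite -sqrrN opprB.
  by split.
have ge0 t' x' : (0 <= \int[lebesgue2]_(z in spacetime) ((hi t' x' z - hi s y z) ^+ 2)%:E)%E.
  by apply: integral_ge0 => z _; rewrite lee_fin sqr_ge0.
split.
  move: st; rewrite le_eqVlt => /predU1P[<-|st].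
    by rewrite subrr normr0 sqrtr0 mulr0; exact: ge0.
  by rewrite gtr0_norm ?subr_gt0//; apply: variance_time => //; exact: ltW.
rewrite (min_idPr st).
have [->|xy] := eqVneq x y; last exact: variance_space.
by rewrite subrr normr0 (min_idPl _) ?sqrtr_ge0// mulr0; exact: ge0.
Qed.

End heat_integrand.

(** * The pair kernel *)

Section restriction.
Context d (T : measurableType d) (R : realType).

Lemma ge0_integral_mrestr (mu : {measure set T -> \bar R}) (D : set T) (mD : measurable D)
    (f : T -> \bar R) : measurable_fun setT f -> (forall x, 0 <= f x)%E ->
  (\int[mrestr mu mD]_x f x = \int[mu]_(x in D) f x)%E.
Proof.
move=> mf f0; transitivity (\int[mrestr mu mD]_(x in D) f x)%E; last first.
  by apply: eq_measure_integral => A mA AD; rewrite /= /mrestr setIidl.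
rewrite [LHS](@ge0_negligible_integral _ _ _ (mrestr mu mD) setT (~` D))//.
- by rewrite setTD setCK.
- exact: measurableC.
- by rewrite /= /mrestr setICl measure0.
Qed.

Lemma integral_mrestr (mu : {measure set T -> \bar R}) (D : set T) (mD : measurable D)
    (f : T -> \bar R) : measurable_fun setT f ->
  (\int[mrestr mu mD]_x f x = \int[mu]_(x in D) f x)%E.
Proof.
move=> mf; rewrite [LHS]integralE [RHS]integralE; congr (_ - _)%E; apply: ge0_integral_mrestr => //.
  exact: measurable_funepos.
exact: measurable_funeneg.
Qed.

Lemma le_integral_mrestr (mu : {measure set T -> \bar R}) (D : set T) (mD : measurable D)
    (f g : T -> \bar R) : measurable_fun setT f -> (forall x, 0 <= f x)%E ->
  measurable_fun setT g -> (forall x, 0 <= g x)%E -> (forall x, D x -> f x <= g x)%E ->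
  (\int[mrestr mu mD]_x f x <= \int[mrestr mu mD]_x g x)%E.
Proof.
move=> mf f0 mg g0 fg; rewrite !ge0_integral_mrestr//.
by apply: ge0_le_integral => //; apply: measurable_funTS.
Qed.

End restriction.

Section pair_kernel.
Context {R : realType}.
Local Notation leb := (@lebesgue_measure R).
Local Notation K78 := (@singk R (7 / 8)).
Local Notation K34 := (@singk R (3 / 4)).
Local Notation K38 := (@singk R (3 / 8)).
Implicit Types (t x s y C : R) (z : R * R).

Lemma singkN a x : singk a (- x) = singk a x.
Proof. by rewrite /singk oppr_eq0 normrN. Qed.

(** Takes values in the extended reals: it is infinite when a time is [0] or the two points
    coincide, so that the bound on increments holds on the whole rectangle without exceptional
    sets. *)
Definition pairk C z z' : \bar R :=
  (1 + C%:E * (K78 (z.1 - z'.1)%R * (K34 (z.2 - z'.2)%R + K38 z.1 + K38 z'.1)))%E.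

Lemma pairk_pinfty C z z' : 0 < C -> [\/ z.1 = 0, z'.1 = 0 | z = z'] -> pairk C z z' = +oo%E.
Proof.
move=> C0 zz'; rewrite /pairk.
have kN (c b : R) : singk c b != -oo%E by rewrite -ltNye (lt_le_trans _ (singk_ge0 _ _)).
suff -> : (K34 (z.2 - z'.2)%R + K38 z.1 + K38 z'.1 = +oo)%E.
  by rewrite !gt0_muley ?lte_fin ?singk_gt0.
have K0 c : @singk R c 0 = +oo%E by rewrite /singk eqxx.
case: zz' => [->|->|->]; rewrite ?subrr K0.
- by rewrite addey// addye.
- by rewrite addey//; rewrite adde_eq_ninfty negb_or !kN.
- by rewrite !addye.
Qed.

Let powRN_le (a b p : R) : 0 < a -> a <= b -> 0 <= p -> b `^ (- p) <= a `^ (- p).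
Proof.
move=> a0 ab p0; rewrite !powRN lef_pV2 ?posrE ?powR_gt0 ?(lt_le_trans a0)//.
by apply: ge0_ler_powR; rewrite ?nnegrE ?(ltW a0)// (le_trans (ltW a0)).
Qed.

Let singk_sum_gt0 t x s y : (0 < K34 (x - y)%R + K38 t + K38 s)%E.
Proof.
by apply: adde_gt0; [apply: adde_gt0|]; exact: singk_gt0.
Qed.

Lemma pairk_ge t x s y (v S : R) (d : nat) : (d < 6)%N -> 0 < v -> 0 < s -> 0 < t ->
  v * Num.sqrt `|t - s| <= S ->
  v * Num.min `|x - y| (Num.sqrt (Num.min t s)) <= S ->
  ((((Num.sqrt (2 * pi * S))^-1) ^+ d)%:E <=
   pairk ((2 * pi * v) `^ (- (5 / 2))) (t, x) (s, y))%E.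
Proof.
move=> d6 v0 s0 t0 Sts Sxy; rewrite /pairk /=.
have k0 : 0 < 2 * pi * v by rewrite !mulr_gt0 ?pi_gt0.
set k := 2 * pi * v in k0 *.
have kC : 0 < k `^ (- (5 / 2)) by rewrite powR_gt0.
have [->|ts] := eqVneq t s.
  rewrite {1}/singk subrr eqxx gt0_mulye ?singk_sum_gt0// gt0_muley ?lte_fin//.
  by rewrite addey// leey.
have [->|xy] := eqVneq x y.
  have kN (c b : R) : singk c b != -oo%E by rewrite -ltNye (lt_le_trans _ (singk_ge0 _ _)).
  rewrite {2}/singk subrr eqxx !addye// !gt0_muley ?lte_fin//; last exact: singk_gt0.
  by rewrite addey// leey.
rewrite /singk !subr_eq0 (negbTE ts) (negbTE xy) (gt_eqF t0) (gt_eqF s0).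
rewrite -[leRHS]/((1 + k `^ (- (5 / 2)) * (`|t - s| `^ (- (7 / 8)) *
  (`|x - y| `^ (- (3 / 4)) + `|t| `^ (- (3 / 8)) + `|s| `^ (- (3 / 8)))))%:E) lee_fin.
have a0 : 0 < `|t - s| by rewrite normr_gt0 subr_eq0.
have [a aE] : exists a, a = `|t - s| by exists `|t - s|.
have m0 : 0 < Num.min `|x - y| (Num.sqrt (Num.min t s)).
  by rewrite !lt_min normr_gt0 subr_eq0 xy sqrtr_gt0 lt_min t0.
have [m mE] : exists m, m = Num.min `|x - y| (Num.sqrt (Num.min t s)).
  by exists (Num.min `|x - y| (Num.sqrt (Num.min t s))).
rewrite -!aE -!mE in a0 m0 Sts Sxy *.
(* A negative power of a minimum is at most the sum of the negative powers of its terms; the square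
   root halves [3/4] to [3/8] on the times. *)
have mm : m `^ (- (3 / 4)) <= `|x - y| `^ (- (3 / 4)) + `|t| `^ (- (3 / 8)) + `|s| `^ (- (3 / 8)).
  have hs r : 0 < r -> Num.sqrt r `^ (- (3 / 4)) = `|r| `^ (- (3 / 8)).
    move=> r0; rewrite -powR12_sqrt ?ltW// -powRrM gtr0_norm//.
    by congr (_ `^ _); field.
  rewrite mE; have [_|_] := leP `|x - y| (Num.sqrt (Num.min t s)).
    by rewrite -addrA lerDl addr_ge0 ?powR_ge0.
  have [_|_] := leP t s; rewrite hs//.
    by rewrite -addrA addrCA lerDl addr_ge0 ?powR_ge0.
  by rewrite lerDr addr_ge0 ?powR_ge0.
have [r rE] : exists r, r = 2 * pi * S by exists (2 * pi * S).
rewrite -rE.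
have r1 : k * Num.sqrt a <= r by rewrite rE /k -mulrA ler_pM2l// mulr_gt0 ?pi_gt0.
have r2 : k * m <= r by rewrite rE /k -mulrA ler_pM2l// mulr_gt0 ?pi_gt0.
have r0 : 0 < r by rewrite (lt_le_trans _ r2)// mulr_gt0.
apply: (@le_trans _ _ (1 + r `^ (- (5 / 2)))).
  have -> : r `^ (- (5 / 2)) = (Num.sqrt r)^-1 ^+ 5.
    rewrite -powR12_sqrt ?ltW// -powRN -powR_mulrn ?powR_ge0// -powRrM.
    by congr (_ `^ _); field.
  (* When the density bound is at most [1] the summand [1] of the kernel suffices; otherwise powers
     increase with the exponent and [d] may be replaced by [5]. *)
  have [r11|r11] := leP (Num.sqrt r)^-1 1.
    rewrite (@le_trans _ _ 1)// ?exprn_ile1 ?invr_ge0 ?sqrtr_ge0//.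
    by rewrite lerDl exprn_ge0// invr_ge0 sqrtr_ge0.
  rewrite (@le_trans _ _ ((Num.sqrt r)^-1 ^+ 5))// ?lerDr//.
  by rewrite ler_weXn2l// ltW.
rewrite lerD2l.
(* The time bound is spent on the exponent [7/4], which its square root halves to [7/8], and the
   space bound on [3/4]; both singularities stay integrable. *)
have -> : r `^ (- (5 / 2)) = r `^ (- (7 / 4)) * r `^ (- (3 / 4)).
  by rewrite -powRD ?(gt_eqF r0) ?implybT//; congr (_ `^ _); field.
apply: (@le_trans _ _ ((k * Num.sqrt a) `^ (- (7 / 4)) * (k * m) `^ (- (3 / 4)))).
  have ka0 : 0 < k * Num.sqrt a by rewrite mulr_gt0 ?sqrtr_gt0.
  have km0 : 0 < k * m by rewrite mulr_gt0.
  by apply: ler_pM; rewrite ?powR_ge0//; apply: powRN_le => //; rewrite divr_ge0.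
rewrite (powRM _ (ltW k0) (sqrtr_ge0 _)) (powRM _ (ltW k0) (ltW m0)).
rewrite (_ : _ * _ * (_ * _) = k `^ (- (7 / 4)) * k `^ (- (3 / 4)) *
  (Num.sqrt a `^ (- (7 / 4)) * m `^ (- (3 / 4)))); last by ring.
rewrite -powRD ?(gt_eqF k0) ?implybT//.
rewrite (_ : - (7 / 4) - 3 / 4 = - (5 / 2)); last by field.
rewrite -(powR12_sqrt (ltW a0)) -powRrM.
rewrite (_ : 2^-1 * - (7 / 4) = - (7 / 8)); last by field.
by rewrite ler_wpM2l ?(ltW kC)// ler_wpM2l ?powR_ge0.
Qed.

End pair_kernel.

(** * Integrability of the pair kernel over a rectangle *)

Section pair_kernel_integral.
Context {R : realType}.
Local Notation leb := (@lebesgue_measure R).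
Local Notation K78 := (@singk R (7 / 8)).
Local Notation K34 := (@singk R (3 / 4)).
Local Notation K38 := (@singk R (3 / 8)).
Implicit Types (t x s y C : R) (z : R * R).

Lemma measurable_singk_comp d (T : measurableType d) a (f : T -> R) (D : set T) :
  measurable_fun setT f -> measurable_fun D (fun w => singk a (f w)).
Proof.
by move=> mf; apply: measurable_funTS; apply: (measurableT_comp (measurable_singk a)).
Qed.

Lemma measurable_pairk C : measurable_fun setT (fun p : (R * R) * (R * R) => pairk C p.1 p.2).
Proof.
have m11 : measurable_fun setT (fun p : (R * R) * (R * R) => p.1.1).
  exact: (measurableT_comp measurable_fst measurable_fst).
have m12 : measurable_fun setT (fun p : (R * R) * (R * R) => p.1.2).
  exact: (measurableT_comp measurable_snd measurable_fst).
have m21 : measurable_fun setT (fun p : (R * R) * (R * R) => p.2.1).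
  exact: (measurableT_comp measurable_fst measurable_snd).
have m22 : measurable_fun setT (fun p : (R * R) * (R * R) => p.2.2).
  exact: (measurableT_comp measurable_snd measurable_snd).
apply: emeasurable_funD => //; apply: emeasurable_funM => //.
apply: emeasurable_funM.
  by apply: measurable_singk_comp; exact: measurable_funB.
apply: emeasurable_funD; last exact: measurable_singk_comp.
apply: emeasurable_funD; last exact: measurable_singk_comp.
by apply: measurable_singk_comp; exact: measurable_funB.
Qed.

Lemma pairk_ge0 C z z' : 0 <= C -> (0 <= pairk C z z')%E.
Proof.
by move=> C0; rewrite adde_ge0// mule_ge0 ?lee_fin// mule_ge0 ?singk_ge0// !adde_ge0 ?singk_ge0.
Qed.

Local Notation Z := (measurableTypeR R * measurableTypeR R)%type.
Variables (M C : R) (A B : set R) (m : {finite_measure set Z -> \bar R}).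
Hypotheses (M0 : 0 < M) (C0 : 0 <= C) (mA : measurable A) (mB : measurable B)
  (AM : A `<=` `[- M, M]) (BM : B `<=` `[- M, M]).
(** Expresses that [m] is Lebesgue measure restricted to the rectangle with sides [A] and [B], in
    the form of iterated integrals. *)
Hypothesis mE : forall f : Z -> \bar R, measurable_fun setT f -> (forall z, 0 <= f z)%E ->
  (\int[m]_z f z = \int[leb]_(r in A) \int[leb]_(y in B) f (r, y))%E.

Let c (a : R) : R := 2 * singk_cst a (2 * M).

(** Seen from a point of [[- M, M]], the set [D] lies within distance [2 M]. *)
Let sing_le a t (D : set R) : 0 < a < 1 -> measurable D -> D `<=` `[- M, M] -> t \in `[- M, M] ->
  (\int[leb]_(r in D) singk a (t - r) <= (c a)%:E)%E.
Proof.
move=> a01 mD DM; rewrite in_itv/= => tM.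
have -> : (\int[leb]_(r in D) singk a (t - r) = \int[leb]_(r in D) singk a (r - t))%E.
  by apply: eq_integral => r _; rewrite -singkN opprB.
apply: integral_singk_le => //; first by rewrite mulr_gt0.
move=> r /DM /=; rewrite !in_itv/= => rM; apply/andP; split; lra.
Qed.

Let leb_le (D : set R) : measurable D -> D `<=` `[- M, M] -> (leb D <= (2 * M)%:E)%E.
Proof.
move=> mD DM; apply: (@le_trans _ _ (leb `[- M, M])).
  by apply: le_measure; rewrite ?inE//; exact: measurable_itv.
rewrite lebesgue_measure_itv/= lte_fin ifT; last by rewrite (lt_trans _ M0)// oppr_lt0.
by rewrite -EFinB lee_fin opprK mulr_natl mulr2n.
Qed.

Let c_ge0 a : 0 < a < 1 -> 0 <= c a.
Proof. by move=> a01; rewrite mulr_ge0// singk_cst_ge0. Qed.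

Let termC (z : R * R) : A z.1 -> B z.2 ->
  (\int[m]_z' (K78 (z.1 - z'.1)%R * K34 (z.2 - z'.2)%R) <= (c (3 / 4) * c (7 / 8))%:E)%E.
Proof.
case: z => t x /= At Bx; rewrite mE.
- have ms a D u : measurable_fun D (fun r : R => singk a (u - r)).
    by apply: measurable_singk_comp; exact: measurable_funB.
  have -> : (\int[leb]_(r in A) \int[leb]_(y in B) (K78 (t - r)%R * K34 (x - y)%R) =
      \int[leb]_(r in A) (K78 (t - r)%R * \int[leb]_(y in B) K34 (x - y)%R))%E.
    by apply: eq_integral => r _; apply: ge0_integralZl; [| |move=> *|]; first [exact: singk_ge0|exact: ms|exact: mB].
  rewrite ge0_integralZr//; last 3 first.
  - exact: ms.
  - by move=> *; exact: singk_ge0.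
  - by apply: integral_ge0 => *; exact: singk_ge0.
  rewrite muleC EFinM lee_pmul//; [| |apply: sing_le|apply: sing_le] => //.
  - by apply: integral_ge0 => *; exact: singk_ge0.
  - by apply: integral_ge0 => *; exact: singk_ge0.
  - by apply/andP; split; lra.
  - exact: BM.
  - by apply/andP; split; lra.
  - exact: AM.
- by apply: emeasurable_funM; apply: measurable_singk_comp; apply: measurable_funB.
- by move=> z; rewrite mule_ge0 ?singk_ge0.
Qed.

Let termT (z : R * R) : A z.1 ->
  (\int[m]_z' (K78 (z.1 - z'.1)%R * K38 z.1) <= K38 z.1 * (c (7 / 8) * (2 * M))%:E)%E.
Proof.
case: z => t x /= At.
have m1 : measurable_fun setT (fun z : Z => K78 (t - z.1)).
  by apply: measurable_singk_comp; apply: measurable_funB.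
rewrite ge0_integralZr//; last 2 first.
- by move=> *; exact: singk_ge0.
- by rewrite singk_ge0.
rewrite muleC lee_wpmul2l ?singk_ge0// mE//; last by move=> *; exact: singk_ge0.
have h r : (\int[leb]_(y in B) K78 (t - r)%R <= K78 (t - r)%R * (2 * M)%:E)%E.
  by rewrite integral_cst// lee_wpmul2l ?singk_ge0// leb_le.
apply: (@le_trans _ _ (\int[leb]_(r in A) (K78 (t - r)%R * (2 * M)%:E))%E).
  apply: ge0_le_integral => //.
  - by move=> r _; apply: integral_ge0 => *; exact: singk_ge0.
  - have -> : (fun r => \int[leb]_(y in B) K78 (t - r)%R)%E = (fun r => K78 (t - r)%R * leb B)%E.
      by apply/funext => r; rewrite integral_cst.
    by apply: emeasurable_funM => //; apply: measurable_singk_comp; exact: measurable_funB.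
  - by apply: emeasurable_funM => //; apply: measurable_singk_comp; exact: measurable_funB.
  by move=> r _; exact: h.
rewrite ge0_integralZr//.
- rewrite [leRHS]EFinM lee_wpmul2r ?lee_fin ?mulr_ge0 ?(ltW M0)//.
  by apply: sing_le => //; [apply/andP; split; lra|exact: AM].
- by apply: measurable_singk_comp; exact: measurable_funB.
- by move=> *; exact: singk_ge0.
- by rewrite lee_fin mulr_ge0// ltW.
Qed.

Let AB : set Z := A `*` B.

Let mAB : measurable AB. Proof. exact: measurableX. Qed.

(** By [mE] the complement of the rectangle is [m]-null, so a comparison on the rectangle is
    enough. *)
Let integral_le_AB (g h : Z -> \bar R) : measurable_fun setT g -> measurable_fun setT h ->
  (forall z, 0 <= g z)%E -> (forall z, 0 <= h z)%E -> (forall z, AB z -> g z <= h z)%E ->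
  (\int[m]_z g z <= \int[m]_z h z)%E.
Proof.
move=> mg mh g0 h0 gh.
have ABC : m (~` AB) = 0%E.
  rewrite -[LHS]mul1e -integral_cst; last exact: measurableC.
  rewrite integral_mkcond mE.
  - rewrite integral0_eq// => r Ar; rewrite integral0_eq// => y By.
    by rewrite patchE memNset//= => -[].
  - by apply/(measurable_restrictT _ _).1 => //; exact: measurableC.
  - by move=> z; rewrite patchE; case: ifP.
rewrite (@ge0_negligible_integral _ _ _ m setT (~` AB))//; last exact: measurableC.
rewrite setTD setCK (@le_trans _ _ (\int[m]_(z in AB) h z)%E)//.
  by apply: ge0_le_integral => //; apply: measurable_funTS.
exact: ge0_subset_integral.
Qed.

Let G (f : Z * Z -> \bar R) : \bar R := (\int[m]_z \int[m]_z' f (z, z'))%E.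

Let mG (f : Z * Z -> \bar R) : measurable_fun setT f -> (forall p, 0 <= f p)%E ->
  measurable_fun setT (fun z : Z => \int[m]_z' f (z, z'))%E.
Proof. by move=> mf f0; exact: (@measurable_fun_fubini_tonelli_F _ _ Z Z R m f). Qed.

Let msec (f : Z * Z -> \bar R) z : measurable_fun setT f ->
  measurable_fun setT (fun z' : Z => f (z, z')).
Proof. by move=> mf; apply: (measurableT_comp mf); exact: measurable_pair1. Qed.

Let GD f g : measurable_fun setT f -> (forall p, 0 <= f p)%E ->
  measurable_fun setT g -> (forall p, 0 <= g p)%E -> G (fun p => f p + g p)%E = (G f + G g)%E.
Proof.
move=> mf f0 mg g0; rewrite /G.
transitivity (\int[m]_z (\int[m]_z' f (z, z') + \int[m]_z' g (z, z')))%E.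
  by apply: eq_integral => z _; apply: ge0_integralD => //; exact: msec.
by rewrite ge0_integralD//; [move=> *; exact: integral_ge0|exact: mG|move=> *; exact: integral_ge0|exact: mG].
Qed.

Let GZ (k : R) f : measurable_fun setT f -> (forall p, 0 <= f p)%E -> 0 <= k ->
  G (fun p => k%:E * f p)%E = (k%:E * G f)%E.
Proof.
move=> mf f0 k0; rewrite /G.
transitivity (\int[m]_z (k%:E * \int[m]_z' f (z, z')))%E.
  by apply: eq_integral => z _; apply: ge0_integralZl => //; exact: msec.
by rewrite ge0_integralZl//; [exact: mG|move=> *; exact: integral_ge0].
Qed.

Let mfin : (m setT < +oo)%E. Proof. by rewrite ltey_eq fin_num_measure. Qed.

Let m11 : measurable_fun setT (fun p : Z * Z => p.1.1).
Proof. exact: (measurableT_comp measurable_fst measurable_fst). Qed.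
Let m12 : measurable_fun setT (fun p : Z * Z => p.1.2).
Proof. exact: (measurableT_comp measurable_snd measurable_fst). Qed.
Let m21 : measurable_fun setT (fun p : Z * Z => p.2.1).
Proof. exact: (measurableT_comp measurable_fst measurable_snd). Qed.
Let m22 : measurable_fun setT (fun p : Z * Z => p.2.2).
Proof. exact: (measurableT_comp measurable_snd measurable_snd). Qed.

Let fa (p : Z * Z) := (K78 (p.1.1 - p.2.1)%R * K34 (p.1.2 - p.2.2)%R)%E.
Let fb (p : Z * Z) := (K78 (p.1.1 - p.2.1)%R * K38 p.1.1)%E.
Let fc (p : Z * Z) := (K78 (p.1.1 - p.2.1)%R * K38 p.2.1)%E.

Let mfa : measurable_fun setT fa.
Proof.
by apply: emeasurable_funM; apply: measurable_singk_comp; exact: measurable_funB.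
Qed.

Let mfb : measurable_fun setT fb.
Proof.
by apply: emeasurable_funM; apply: measurable_singk_comp => //; exact: measurable_funB.
Qed.

Let mfc : measurable_fun setT fc.
Proof.
by apply: emeasurable_funM; apply: measurable_singk_comp => //; exact: measurable_funB.
Qed.

Let fa0 p : (0 <= fa p)%E. Proof. by rewrite mule_ge0 ?singk_ge0. Qed.
Let fb0 p : (0 <= fb p)%E. Proof. by rewrite mule_ge0 ?singk_ge0. Qed.
Let fc0 p : (0 <= fc p)%E. Proof. by rewrite mule_ge0 ?singk_ge0. Qed.

Let c34_ge0 : 0 <= c (3 / 4). Proof. by apply: c_ge0; apply/andP; split; lra. Qed.
Let c78_ge0 : 0 <= c (7 / 8). Proof. by apply: c_ge0; apply/andP; split; lra. Qed.

Let Ga : (G fa < +oo)%E.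
Proof.
apply: (@le_lt_trans _ _ (\int[m]_z (c (3 / 4) * c (7 / 8))%:E)%E).
  apply: integral_le_AB => //; first exact: mG.
  - by move=> z; exact: integral_ge0.
  - by move=> z; rewrite lee_fin mulr_ge0.
  - by move=> z [Az Bz]; exact: termC.
rewrite integral_cst//; apply: lte_mul_pinfty => //.
by rewrite lee_fin mulr_ge0.
Qed.

Let Gb : (G fb < +oo)%E.
Proof.
have k0 : 0 <= c (7 / 8) * (2 * M) by apply: mulr_ge0 => //; rewrite mulr_ge0// ltW.
apply: (@le_lt_trans _ _ (\int[m]_z (K38 z.1 * (c (7 / 8) * (2 * M))%:E))%E).
  apply: integral_le_AB => //; first exact: mG.
  - by apply: emeasurable_funM => //; exact: measurable_singk_comp.
  - by move=> z; exact: integral_ge0.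
  - by move=> z; rewrite mule_ge0 ?singk_ge0 ?lee_fin.
  - by move=> z [Az Bz]; exact: termT.
have m1 : measurable_fun setT (fun z : Z => K38 z.1) by exact: measurable_singk_comp.
rewrite ge0_integralZr//; last by move=> *; exact: singk_ge0.
rewrite muleC lte_mul_pinfty ?lee_fin// mE//; last by move=> *; exact: singk_ge0.
(* The singularity at time [0] is read as one centred at the point [0] of [[- M, M]], so that
   [sing_le] applies. *)
apply: (@le_lt_trans _ _ (\int[leb]_(r in A) (K38 (0 - r)%R * leb B))%E).
  rewrite le_eqVlt; apply/orP; left; apply/eqP; apply: eq_integral => r _.
  by rewrite /= integral_cst// sub0r singkN.
rewrite ge0_integralZr//.
- rewrite muleC lte_mul_pinfty// ?ge0_fin_numE ?(le_lt_trans (leb_le _ _)) ?ltry//.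
  apply: (le_lt_trans (sing_le _ _ _ _)); rewrite ?ltry//.
  + by apply/andP; split; lra.
  + by rewrite in_itv/= oppr_le0 (ltW M0).
- by apply: measurable_singk_comp; exact: measurable_funB.
- by move=> *; exact: singk_ge0.
Qed.

Lemma integral_pairk_lt : (\int[m]_z \int[m]_z' pairk C z z' < +oo)%E.
Proof.
have -> : (\int[m]_z \int[m]_z' pairk C z z' = G (fun p => 1 + C%:E * (fa p + fb p + fc p)))%E.
  apply: eq_integral => z _; apply: eq_integral => z' _.
  rewrite /pairk /fa /fb /fc /= ge0_muleDr ?adde_ge0 ?singk_ge0//.
  by rewrite [X in (X + _)%E]ge0_muleDr ?singk_ge0.
have mab : measurable_fun setT (fun p => fa p + fb p)%E by exact: emeasurable_funD.
have mabc : measurable_fun setT (fun p => fa p + fb p + fc p)%E by exact: emeasurable_funD.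
have abc0 p : (0 <= fa p + fb p + fc p)%E by rewrite !adde_ge0.
have m1 : measurable_fun setT (fun _ : Z * Z => 1%E : \bar R) by [].
have mC : measurable_fun setT (fun p => C%:E * (fa p + fb p + fc p))%E.
  by apply: emeasurable_funM.
have C0' p : (0 <= C%:E * (fa p + fb p + fc p))%E by rewrite mule_ge0 ?lee_fin.
have ab0 p : (0 <= fa p + fb p)%E by rewrite adde_ge0.
rewrite (GD m1 (fun=> lee01) mC C0') (GZ mabc abc0 C0) (GD mab ab0 mfc fc0) (GD mfa fa0 mfb fb0).
(* As [K78] is even, [fc] is [fb] with the two points exchanged, and Tonelli reduces the claim to
   [Gb]. *)
have Gc : (G fc < +oo)%E.
  have E1 : G fc = (\int[m]_z' \int[m]_z fc (z, z'))%E.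
    by rewrite /G; apply: (@fubini_tonelli _ _ Z Z R m m fc).
  rewrite E1 (eq_integral (fun z : Z => \int[m]_z' fb (z, z'))%E); first exact: Gb.
  move=> z _; apply: eq_integral => z' _; rewrite /fb /fc.
  by rewrite -(singkN _ ((z', z).1.1 - (z', z).2.1)) opprB.
have G1 : (G (fun=> 1%E) < +oo)%E.
  rewrite /G (eq_integral (fun=> m setT)).
    by rewrite integral_cst//; apply: lte_mul_pinfty; rewrite ?ge0_fin_numE.
  by move=> z _; rewrite integral_cst// mul1e.
apply: (lte_add_pinfty G1); apply: lte_mul_pinfty; rewrite ?lee_fin//.
exact: (lte_add_pinfty (lte_add_pinfty Ga Gb) Gc).
Qed.

End pair_kernel_integral.

(** * Gaussian vectors *)

Section image_measure.
Context d1 d2 (T1 : measurableType d1) (T2 : measurableType d2) (R : realType).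
Variables (m : {measure set T1 -> \bar R}) (f : T1 -> T2).
Hypothesis mf : measurable_fun setT f.

(** The push-forward packed with the proof [mf] that makes it a measure. *)
Definition image_measure : {measure set T2 -> \bar R} :=
  measure_function_pushforward__canonical__measure_function_Measure m mf.

Lemma image_measureE A : image_measure A = m (f @^-1` A). Proof. by []. Qed.

Lemma ge0_integral_image_measure (g : T2 -> \bar R) : measurable_fun setT g ->
  (forall y, 0 <= g y)%E -> (\int[image_measure]_y g y = \int[m]_x g (f x))%E.
Proof. by move=> mg g0; rewrite ge0_integral_pushforward. Qed.

Lemma integral_image_measure (g : T2 -> \bar R) : measurable_fun setT g ->
  (\int[image_measure]_y g y = \int[m]_x g (f x))%E.
Proof.
move=> mg; rewrite [LHS]integralE [RHS]integralE; congr (_ - _)%E.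
  rewrite (ge0_integral_image_measure (measurable_funepos mg)) => [|y]; last exact: funepos_ge0.
  by apply: eq_integral => x _; rewrite !funeposE.
rewrite (ge0_integral_image_measure (measurable_funeneg mg)) => [|y]; last exact: funeneg_ge0.
by apply: eq_integral => x _; rewrite !funenegE.
Qed.

End image_measure.

Section image_finite_measure.
Context d1 d2 (T1 : measurableType d1) (T2 : measurableType d2) (R : realType).
Variables (m : {finite_measure set T1 -> \bar R}) (f : T1 -> T2).
Hypothesis mf : measurable_fun setT f.

Definition image_finite_measure : set T2 -> \bar R := image_measure m mf.

HB.instance Definition _ := Measure.on image_finite_measure.

Let image_finite_measure_fin : fin_num_fun image_finite_measure.
Proof.
move=> A mA; apply: fin_num_measure.
by rewrite -[X in measurable X]setTI; exact: mf.
Qed.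

HB.instance Definition _ :=
  Measure_isFinite.Build _ _ _ image_finite_measure image_finite_measure_fin.

End image_finite_measure.

Section density.
Context d (T : measurableType d) (R : realType).
Local Notation leb := (@lebesgue_measure R).
Variables (mu : {sigma_finite_measure set T -> \bar R}) (nu : {measure set T -> \bar R}).
Variable L : T -> R.
Hypotheses (mL : measurable_fun setT L) (L0 : forall x, 0 <= L x).
Hypothesis nuE : forall A, measurable A -> nu A = (\int[mu]_(x in A) (L x)%:E)%E.

Let D : set (T * measurableTypeR R) := [set p | 0 <= p.2 < L p.1].

Let mD : measurable D.
Proof.
rewrite (_ : D = [set p | 0 <= p.2] `&` [set p | p.2 < L p.1]); last first.
  by apply/seteqP; split => p; rewrite /D /=; [move=> /andP[]|move=> [-> ->]].
apply: measurableI.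
  rewrite (_ : [set p | _] = setT `*` `[0%R, +oo[%classic); first exact: measurableX.
  by apply/seteqP; split => p /=; rewrite in_itv/= andbT => // -[].
rewrite -[X in measurable X]setTI.
have : measurable_fun setT (fun p : T * measurableTypeR R => p.2 < L p.1).
  by apply: measurable_fun_ltr => //; apply: (measurableT_comp mL).
by move=> /(_ measurableT [set true]) h; exact: h.
Qed.

(* [nu] is the image of the measure of the region under the graph of [L]. *)
Lemma ge0_integral_density (f : T -> \bar R) : measurable_fun setT f -> (forall x, 0 <= f x)%E ->
  (\int[nu]_x f x = \int[mu]_x (f x * (L x)%:E))%E.
Proof.
move=> mf f0.
have gE (g : T -> \bar R) : measurable_fun setT g -> (forall x, 0 <= g x)%E ->
    (\int[mrestr (mu \x leb)%E mD]_p g p.1 = \int[mu]_x (g x * (L x)%:E))%E.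
  move=> mg g0.
  have mg1 : measurable_fun setT (fun p : T * measurableTypeR R => g p.1).
    exact: (measurableT_comp mg measurable_fst).
  rewrite ge0_integral_mrestr// integral_mkcond fubini_tonelli1/=; last 2 first.
  - by apply: (measurable_restrictT _ mD).1; exact: measurable_funTS.
  - by move=> p; rewrite patchE; case: ifP.
  apply: eq_integral => x _; rewrite /fubini_F.
  transitivity (\int[leb]_(y in `[0%R, L x[) g x)%E.
    rewrite [RHS]integral_mkcond; apply: eq_integral => y _; rewrite !patchE.
    by congr (if _ then _ else _); apply/idP/idP; rewrite !inE /D/= in_itv.
  rewrite integral_cst; last exact: measurable_itv.
  have lebL : leb `[0%R, L x[%classic = (L x)%:E.
    rewrite lebesgue_measure_itv/= lte_fin; have := L0 x; rewrite le_eqVlt.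
    by move=> /predU1P[<-|->]; rewrite ?ltxx// oppr0 adde0.
  exact: (congr1 (fun y => g x * y)%E lebL).
rewrite -gE//.
rewrite -(@ge0_integral_pushforward _ _ _ _ _ _ (@measurable_fst _ _ T (measurableTypeR R)) (mrestr (mu \x leb)%E mD) setT f)//.
apply: eq_measure_integral => A mA _; rewrite nuE//.
have mA1 : measurable_fun setT (cst 1%E \_ A : T -> \bar R) by exact: (measurable_restrictT _ mA).1.
have A0 x : (0 <= (cst 1 \_ A : T -> \bar R) x)%E by rewrite patchE; case: ifP.
rewrite -[RHS]mul1e -integral_cst// integral_mkcond.
rewrite ge0_integral_pushforward// preimage_setT (gE _ mA1 A0).
rewrite integral_mkcond; apply: eq_integral => x _.
by rewrite !patchE; case: ifP; rewrite ?mul1e ?mul0e.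
Qed.

End density.

(** * Gaussian laws and bounds on their densities *)

Section gaussian.
Context {R : realType}.
Local Notation leb := (@lebesgue_measure R).

(** The constant [6] bounds [4 sqrt 2]. The estimate serves to turn a known second moment into a
    lower bound for [s ^+ 2]. *)
Lemma normal_sqr_le (s : R) : s != 0 ->
  (\int[leb]_x (x ^+ 2 * normal_pdf 0 s x)%:E <= (6 * s ^+ 2)%:E)%E.
Proof.
move=> s0; have r20 : 0 < Num.sqrt 2 :> R by rewrite sqrtr_gt0.
have [r rE] : exists r : R, r = Num.sqrt 2 by exists (Num.sqrt 2).
rewrite -rE in r20; have r2 : r ^+ 2 = 2 by rewrite rE sqr_sqrtr.
have s20 : 0 < s ^+ 2 by rewrite exprn_even_gt0.
(* [x^2 <= 4 s^2 exp(x^2 / (4 s^2))], and the right-hand side times the density of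
   N(0, s^2) is a multiple of that of N(0, 2 s^2) *)
have key (x : R) : x ^+ 2 * (normal_peak s * normal_fun 0 s x) <=
    4 * s ^+ 2 * r * (normal_peak (r * s) * normal_fun 0 (r * s) x).
  rewrite /normal_fun /normal_peak !subr0.
  have -> : (r * s) ^+ 2 * pi *+ 2 = r ^+ 2 * (s ^+ 2 * pi *+ 2).
    by rewrite exprMn mulrnAr !mulrA.
  rewrite sqrtrM ?sqr_ge0// sqrtr_sqr gtr0_norm// invfM.
  set c := (Num.sqrt _)^-1; have c0 : 0 <= c by rewrite invr_ge0.
  rewrite exprMn r2.
  rewrite (_ : 4 * s ^+ 2 * r * (r^-1 * c * expR (- x ^+ 2 / (2 * s ^+ 2 *+ 2))) =
    c * (4 * s ^+ 2 * expR (- x ^+ 2 / (2 * s ^+ 2 *+ 2)))); last first.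
    by field; rewrite gt_eqF.
  rewrite mulrCA ler_wpM2l//.
  have [q qE] : exists q, q = x ^+ 2 / (4 * s ^+ 2) by exists (x ^+ 2 / (4 * s ^+ 2)).
  have -> : - x ^+ 2 / (s ^+ 2 *+ 2) = - q - q by rewrite qE -mulr_natl; field.
  have -> : - x ^+ 2 / (2 * s ^+ 2 *+ 2) = - q by rewrite qE -mulr_natl; field.
  have -> : x ^+ 2 = 4 * s ^+ 2 * q by rewrite qE; field.
  have qe : q * expR (- q) <= 1.
    rewrite expRN ler_pdivrMr ?expR_gt0// mul1r.
    by rewrite (le_trans _ (expR_ge1Dx q))// lerDr.
  rewrite expRD -subr_ge0; move: (expR (- q)) (expR_ge0 (- q)) qe => v v0 qv.
  rewrite (_ : _ - _ = 4 * s ^+ 2 * v * (1 - q * v)); last by ring.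
  by rewrite mulr_ge0 ?subr_ge0// mulr_ge0// mulr_ge0// ltW.
apply: (@le_trans _ _ (\int[leb]_x ((4 * s ^+ 2 * r)%:E * (normal_pdf 0 (r * s) x)%:E))%E).
  apply: ge0_le_integral => //.
  - by move=> x _; rewrite lee_fin mulr_ge0 ?sqr_ge0 ?normal_pdf_ge0.
  - apply/measurable_EFinP; apply: measurable_funM; first exact: measurable_funX.
    exact: measurable_normal_pdf.
  - apply/measurable_EFinP; apply: measurable_funM => //; exact: measurable_normal_pdf.
  - move=> x _; rewrite -EFinM lee_fin !normal_pdfE ?mulf_neq0 ?(gt_eqF r20)//.
rewrite ge0_integralZl//=.
- rewrite integral_normal_pdf mule1 lee_fin; nra.
- by apply/measurable_EFinP; exact: measurable_normal_pdf.
- by move=> x _; rewrite lee_fin normal_pdf_ge0.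
- by rewrite lee_fin mulr_ge0 ?(ltW r20)// mulr_ge0// ltW.
Qed.

Context {dO : measure_display} {T : measurableType dO}.
Variable P : probability T R.

(** A positive second moment excludes the Dirac law, and the preceding estimate bounds the standard
    deviation from below. *)
Lemma gaussian_law (X : T -> R) (S : R) : centered_gaussian P X -> 0 < S ->
  (\int[P]_w ((X w) ^+ 2)%:E = S%:E)%E ->
  exists s : R, [/\ s != 0, S <= 6 * s ^+ 2 &
    forall B, measurable B -> P (X @^-1` B) = normal_prob 0 s B].
Proof.
move=> [mX [s lawX]] S0 XS; exists s.
have mX' : @measurable_fun _ _ T (measurableTypeR R) setT X by exact: mX.
have XE : (\int[P]_w ((X w) ^+ 2)%:E = \int[image_measure P mX']_x (x ^+ 2)%:E)%E.
  rewrite ge0_integral_image_measure//.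
    by apply/measurable_EFinP; exact: measurable_funX.
  by move=> x; rewrite lee_fin sqr_ge0.
have [s0|s0] := eqVneq s 0.
  suff : (\int[P]_w ((X w) ^+ 2)%:E = 0)%E by rewrite XS => -[] S0'; rewrite S0' ltxx in S0.
  rewrite XE (eq_measure_integral (\d_(0 : measurableTypeR R))); last first.
    by move=> A mA _; have := lawX A mA; rewrite s0 eqxx; exact.
  rewrite integral_dirac//= ?diracT ?mul1e ?expr0n//.
  by apply/measurable_EFinP; exact: measurable_funX.
split => //; last by move=> B mB; rewrite lawX// (negbTE s0).
have E : (\int[image_measure P mX']_x (x ^+ 2)%:E =
    \int[leb]_x ((x ^+ 2)%:E * (normal_pdf 0 s x)%:E))%E.
  apply: (@ge0_integral_density _ (measurableTypeR R) R leb (image_measure P mX') (normal_pdf 0 s)).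
  - exact: measurable_normal_pdf.
  - by move=> x; exact: normal_pdf_ge0.
  - by move=> A mA; have := lawX A mA; rewrite (negbTE s0); exact.
  - by apply/measurable_EFinP; exact: measurable_funX.
  - by move=> x; rewrite lee_fin sqr_ge0.
by rewrite -lee_fin -XS XE E; exact: normal_sqr_le.
Qed.

(** By independence the law agrees on open boxes with the product density, hence everywhere. That
    density is at most the product of the peaks [1 / sqrt (2 pi s_j^2)], where [s_j^2 >= S / 6]. *)
Lemma gaussian_tuple_integral_le d (N : 'I_d -> T -> R) (s : 'I_d -> R) (S : R)
    (f : d.-tuple R -> \bar R) :
  (forall j, measurable_fun setT (N j)) -> 0 < S -> (forall j, s j != 0) ->
  (forall j, S <= 6 * s j ^+ 2) ->
  (forall j B, measurable B -> P (N j @^-1` B) = normal_prob 0 (s j) B) ->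
  (forall B : 'I_d -> set R, (forall j, measurable (B j)) ->
    P (\bigcap_j (N j @^-1` B j)) = (\prod_(j < d) P (N j @^-1` B j))%E) ->
  measurable_fun setT f -> (forall x, 0 <= f x)%E ->
  (\int[P]_w f [tuple N j w | j < d] <=
   (((Num.sqrt (2 * pi * (S / 6)))^-1) ^+ d)%:E * \int[lebesgue_tuple d]_x f x)%E.
Proof.
move=> mN S0 s0 Ss law ind mf f0.
have mNt : measurable_fun setT (fun w => [tuple N j w | j < d]).
  apply/measurable_fun_tnthP => j.
  by rewrite (_ : _ \o _ = N j)//; apply/funext => w /=; rewrite tnth_mktuple.
pose p (x : d.-tuple R) := \prod_(j < d) normal_pdf 0 (s j) (tnth x j).
have mp : measurable_fun setT p.
  by apply: (measurable_prod_tnth (f := fun j => normal_pdf 0 (s j))) => j; exact: measurable_normal_pdf.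
have p0 x : 0 <= p x by apply: prodr_ge0 => j _; exact: normal_pdf_ge0.
have lawN A : measurable A -> image_measure P mNt A = (\int[lebesgue_tuple d]_(x in A) (p x)%:E)%E.
  apply: (@measure_tuple_unique _ d _ (density_measure_pack (lebesgue_tuple d) mp p0)).
    by rewrite (_ : image_measure P mNt setT = 1%E) ?ltry//; exact: probability_setT.
  move=> a b.
  have -> : image_measure P mNt (open_box a b) = P (\bigcap_j (N j @^-1` `]a j, b j[%classic)).
    rewrite image_measureE; congr (P _); apply/seteqP; split => w /=.
      by move=> h j _; have := h j; rewrite tnth_mktuple /= in_itv.
    by move=> h j; have := h j I; rewrite tnth_mktuple /= in_itv.
  rewrite ind; last by move=> j; exact: measurable_itv.
  rewrite /= /density_measure integral_mkcond.
  rewrite (eq_integral (fun x => (\prod_(j < d)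
     (normal_pdf 0 (s j) (tnth x j) * \1_(`]a j, b j[%classic) (tnth x j)))%:E)); last first.
    move=> x _; rewrite patchE big_split/=; case: ifPn => [|xab].
      rewrite inE => xab; rewrite [X in _ * X]big1 ?mulr1// => j _.
      by rewrite indicE mem_set//= in_itv/=; exact: xab.
    move: xab; rewrite notin_setE => /existsNP[j xj].
    rewrite [X in (_ * X)%:E](bigD1 j)//= indicE memNset ?mul0r ?mulr0//=.
  rewrite (integral_prod_tnth (f := fun j y => normal_pdf 0 (s j) y * \1_(`]a j, b j[%classic) y)).
  - apply: eq_bigr => j _; rewrite law; last exact: measurable_itv.
    rewrite /normal_prob integral_mkcond; apply: eq_integral => y _.
    by rewrite epatch_indic EFinM.
  - move=> j; apply: measurable_funM; first exact: measurable_normal_pdf.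
    by apply: measurable_indic; exact: measurable_itv.
  - by move=> j y; rewrite mulr_ge0 ?normal_pdf_ge0.
set c := (Num.sqrt _)^-1.
have c0 : 0 <= c by rewrite invr_ge0.
have pc x : p x <= c ^+ d.
  rewrite -[X in _ <= _ ^+ X]card_ord -prodr_const; apply: ler_prod => j _.
  rewrite normal_pdf_ge0 (le_trans (normal_pdf_ub _ _ (s0 j)))//.
  have pi0 := @pi_gt0 R.
  rewrite /normal_peak /c lef_pV2 ?posrE ?sqrtr_gt0; last 2 first.
  - by rewrite mulrn_wgt0// mulr_gt0// exprn_even_gt0//= s0.
  - by rewrite !mulr_gt0// divr_gt0.
  have v0 : 0 <= s j ^+ 2 * pi *+ 2 by rewrite mulrn_wge0// mulr_ge0 ?sqr_ge0// ltW.
  rewrite ler_sqrt//.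
  by have := Ss j; rewrite mulr2n; move: (s j ^+ 2) => v; move: (@pi R) pi0 => q *; nra.
rewrite (_ : (\int[P]_w _ = \int[image_measure P mNt]_x f x)%E); last first.
  by rewrite ge0_integral_image_measure.
rewrite (@ge0_integral_density _ _ _ (lebesgue_tuple d) _ p)// -ge0_integralZl//; last first.
  by rewrite lee_fin exprn_ge0.
apply: ge0_le_integral => //.
- by move=> x _; rewrite mule_ge0 ?lee_fin.
- by apply: emeasurable_funM => //; exact/measurable_EFinP.
- exact: measurable_funeM.
- by move=> x _; rewrite muleC lee_wpmul2r ?lee_fin.
Qed.

End gaussian.

(** * White noise *)

Lemma Lfun2B d (X : measurableType d) (R : realType) (m : {measure set X -> \bar R})
    (f g : X -> R) :
  f \in Lfun m 2%:E -> g \in Lfun m 2%:E -> f \- g \in Lfun m 2%:E.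
Proof.
move=> f2 g2; have p1 : (1 <= 2%:E :> \bar R)%E by rewrite lee_fin ler1n.
have [_ /(_ (-1) g f g2 f2)] := Lfun_submod_closed m p1.
by rewrite (_ : -1 *: g + f = f \- g)//; apply/funext => x; rewrite scaleN1r addrC.
Qed.

Section white_noise.
Context {R : realType} {dO : measure_display} {T : measurableType dO}.
Variable P : probability T R.
Variables (F : R -> set (set T)) (d : nat) (W : 'I_d -> (R * R -> R) -> T -> R).
Hypothesis noise : white_noise P F W.
Implicit Types f g h : R * R -> R.
Local Notation spacetime_integral f := (\int[lebesgue2]_(z in spacetime) (f z)%:E)%E.

Lemma L2_spacetimeB f g : L2_spacetime f -> L2_spacetime g -> L2_spacetime (f \- g).
Proof.
move=> f2 g2; rewrite /L2_spacetime.
rewrite (_ : _ \_ _ = (f \_ spacetime) \- (g \_ spacetime)); first exact: Lfun2B.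
by apply/funext => z; rewrite /= !patchE; case: ifP => //; rewrite /point/= subr0.
Qed.

Let noise_gauss j f : L2_spacetime f -> centered_gaussian P (W j f).
Proof.
move=> f2; have := noise_gaussian noise j (f := fun _ : 'I_1 => f) (fun=> 1) (fun=> f2).
rewrite (_ : (fun w => _) = W j f)//.
by apply/funext => w; rewrite big_ord_recl big_ord0 mul1r addr0.
Qed.

Lemma measurable_noise j f : L2_spacetime f -> measurable_fun setT (W j f).
Proof. by case/(noise_gauss j). Qed.

Let noise_cov j f g : L2_spacetime f -> L2_spacetime g ->
  (\int[P]_w (W j f w * W j g w)%:E = spacetime_integral (f \* g))%E.
Proof. by move=> f2 g2; have := noise_covariance noise j f2 g2; rewrite unlock. Qed.

Lemma L2_spacetimeM f g : L2_spacetime f -> L2_spacetime g ->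
  lebesgue2.-integrable spacetime (EFin \o (f \* g)).
Proof.
move=> f2 g2; have mS : measurable (spacetime : set (measurableTypeR R * measurableTypeR R)%type).
  exact: measurable_spacetime.
apply: (@integrable_mkcond _ _ R lebesgue2 spacetime (EFin \o (f \* g)) mS).2.
have /Lfun1_integrable := Lfun2_mul_Lfun1 f2 g2.
rewrite (_ : EFin \o _ = (EFin \o f \* g) \_ spacetime)//.
apply/funext => z; rewrite /= !patchE; case: ifP => // _.
by rewrite /point/= mulr0.
Qed.

Lemma noise_Lfun2 j f : L2_spacetime f -> W j f \in Lfun P 2%:E.
Proof.
move=> f2; apply: integrable_sqr_Lfun2; first exact: measurable_noise.
under eq_integral do rewrite expr2.
by rewrite noise_cov// ltey_eq integrable_fin_num//; [exact: measurable_spacetime|exact: L2_spacetimeM].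
Qed.

Let integral3 d1 (X : measurableType d1) (m : {measure set X -> \bar R}) (D : set X) (a b c : X -> R) :
  measurable D -> m.-integrable D (EFin \o a) -> m.-integrable D (EFin \o b) ->
  m.-integrable D (EFin \o c) ->
  (\int[m]_(x in D) (a x - b x - c x)%:E =
   \int[m]_(x in D) (a x)%:E - \int[m]_(x in D) (b x)%:E - \int[m]_(x in D) (c x)%:E)%E.
Proof.
move=> mD ia ib ic.
under eq_integral do rewrite EFinB.
rewrite (@integralB_EFin _ _ _ m D (a \- b) c)//; last first.
  by rewrite (_ : EFin \o _ = (EFin \o a) \- (EFin \o b))%E//; exact: integrableB.
congr (_ - _)%E; under eq_integral do rewrite EFinB.
exact: integralB_EFin.
Qed.

(* [Y := W f - W g - W (f - g)] is orthogonal to each of its three terms, so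
   [E Y^2 = 0]. *)
Lemma noiseB j f g : L2_spacetime f -> L2_spacetime g ->
  {ae P, forall w, W j (f \- g) w = W j f w - W j g w}.
Proof.
move=> f2 g2; have h2 := L2_spacetimeB f2 g2; set h := f \- g in h2 *.
pose Y := (W j f \- W j g) \- W j h.
have Y2 : Y \in Lfun P 2%:E by do 2?apply: Lfun2B; exact: noise_Lfun2.
have iYW k : L2_spacetime k -> P.-integrable setT (EFin \o (Y \* W j k)).
  by move=> k2; apply/Lfun1_integrable; apply: Lfun2_mul_Lfun1 => //; exact: noise_Lfun2.
have iWW k l : L2_spacetime k -> L2_spacetime l -> P.-integrable setT (EFin \o (W j k \* W j l)).
  by move=> k2 l2; apply/Lfun1_integrable; apply: Lfun2_mul_Lfun1 => //; exact: noise_Lfun2.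
have YW k : L2_spacetime k -> (\int[P]_w (Y w * W j k w)%:E = 0)%E.
  move=> k2; rewrite (eq_integral (fun w =>
      (W j f w * W j k w - W j g w * W j k w - W j h w * W j k w)%:E)); last first.
    by move=> w _; rewrite /Y /= !mulrBl.
  rewrite (@integral3 _ _ P setT (W j f \* W j k) (W j g \* W j k) (W j h \* W j k)) ?iWW//=.
  rewrite !noise_cov// -(@integral3 _ _ lebesgue2 spacetime (f \* k) (g \* k) (h \* k)) ?L2_spacetimeM//.
    by apply: integral0_eq => z _; rewrite /h /= mulrBl subrr.
  exact: measurable_spacetime.
have YY : (\int[P]_w `|(Y w ^+ 2)%:E| = 0)%E.
  rewrite (eq_integral (fun w =>
      (Y w * W j f w - Y w * W j g w - Y w * W j h w)%:E)); last first.
    by move=> w _; rewrite gee0_abs ?lee_fin ?sqr_ge0// {2}/Y /= -!mulrBr expr2.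
  rewrite (@integral3 _ _ P setT (Y \* W j f) (Y \* W j g) (Y \* W j h)) ?iYW//=.
  by rewrite !YW// !sube0.
have mY : measurable_fun setT Y.
  by apply: measurable_funB; [apply: measurable_funB|]; exact: measurable_noise.
have mY2 : measurable_fun setT (fun w => (Y w ^+ 2)%:E).
  by apply/measurable_EFinP; exact: measurable_funX.
have /(ae_eq_integral_abs P measurableT mY2) := YY.
apply: filterS => w /(_ I) /= [] /eqP; rewrite sqrf_eq0 /Y /= subr_eq0 => /eqP.
by move=> ->.
Qed.

Lemma noise_integral_le h (S : R) (f : d.-tuple R -> \bar R) : L2_spacetime h -> 0 < S ->
  spacetime_integral (h \* h) = S%:E ->
  measurable_fun setT f -> (forall x, 0 <= f x)%E ->
  (\int[P]_w f [tuple W j h w | j < d] <=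
   (((Num.sqrt (2 * pi * (S / 6)))^-1) ^+ d)%:E * \int[lebesgue_tuple d]_x f x)%E.
Proof.
move=> h2 S0 hS mf f0.
have /choice[s sP] j : exists s : R, [/\ s != 0, S <= 6 * s ^+ 2 &
    forall B, measurable B -> P (W j h @^-1` B) = normal_prob 0 s B].
  apply: gaussian_law => //; first exact: noise_gauss.
  by under eq_integral do rewrite expr2; rewrite noise_cov.
apply: (@gaussian_tuple_integral_le _ _ _ P d (fun j => W j h) s S f) => //.
- by move=> j; exact: measurable_noise.
- by move=> j; case: (sP j).
- by move=> j; case: (sP j).
- by move=> j; case: (sP j).
move=> B mB; apply: (noise_independent noise) => j.
by apply: sub_gen_smallest; exists h => //; exists (B j).
Qed.

(** The drift [D] is independent of the noise, so their joint law is a product; with [D] frozen, the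
    density bound for the noise meets a kernel of mass [1]. *)
Lemma noise_future_integral_le h (S e : R) (D : T -> d.-tuple R) : L2_spacetime h -> 0 < S ->
  spacetime_integral (h \* h) = S%:E -> 0 < e ->
  measurable_fun setT D -> measurable_wrt (F 0) D ->
  (\int[P]_w (hkd e (tsub [tuple W j h w | j < d] (D w)))%:E <=
   (((Num.sqrt (2 * pi * (S / 6)))^-1) ^+ d)%:E)%E.
Proof.
move=> h2 S0 hS e0 mD FD; set c := (_ ^+ d).
have c0 : 0 <= c by rewrite exprn_ge0// invr_ge0.
pose N w := [tuple W j h w | j < d].
have mN : measurable_fun setT N.
  apply/measurable_fun_tnthP => j.
  rewrite (_ : _ \o _ = W j h); first exact: measurable_noise.
  by apply/funext => w /=; rewrite tnth_mktuple.
have mDN : measurable_fun setT (fun w => (D w, N w)) by exact/measurable_fun_pairP.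
pose mu1 := image_finite_measure P mD; pose mu2 := image_finite_measure P mN.
pose g (p : d.-tuple R * d.-tuple R) := (hkd e (tsub p.2 p.1))%:E.
have mg : measurable_fun setT g.
  by apply/measurable_EFinP; apply: measurable_hkd_tsub.
have g0 p : (0 <= g p)%E by rewrite lee_fin hkd_ge0.
have -> : (\int[P]_w (hkd e (tsub (N w) (D w)))%:E = \int[image_measure P mDN]_p g p)%E.
  by rewrite ge0_integral_image_measure.
rewrite (eq_measure_integral (mu1 \x mu2)%E); last first.
  move=> A mA _; apply/esym; apply: product_measure_unique => // A1 A2 mA1 mA2.
  rewrite image_measureE (_ : _ @^-1` _ = D @^-1` A1 `&` N @^-1` A2)//.
  (* At time [0] the support condition of [noise_future] is vacuous: no point of [spacetime] has a
     negative time. *)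
  apply: (noise_future noise (lexx 0) h2) => //; last exact: FD.
  by apply: aeW => z /= z0; rewrite ltNge z0.
rewrite fubini_tonelli1//.
apply: (@le_trans _ _ (\int[mu1]_x c%:E)%E); last first.
  rewrite integral_cst// -[leRHS]mule1 lee_wpmul2l ?lee_fin//.
  by rewrite le_eqVlt; apply/orP; left; apply/eqP; exact: (@probability_setT _ _ _ P).
apply: ge0_le_integral => //.
- by move=> x _; exact: integral_ge0.
- exact: measurable_fun_fubini_tonelli_F.
move=> x _; rewrite /fubini_F /g /=.
rewrite (@ge0_integral_image_measure _ _ _ _ _ P _ mN (fun y => (hkd e (tsub y x))%:E)).
- apply: (le_trans (@noise_integral_le h S (fun y => (hkd e (tsub y x))%:E) h2 S0 hS _ _)).
  + by apply/measurable_EFinP; exact: measurable_hkd_tsub.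
  + by move=> y; rewrite lee_fin hkd_ge0.
  + rewrite (eq_integral (fun y => (hkd e (tsub x y))%:E)) ?integral_hkd ?mule1//.
    by move=> y _; rewrite hkd_sym.
- by apply/measurable_EFinP; exact: measurable_hkd_tsub.
- by move=> y; rewrite lee_fin hkd_ge0.
Qed.

End white_noise.

(** * Riemann sums *)

Section riemann_sum.
Context {R : realType}.
Local Notation leb := (@lebesgue_measure R).
Implicit Types (f : R -> R) (n k : nat).

(** Mesh [1 / (n + 1)] starting from [- (n + 1)]: the first [2 (n + 1)^2] cells fill [[- (n + 1), n
    + 1[]. *)
Definition grid n k : R := k%:R / n.+1%:R - n.+1%:R.

Definition riemann_sum n f : R :=
  \sum_(k < (2 * (n.+1 * n.+1))%N) f (grid n k) / n.+1%:R.

Definition grid_cell n k y : R := \1_(`[grid n k, grid n k.+1[%classic) y.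

Let cellE n k y : grid_cell n k y = ((k%:R <= n.+1%:R * (y + n.+1%:R)) && (n.+1%:R * (y + n.+1%:R) < k.+1%:R))%:R.
Proof.
rewrite /grid_cell indicE; congr (nat_of_bool _)%:R; apply/idP/idP.
  rewrite inE /= in_itv /= /grid lerBlDr ltrBrDr => /andP[h1 h2]; apply/andP; split.
    by rewrite mulrC -ler_pdivrMr.
  by rewrite mulrC -ltr_pdivlMr.
rewrite inE /= in_itv /= /grid lerBlDr ltrBrDr => /andP[h1 h2]; apply/andP; split.
  by rewrite ler_pdivrMr// mulrC.
by rewrite ltr_pdivlMr// mulrC.
Qed.

Let cell_uniq n k k' y : grid_cell n k y != 0 -> grid_cell n k' y != 0 -> k = k'.
Proof.
rewrite !cellE !pnatr_eq0 !eqb0 !negbK => /andP[h1 h2] /andP[h3 h4].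
have := le_lt_trans h1 h4; have := le_lt_trans h3 h2; rewrite !ltr_nat !ltnS => h5 h6.
by apply/eqP; rewrite eqn_leq h5 h6.
Qed.

Definition step_approx n f y : R := \sum_(k < (2 * (n.+1 * n.+1))%N) f (grid n k) * grid_cell n k y.

Let cell_near n k y : grid_cell n k y != 0 -> `|grid n k - y| <= n.+1%:R^-1.
Proof.
rewrite cellE pnatr_eq0 eqb0 negbK => /andP[h1 h2].
have m0 : 0 < n.+1%:R :> R by [].
have -> : grid n k - y = (k%:R - n.+1%:R * (y + n.+1%:R)) / n.+1%:R.
  by rewrite /grid; field; rewrite gt_eqF.
rewrite normrM normfV (gtr0_norm m0) ler_pdivrMr// mulVf ?gt_eqF//.
move: h1 h2; rewrite -natr1 ler_norml => h1 h2.
by apply/andP; split; lra.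
Qed.

Let approx_cell n f y k : (k < 2 * (n.+1 * n.+1))%N -> grid_cell n k y != 0 ->
  step_approx n f y = f (grid n k).
Proof.
move=> kN ck; rewrite /step_approx (bigD1 (Ordinal kN))//= big1 ?addr0; last first.
  move=> k' kk'; apply/eqP; rewrite mulf_eq0; apply/orP; right; apply: contraNT kk' => ck'.
  by apply/eqP/val_inj; exact: cell_uniq ck' ck.
by move: ck; rewrite cellE; case: (_ && _); rewrite ?eqxx// mulr1.
Qed.

Lemma step_approxP n f y : (exists2 v, `|v - y| <= n.+1%:R^-1 & step_approx n f y = f v) \/
  (step_approx n f y = 0 /\ n.+1%:R <= `|y|).
Proof.
have [[k [kN ck]]|nk] := pselect (exists k, (k < 2 * (n.+1 * n.+1))%N /\ grid_cell n k y != 0).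
  by left; exists (grid n k); [exact: cell_near|exact: approx_cell].
right; split.
  rewrite /step_approx big1// => k _; apply/eqP; rewrite mulf_eq0; apply/orP; right.
  by apply: contra_notT nk => ck; exists k.
rewrite leNgt ltr_norml; apply: contra_notN nk => /andP[y1 y2].
have m0 : 0 < n.+1%:R :> R by [].
have ym : 0 <= n.+1%:R * (y + n.+1%:R) :> R.
  by rewrite mulr_ge0//; move: y1; move: (n.+1%:R : R) => m; lra.
have /andP[t1 t2] := truncn_itv ym.
exists (Num.truncn (n.+1%:R * (y + n.+1%:R))); split; last first.
  by rewrite cellE t1 t2 oner_neq0.
rewrite -(@ltr_nat R) (le_lt_trans t1)// !natrM mulrCA ltr_pM2l//.
by move: y2; move: (n.+1%:R : R) => m; lra.
Qed.

(** Riemann sums are integrals of step functions. Since the mesh is at most [1], the value used at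
    [y] is taken at distance at most [1], where the envelope [G] controls [f]; dominated convergence
    applies. *)
Lemma cvg_riemann_sum f (G : R -> R) : continuous f ->
  leb.-integrable setT (EFin \o G) -> (forall v y, `|v - y| <= 1 -> `|f v| <= G y) ->
  leb.-integrable setT (EFin \o f) /\ riemann_sum n f @[n --> \oo] --> \int[leb]_y f y.
Proof.
move=> cf iG fG.
have icell n k : leb.-integrable setT (EFin \o (fun y => f (grid n k) * grid_cell n k y)).
  rewrite (_ : EFin \o _ = (fun y => (f (grid n k))%:E * (grid_cell n k y)%:E)%E); last first.
    by apply/funext => y /=; rewrite EFinM.
  apply: integrableZl => //; exact: integrable_indic_itv.
have approxE n : (\int[leb]_y (step_approx n f y)%:E = (riemann_sum n f)%:E)%E.
  under eq_integral do rewrite /step_approx -sumEFin.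
  rewrite integral_sum//; last by move=> k; exact: icell.
  rewrite /riemann_sum -sumEFin; apply: eq_bigr => k _.
  under eq_integral do rewrite EFinM.
  rewrite integralZl//; last exact: integrable_indic_itv.
  rewrite EFinM integral_indic//= setIT lebesgue_measure_itv/= lte_fin.
  have m0 : 0 < n.+1%:R^-1 :> R by rewrite invr_gt0.
  have gS : grid n k.+1 = grid n k + n.+1%:R^-1.
    by rewrite /grid -natr1 mulrDl mul1r addrAC.
  by rewrite gS ltrDl m0 -EFinB addrAC subrr add0r.
have mf : measurable_fun setT f by exact: continuous_measurable_fun.
have ma n : measurable_fun setT (fun y => (step_approx n f y)%:E).
  apply/measurable_EFinP; apply: measurable_sum => k; apply: measurable_funM => //.
  by apply: measurable_indic; exact: measurable_itv.
have cvga y : (step_approx n f y)%:E @[n --> \oo] --> (f y)%:E.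
  apply: cvg_EFin; first by apply: nearW.
  apply/cvgrPdist_lt => e e0.
  have /cvgrPdist_lt/(_ e e0) := cf y; rewrite -nbhs_nearE => /nbhs_ballP[r /= r0 fr].
  have c1 : n.+1%:R^-1 @[n --> \oo] --> (0 : R) by exact: cvg_harmonic.
  have : \forall n \near \oo, (n.+1%:R^-1 : R) < r.
    by move/cvgr_lt: c1; apply.
  have : \forall n \near \oo, `|y| < (n.+1%:R : R).
    exists (Num.truncn `|y|) => // n /= yn; apply: lt_le_trans (truncnS_gt _) _.
    by rewrite ler_nat.
  apply: filterS2 => n yn nr; have [[v vy ->]|[_]] := step_approxP n f y; last first.
    by rewrite leNgt yn.
  by apply: fr; rewrite /ball /= distrC (le_lt_trans vy).
have aG n y : `|step_approx n f y| <= G y.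
  have [[v vy ->]|[-> _]] := step_approxP n f y.
    by apply: fG; rewrite (le_trans vy)// invf_le1// ler1n.
  by rewrite normr0 (le_trans _ (fG y y _))// subrr normr0.
have [|||||int_f _ cvg_int] := @dominated_convergence _ _ _ leb setT measurableT
  (fun n y => (step_approx n f y)%:E) (fun y => (f y)%:E) (EFin \o G).
- exact: ma.
- exact/measurable_EFinP.
- by apply: aeW => y _; exact: cvga.
- exact: iG.
- by apply: aeW => y n _; rewrite /= lee_fin; exact: aG.
split=> //.
have : (riemann_sum n f)%:E @[n --> \oo] --> (\int[leb]_y (f y)%:E)%E.
  by move: cvg_int; under eq_cvg do rewrite /= approxE.
rewrite -(fineK (integrable_fin_num measurableT int_f)).
by move=> /fine_cvgP[].
Qed.

End riemann_sum.

(** * Riemann sums for the heat flow of the initial condition *)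

Section heat_flow.
Context {R : realType}.
Local Notation leb := (@lebesgue_measure R).
Implicit Types (t x y v lam : R).

Lemma normr_tnth_le d (a : d.-tuple R) j : `|tnth a j| <= enorm a.
Proof.
rewrite -sqrtr_sqr ler_wsqrtr// /dotp (bigD1 j)//= -expr2 lerDl.
by apply: sumr_ge0 => i _; rewrite -expr2 sqr_ge0.
Qed.

(** Outside some [[- M, M]] the limits at both infinities give the constant [1]; inside, continuity
    gives a maximum for each of the finitely many coordinates. *)
Lemma Elambda_le d lam (g : R -> d.-tuple R) : 0 <= lam -> Elambda lam g ->
  exists2 C : R, 0 <= C & forall y j, `|tnth (g y) j| <= C * expR (lam * `|y|).
Proof.
move=> lam0 [cg gp gm].
have near1 (F : set_system R) (FF : Filter F) :
    enorm (g y) * expR (- (lam * `|y|)) @[y --> F] --> (0 : R) ->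
    \forall y \near F, forall j, `|tnth (g y) j| <= expR (lam * `|y|).
  move=> /cvgr_lt/(_ 1 ltr01); apply: filterS => y gy j.
  rewrite (le_trans (normr_tnth_le _ _))//; move: gy.
  by rewrite expRN ltr_pdivrMr ?expR_gt0// mul1r => /ltW.
have [Mp [_ hp]] := near1 _ _ gp; have [Mm [_ hm]] := near1 _ _ gm.
pose M := Num.max `|Mp| `|Mm|.
have M0 : 0 <= M by rewrite /M le_max normr_ge0.
have MM : - M <= M by rewrite (le_trans _ M0)// oppr_le0.
have /choice[B BP] j : exists B : R, forall y, - M <= y <= M -> `|tnth (g y) j| <= B.
  have cM : {within `[- M, M], continuous (fun y => `|tnth (g y) j|)}.
    by apply: continuous_subspaceT => y; exact: (cvg_norm (cg j y)).
  have [c _ cB] := EVT_max MM cM; exists `|tnth (g c) j| => y yM.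
  by apply: cB; rewrite in_itv.
have BC j : B j <= 1 + \sum_(i < d) `|B i|.
  rewrite (bigD1 j)//= addrCA (le_trans (ler_norm _))// lerDl addr_ge0//.
  exact: sumr_ge0.
have C1 : 1 <= 1 + \sum_(i < d) `|B i| by rewrite lerDl; exact: sumr_ge0.
exists (1 + \sum_(i < d) `|B i|); first exact: le_trans C1.
move=> y j; have e1 : 1 <= expR (lam * `|y|) by rewrite -expR0 ler_expR mulr_ge0.
have [yM|My] := leP y M; last first.
  rewrite (le_trans (hp y _ j)) ?ler_peMl ?expR_ge0//.
  by rewrite (le_lt_trans _ My)// (le_trans (ler_norm _))// /M le_max lexx.
have [My|yM'] := leP (- M) y; last first.
  rewrite (le_trans (hm y _ j)) ?ler_peMl ?expR_ge0//.
  by rewrite (lt_le_trans yM')// lerNl (le_trans (ler_norm _))// normrN /M le_max lexx orbT.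
rewrite (le_trans (BP j y _)) ?My// (le_trans (BC j))// ler_peMr//.
exact: le_trans C1.
Qed.

Let shift_cst t x lam : R := lam * `|x| + 2 * t * lam ^+ 2 + (1 + `|x|) ^+ 2 / (8 * t).

(** With [r = |x - v|], half of the Gaussian exponent absorbs the growth through
    [lam r <= r^2 / (8 t) + 2 t lam^2]; the other half becomes a Gaussian in [y] of time [4 t],
    because [|y| <= 1 + |x| + r]. The factor [2] is the ratio of the normalisations. *)
Lemma heat_kernel_expR_le t x lam v y : 0 < t -> 0 <= lam -> `|v - y| <= 1 ->
  heat_kernel t (x - v) * expR (lam * `|v|) <=
  2 * expR (shift_cst t x lam) * heat_kernel (4 * t) y.
Proof.
move=> t0 lam0 vy; rewrite /heat_kernel.
have -> : 4 * pi * (4 * t) = 2 ^+ 2 * (4 * pi * t) by ring.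
have sE (s : R) : Num.sqrt (2 ^+ 2 * s) = 2 * Num.sqrt s.
  by rewrite sqrtrM ?sqr_ge0// sqrtr_sqr ger0_norm.
rewrite sE (invfM 2).
set c := (Num.sqrt _)^-1.
rewrite -(mulrA c) -expRD (_ : 2 * _ * _ = c * (expR (shift_cst t x lam) * expR (- (y ^+ 2 / (4 * (4 * t))))));
  last by field.
rewrite ler_wpM2l ?invr_ge0// -expRD ler_expR.
have [r rE] : exists r, r = `|x - v| by exists `|x - v|.
have r2 : (x - v) ^+ 2 = r ^+ 2 by rewrite rE real_normK ?num_real.
have [b bE] : exists b, b = 1 + `|x| by exists (1 + `|x|).
have vr : `|v| <= `|x| + r.
  by rewrite rE distrC; have := ler_normD x (v - x); rewrite addrC subrK.
have yr : y ^+ 2 <= 2 * r ^+ 2 + 2 * b ^+ 2.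
  have yb : `|y| <= b + r.
    have := ler_normD (y - v) v; rewrite subrK distrC => h.
    by rewrite bE (le_trans h)// -addrA lerD.
  apply: (@le_trans _ _ ((b + r) ^+ 2)).
    by rewrite -(real_normK (num_real y)) lerXn2r ?nnegrE// (le_trans _ yb).
  by have := sqr_ge0 (b - r); rewrite !expr2 => ?; nra.
rewrite /shift_cst r2 -bE.
have lv : lam * `|v| <= lam * `|x| + lam * r by rewrite -mulrDr ler_wpM2l.
have lr : lam * r <= r ^+ 2 / (8 * t) + 2 * t * lam ^+ 2.
  rewrite -subr_ge0 (_ : _ - _ = (r - 4 * t * lam) ^+ 2 / (8 * t)).
    by rewrite divr_ge0 ?sqr_ge0// mulr_ge0// ltW.
  by field; rewrite gt_eqF.
have yt : y ^+ 2 / (4 * (4 * t)) <= r ^+ 2 / (8 * t) + b ^+ 2 / (8 * t).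
  rewrite -mulrDl (_ : 4 * (4 * t) = 2 * (8 * t)); last by ring.
  rewrite invfM mulrA ler_wpM2r ?invr_ge0 ?mulr_ge0 ?(ltW t0)//.
  by rewrite ler_pdivrMr// mulrC mulrDr.
have rt : r ^+ 2 / (4 * t) = r ^+ 2 / (8 * t) + r ^+ 2 / (8 * t).
  by field; rewrite gt_eqF.
rewrite rt; move: lv lr yt; move: (r ^+ 2 / (8 * t)) (b ^+ 2 / (8 * t)) => p q.
by move: (lam * `|v|) (lam * `|x|) (lam * r) (2 * t * lam ^+ 2) (y ^+ 2 / (4 * (4 * t))) => *; lra.
Qed.

Lemma cvg_heat_flow d t x (g : R -> d.-tuple R) j : 0 < t -> Eexp g ->
  let f y := heat_kernel t (x - y) * tnth (g y) j in
  leb.-integrable setT (EFin \o f) /\ riemann_sum n f @[n --> \oo] --> \int[leb]_y f y.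
Proof.
move=> t0 [lam lam0 gl] f; rewrite /= in lam0; have [cg _ _] := gl.
have [C C0 gC] := Elambda_le (ltW lam0) gl.
apply: (@cvg_riemann_sum _ f (fun y => C * (2 * expR (shift_cst t x lam)) * heat_kernel (4 * t) y)).
- move=> y; apply: cvgM; last exact: cg.
  apply: (cvg_comp (fun y => x - y) (heat_kernel t)); last exact: continuous_heat_kernel.
  by apply: (@cvgB _ R^o); [exact: cvg_cst|exact: cvg_id].
- apply: eq_integrable (_ : leb.-integrable setT (fun y => (C * (2 * expR (shift_cst t x lam)))%:E * (heat_kernel (4 * t) y)%:E)%E) => //.
  apply: integrableZl => //; apply/integrableP; split.
    by apply/measurable_EFinP; exact: measurable_heat_kernel.
  have -> : (\int[leb]_y `|(heat_kernel (4 * t) y)%:E| =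
      \int[leb]_y (heat_kernel (4 * t) (0 - y))%:E)%E.
    apply: eq_integral => y _.
    by rewrite gee0_abs ?lee_fin ?heat_kernel_ge0// sub0r heat_kernelN.
  by rewrite integral_heat_kernel ?ltry// mulr_gt0.
move=> v y vy; rewrite /f normrM (ger0_norm (heat_kernel_ge0 _ _)).
rewrite (le_trans (ler_wpM2l (heat_kernel_ge0 _ _) (gC v j)))//.
by rewrite mulrCA -mulrA ler_wpM2l// heat_kernel_expR_le// ltW.
Qed.

End heat_flow.

(** * Increments of the string *)

Lemma measurable_fun_limn_einf d (X : measurableType d) (R : realType) (D : set X)
    (f : nat -> X -> \bar R) : (forall n, measurable_fun D (f n)) ->
  measurable_fun D (fun x => limn_einf (f ^~ x)).
Proof.
move=> mf; apply: (emeasurable_fun_cvg (fun n x => einfs (f ^~ x) n)).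
  exact: measurable_fun_einfs.
by move=> x _; rewrite limn_einf_lim; exact: is_cvg_einfs.
Qed.

Lemma limn_einf_ge0 (R : realType) (f : nat -> \bar R) : (forall n, 0 <= f n)%E ->
  (0 <= limn_einf f)%E.
Proof.
move=> f0; rewrite limn_einf_lim; apply: lime_ge; first exact: is_cvg_einfs.
by apply: nearW => n; apply: le_ereal_inf_tmp => _ [k _ <-].
Qed.

(** Fatou's lemma, after replacing [g] by the lower limit, to which it is almost everywhere
    equal. *)
Lemma ae_cvg_integral_le d (X : measurableType d) (R : realType) (m : {measure set X -> \bar R})
    (g_ : nat -> X -> \bar R) (g : X -> \bar R) (c : \bar R) :
  (forall n, measurable_fun setT (g_ n)) -> (forall n x, 0 <= g_ n x)%E ->
  measurable_fun setT g -> (forall x, 0 <= g x)%E ->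
  {ae m, forall x, g_ n x @[n --> \oo] --> g x} ->
  (forall n, \int[m]_x g_ n x <= c)%E -> (\int[m]_x g x <= c)%E.
Proof.
move=> mg_ g_0 mg g0 g_g gc.
rewrite (@ge0_ae_eq_integral _ _ _ m setT g (fun x => limn_einf (g_ ^~ x)))//.
- apply: (le_trans (fatou m measurableT mg_ (fun n x _ => g_0 n x))).
  exact: (limn_einf_le (N := 0)).
- exact: measurable_fun_limn_einf.
- by move=> x _; exact: limn_einf_ge0.
- by apply: filterS g_g => x /cvg_limn_einf_sup[-> _].
Qed.

(** * Measurability with respect to a sub-sigma-algebra *)

Section measurable_wrt.
Context {R : realType} {dO : measure_display} {T : measurableType dO}.
Variable G : set (set T).
Hypothesis sG : sigma_algebra setT G.

(** Since [G] is the sigma-algebra it generates, [measurable_wrt] becomes ordinary measurability on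
    the type that carries it, and the usual closure properties apply. *)
Let measurable_genE (d : measure_display) (Y : measurableType d) (X : T -> Y) :
  measurable_wrt G X <-> measurable_fun [set: g_sigma_algebraType G] X.
Proof.
split=> [mX _ B mB|mX B mB].
  rewrite setTI; apply: sub_sigma_algebra; exact: mX.
have := mX measurableT B mB; rewrite setTI /measurable /= => h.
by rewrite -(sigma_algebra_id sG).
Qed.

Lemma measurable_wrt_tuple d (X : 'I_d -> T -> R) : (forall j, measurable_wrt G (X j)) ->
  measurable_wrt G (fun w => [tuple X j w | j < d]).
Proof.
move=> mX; apply/measurable_genE/measurable_fun_tnthP => j.
rewrite (_ : _ \o _ = X j); first exact/measurable_genE.
by apply/funext => w /=; rewrite tnth_mktuple.
Qed.

Lemma measurable_wrtB (X Y : T -> R) : measurable_wrt G X -> measurable_wrt G Y ->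
  measurable_wrt G (fun w => X w - Y w).
Proof.
by move=> /measurable_genE mX /measurable_genE mY; apply/measurable_genE; exact: measurable_funB.
Qed.

Lemma measurable_wrt_riemann_sum d n (c : R -> R) (X : R -> T -> d.-tuple R) j :
  (forall y, measurable_wrt G (X y)) ->
  measurable_wrt G (fun w => riemann_sum n (fun y => c y * tnth (X y w) j)).
Proof.
move=> mX; apply/measurable_genE; apply: measurable_sum => k.
apply: measurable_funM => //; apply: measurable_funM => //.
have /measurable_genE/measurable_fun_tnthP := mX (grid n k); exact.
Qed.

End measurable_wrt.

(** * Expected kernel of an increment of the string *)

Section string.
Context {R : realType} {dO : measure_display} {T : measurableType dO}.
Variable P : probability T R.
Variables (F : R -> set (set T)) (d : nat) (W : 'I_d -> (R * R -> R) -> T -> R).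
Variable u : R -> R -> T -> d.-tuple R.
Hypotheses (Ffil : right_continuous_filtration F) (noise : white_noise P F W)
  (string : random_string P F W u) (d_lt6 : (d < 6)%N).
Local Notation leb := (@lebesgue_measure R).
Local Notation hk := (@heat_kernel R).
Local Notation hi := (@heat_integrand R).

Lemma measurable_string t x : 0 <= t -> measurable_fun setT (u t x).
Proof.
move=> t0 _ B mB; rewrite setTI; apply: (filtration_measurable Ffil t0).
exact: (string_adapted string).
Qed.

(** The division by [6] is the loss between the variance [S] and the lower bound [S / 6] that
    [gaussian_law] recovers from it. *)
Definition pair_cst : R := (2 * pi * (vcst / 6)) `^ (- (5 / 2)).

(* The drift enters only through its Riemann sums: finitely many [u 0 y] suffice for
   their measurability with respect to [F 0]. *)
Let drift t x (w : T) j : R := \int[leb]_r (hk t (x - r) * tnth (u 0 r w) j).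
Let drift_ n t x (w : T) j : R := riemann_sum n (fun r => hk t (x - r) * tnth (u 0 r w) j).

Let cvg_drift t x : 0 < t ->
  {ae P, forall w, forall j, drift_ n t x w j @[n --> \oo] --> drift t x w j}.
Proof.
move=> t0; apply: filterS (string_init string) => w uw j.
by have [_] := @cvg_heat_flow R d t x (fun r => u 0 r w) j t0 uw.
Qed.

(** With the drift replaced by its [n]-th Riemann sums, independence from the noise gives a bound
    that depends neither on [n] nor on [e]; Fatou then lets [n] tend to infinity. *)
Lemma string_increment_le (e t x s y : R) : 0 < e -> 0 < t -> 0 < s ->
  (\int[P]_w (hkd e (tsub (u t x w) (u s y w)))%:E <= pairk pair_cst (t, x) (s, y))%E.
Proof.
move=> e0 t0 s0.
have v0 : 0 < @vcst R by rewrite invr_gt0 !mulr_gt0 ?pi_gt0.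
have K0 : 0 < pair_cst by rewrite powR_gt0// !mulr_gt0 ?divr_gt0 ?pi_gt0.
have [txsy|txsy] := pselect ((t, x) = (s, y)).
  by rewrite pairk_pinfty ?leey//; apply: Or33.
pose h := hi t x \- hi s y.
have h2 : L2_spacetime h by apply: L2_spacetimeB; exact: heat_integrand_L2.
have ih := L2_spacetimeM h2 h2.
pose S := fine (\int[lebesgue2]_(z in spacetime) (h z * h z)%:E)%E.
have SE : (\int[lebesgue2]_(z in spacetime) ((h \* h) z)%:E = S%:E)%E.
  by rewrite fineK//; apply: integrable_fin_num => //; exact: measurable_spacetime.
have [Sts Sxy] : vcst * Num.sqrt `|t - s| <= S /\
    vcst * Num.min `|x - y| (Num.sqrt (Num.min t s)) <= S.
  have SE2 : (\int[lebesgue2]_(z in spacetime) ((hi t x z - hi s y z) ^+ 2)%:E = S%:E)%E.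
    by rewrite -SE; apply: eq_integral => z _; rewrite expr2.
  by have [] := @variance_ge R t x s y s0 t0; rewrite SE2 !lee_fin.
(* Distinct points differ in time or in space; each case is settled by one of the two variance
   bounds. *)
have S0 : 0 < S.
  have [ts|ts] := eqVneq t s; last first.
    by rewrite (lt_le_trans _ Sts)// mulr_gt0// sqrtr_gt0 normr_gt0 subr_eq0.
  rewrite (lt_le_trans _ Sxy)// mulr_gt0// !lt_min normr_gt0 sqrtr_gt0 lt_min t0 s0 !andbT.
  by rewrite subr_eq0; apply: contra_not_neq txsy => xy; rewrite ts xy.
have v6 : 0 < @vcst R / 6 by rewrite divr_gt0.
apply: le_trans (@pairk_ge R t x s y (vcst / 6) (S / 6) d d_lt6 v6 s0 t0 _ _); last 2 first.
- by rewrite mulrAC ler_pM2r.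
- by rewrite mulrAC ler_pM2r.
(* The drifts are subtracted in the opposite order, so that [tsub (N w) (D n w)] approximates
   [u t x w - u s y w]. *)
pose D n w := [tuple drift_ n s y w j - drift_ n t x w j | j < d].
have FD n : measurable_wrt (F 0) (D n).
  have F0 := filtration_sigma_algebra Ffil (lexx 0).
  apply: measurable_wrt_tuple => // j; apply: measurable_wrtB => //.
  + by apply: measurable_wrt_riemann_sum => // r; exact: (string_init_measurable string).
  + by apply: measurable_wrt_riemann_sum => // r; exact: (string_init_measurable string).
have mD n : measurable_fun setT (D n).
  move=> _ B mB; rewrite setTI; apply: (filtration_measurable Ffil (lexx 0)).
  exact: FD.
pose N w := [tuple W j h w | j < d].
have mN : measurable_fun setT N.
  apply/measurable_fun_tnthP => j.
  rewrite (_ : _ \o _ = W j h); first exact: (measurable_noise noise).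
  by apply/funext => w /=; rewrite tnth_mktuple.
apply: (@ae_cvg_integral_le _ _ _ _ (fun n w => (hkd e (tsub (N w) (D n w)))%:E)).
- by move=> n; apply/measurable_EFinP; exact: measurable_hkd_tsub.
- by move=> n w; rewrite lee_fin hkd_ge0.
- by apply/measurable_EFinP; apply: measurable_hkd_tsub; apply: measurable_string; exact: ltW.
- by move=> w; rewrite lee_fin hkd_ge0.
- have Wh : {ae P, forall w, forall j, W j h w = W j (hi t x) w - W j (hi s y) w}.
    apply: filter_forall => j; apply: (noiseB noise); exact: heat_integrand_L2.
  have ut := string_mild string x t0; have us := string_mild string y s0.
  apply: filterS2 (filterI Wh (filterI ut us)) (filterI (cvg_drift x t0) (cvg_drift y s0)).
  move=> w [Whw [utw usw]] [ct cs]; apply: cvg_EFin; first exact: nearW.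
  apply: cvg_hkd => j; rewrite tnth_tsub utw usw.
  under eq_fun do rewrite tnth_tsub !tnth_mktuple Whw.
  rewrite -/(drift t x w j) -/(drift s y w j).
  rewrite (_ : _ - (drift s y w j + _) = W j (hi t x) w - W j (hi s y) w -
    (drift s y w j - drift t x w j)); last by ring.
  by apply: cvgB; [exact: cvg_cst|exact: cvgB].
- move=> n; exact: (noise_future_integral_le noise h2 S0 SE e0 (mD n) (FD n)).
Qed.

End string.

(** * Energy of the occupation measure *)

Section measurable_version.
Context {R : realType} {dO : measure_display} {T : measurableType dO} {d : nat}.
Variables (N : set T) (u : R -> R -> T -> d.-tuple R).
Hypotheses (mN : measurable N) (mu : forall t x, 0 <= t -> measurable_fun setT (u t x))
  (cu : forall w, ~ N w -> forall j,
    {within spacetime, continuous (fun z : R * R => tnth (u z.1 z.2 w) j)}).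

(* Off [N] the paths are continuous, so that this version is an everywhere limit of
   its values on grids, hence jointly measurable. *)
Definition regular_version (w : T) (z : R * R) : d.-tuple R :=
  if (w \in N) || (z.1 < 0) then [tuple 0 | _ < d] else u z.1 z.2 w.

(** Grid times may be negative, where the continuity assumption says nothing about [u];
    [Num.max r 0] reads the nearest admissible time instead. *)
Let approx j n (p : T * (R * R)) : R :=
  (if (p.1 \in N) || (p.2.1 < 0) then 0 else 1) *
  step_approx n (fun r => step_approx n (fun q => tnth (u (Num.max r 0) q p.1) j) p.2.2) p.2.1.

Let mz1 : measurable_fun setT (fun p : T * (R * R) => p.2.1).
Proof. exact: (measurableT_comp measurable_fst measurable_snd). Qed.

Let mz2 : measurable_fun setT (fun p : T * (R * R) => p.2.2).
Proof. exact: (measurableT_comp measurable_snd measurable_snd). Qed.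

Let measurable_grid_cell n k (f : T * (R * R) -> R) : measurable_fun setT f ->
  measurable_fun setT (fun p => grid_cell n k (f p)).
Proof.
move=> mf; apply: (measurableT_comp _ mf); apply: measurable_indic; exact: measurable_itv.
Qed.

Let measurable_approx j n : measurable_fun setT (approx j n).
Proof.
apply: measurable_funM.
  apply: measurable_fun_ifT => //; apply: measurable_or.
    have -> : (fun p : T * (R * R) => p.1 \in N) = (fun w => w \in N) \o fst by [].
    apply: measurableT_comp => //; apply: (measurable_fun_bool true).
    rewrite setTI (_ : _ @^-1` _ = N)//.
    by apply/seteqP; split => w /= => [/set_mem|/mem_set].
  exact: measurable_fun_ltr.
apply: measurable_sum => k; apply: measurable_funM; last exact: measurable_grid_cell.
apply: measurable_sum => l; apply: measurable_funM; last exact: measurable_grid_cell.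
have m0 : 0 <= Num.max (@grid R n k) 0 by rewrite le_max lexx orbT.
have /measurable_fun_tnthP/(_ j) := mu (grid n l) m0.
move=> h; exact: (measurableT_comp h measurable_fst).
Qed.

Let cvg_approx j p : approx j n p @[n --> \oo] --> tnth (regular_version p.1 p.2) j.
Proof.
case: p => w [t x]; rewrite /approx /regular_version /=.
case: ifPn => [_|]; first by rewrite tnth_mktuple; under eq_fun do rewrite mul0r; exact: cvg_cst.
rewrite negb_or -leNgt => /andP[wN t0].
under eq_fun do rewrite mul1r.
have {}wN : ~ N w by move/negP : wN; rewrite inE.
have /subspace_continuousP/(_ (t, x) t0) := @cu w wN j.
move=> /cvgrPdist_lt c; apply/cvgrPdist_lt => e e0.
have := c e e0; rewrite near_withinE -nbhs_nearE => /nbhs_ballP[r /= r0 rball].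
have c1 : n.+1%:R^-1 @[n --> \oo] --> (0 : R) by exact: cvg_harmonic.
have nr : \forall n \near \oo, (n.+1%:R^-1 : R) < r.
  by move/cvgr_lt: c1; apply.
have large (y : R) : \forall n \near \oo, `|y| < (n.+1%:R : R).
  exists (Num.truncn `|y|) => // n /= yn; apply: lt_le_trans (truncnS_gt _) _.
  by rewrite ler_nat.
apply: filterS2 nr (filterI (large t) (large x)) => n nr [tn xn].
have [[v vt ->]|[_]] := step_approxP n (fun r => step_approx n (fun q => tnth (u (Num.max r 0) q w) j) x) t; last first.
  by rewrite leNgt tn.
have [[v' vx ->]|[_]] := step_approxP n (fun q => tnth (u (Num.max v 0) q w) j) x; last first.
  by rewrite leNgt xn.
apply: (rball (Num.max v 0, v')); last by rewrite /spacetime /= le_max lexx orbT.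
split; rewrite /ball /= distrC; last exact: le_lt_trans vx nr.
apply: le_lt_trans nr; apply: le_trans vt.
(* Truncation at [0] does not increase the distance to [t >= 0]. *)
have [v0|//] := leP v 0; rewrite sub0r normrN (ger0_norm t0).
have vt0 : v - t <= 0 by rewrite subr_le0 (le_trans v0).
by rewrite (ler0_norm vt0) opprB lerDl oppr_ge0.
Qed.

Lemma measurable_regular_version :
  measurable_fun setT (fun p : T * (R * R) => regular_version p.1 p.2).
Proof.
apply/measurable_fun_tnthP => j.
apply: (measurable_fun_cvg (h := approx j)) => //.
Qed.

Lemma regular_versionE w t x : ~ N w -> 0 <= t -> regular_version w (t, x) = u t x w.
Proof. by move=> Nw t0; rewrite /regular_version memNset// ltNge t0. Qed.

End measurable_version.

Lemma rectangleP (R : realType) (I : set (R * R)) : rectangle I ->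
  exists (M : R) (A B : set R), [/\ 0 < M,
    measurable A /\ measurable B, A `<=` `[- M, M] /\ B `<=` `[- M, M],
    A `<=` [set t | 0 <= t] & I = A `*` B].
Proof.
move=> [i [j [[Mi [_ hi]] [Mj [_ hj]] i0 ->]]].
pose M := Num.max `|Mi| `|Mj| + 1.
have M0 : 0 < M by rewrite ltr_wpDl// le_max normr_ge0.
have iM : Mi < M by rewrite ltr_pwDr// le_max ler_norm.
have jM : Mj < M by rewrite ltr_pwDr// le_max ler_norm orbT.
exists M, [set` i], [set` j]; split => //.
split=> r /= ri; rewrite in_itv/= -ler_norml.
  exact: (hi M iM r ri).
exact: (hj M jM r ri).
Qed.

Section string_energy.
Context {R : realType} {dO : measure_display} {T : measurableType dO}.
Variable P : probability T R.
Variables (F : R -> set (set T)) (d : nat) (W : 'I_d -> (R * R -> R) -> T -> R).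
Variable u : R -> R -> T -> d.-tuple R.
Hypotheses (Ffil : right_continuous_filtration F) (noise : white_noise P F W)
  (string : random_string P F W u) (d_lt6 : (d < 6)%N).
Local Notation leb := (@lebesgue_measure R).
Local Notation Z := (measurableTypeR R * measurableTypeR R)%type.
Local Notation e_ n := (2 / n.+1%:R : R).
Variables (N : set T) (M : R) (A B : set R).
Hypotheses (mN : measurable N) (PN : P N = 0%E)
  (cu : forall w, ~ N w -> forall j,
    {within spacetime, continuous (fun z : R * R => tnth (u z.1 z.2 w) j)}).
Hypotheses (M0 : 0 < M) (mA : measurable A) (mB : measurable B)
  (AM : A `<=` `[- M, M]) (BM : B `<=` `[- M, M]) (A0 : A `<=` [set t | 0 <= t]).
Local Notation I := (A `*` B : set Z).

Let mI : measurable I. Proof. exact: measurableX. Qed.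

Let lebI : (@lebesgue2 R I < +oo)%E.
Proof.
have itv_lt (D : set R) : measurable D -> D `<=` `[- M, M] -> (leb D < +oo)%E.
  move=> mD DM; apply: (@le_lt_trans _ _ (leb `[- M, M])).
    by apply: le_measure; rewrite ?inE//; exact: measurable_itv.
  by rewrite lebesgue_measure_itv/=; case: ifP => _; rewrite -?EFinB ltry.
have -> : @lebesgue2 R I = (leb A * leb B)%E by exact: product_measure1E.
by rewrite lte_mul_pinfty ?ge0_fin_numE ?itv_lt.
Qed.

Definition box_measure : {finite_measure set Z -> \bar R} := mfrestr mI lebI.

Let box_measureE (f : Z -> \bar R) : measurable_fun setT f -> (forall z, 0 <= f z)%E ->
  (\int[box_measure]_z f z = \int[leb]_(r in A) \int[leb]_(y in B) f (r, y))%E.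
Proof.
move=> mf f0; rewrite ge0_integral_mrestr// integral_mkcond integral_lebesgue2; last 2 first.
- by apply: (measurable_restrictT _ mI).1; exact: measurable_funTS.
- by move=> z; rewrite patchE; case: ifP.
rewrite [RHS]integral_mkcond; apply: eq_integral => r _; rewrite patchE.
have [rA|rA] := boolP (r \in A).
  rewrite [RHS]integral_mkcond; apply: eq_integral => y _; rewrite !patchE.
  by congr (if _ then _ else _); rewrite in_setX rA.
by rewrite integral0_eq// => y _; rewrite patchE in_setX (negbTE rA).
Qed.

Local Notation m := box_measure.
Local Notation v := (regular_version N u).

Let mv : measurable_fun [set: T * Z] (fun p => v p.1 p.2).
Proof.
apply: measurable_regular_version => // t x t0.
exact: (measurable_string Ffil string).
Qed.

Let mvw w : measurable_fun [set: Z] (v w).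
Proof. exact: (measurableT_comp mv (measurable_pair1 w)). Qed.

Let hkp n (p : (T * Z) * Z) : \bar R := (hkd (e_ n) (tsub (v p.1.1 p.1.2) (v p.1.1 p.2)))%:E.

Let hkp_ge0 n p : (0 <= hkp n p)%E. Proof. by rewrite lee_fin hkd_ge0. Qed.

Let mhkp n : measurable_fun setT (hkp n).
Proof.
apply/measurable_EFinP; apply: measurable_hkd_tsub.
  exact: (measurableT_comp mv measurable_fst).
have h : measurable_fun setT (fun p : (T * Z) * Z => (p.1.1, p.2)).
  apply/measurable_fun_pairP; split; last exact: measurable_snd.
  exact: (measurableT_comp measurable_fst measurable_fst).
exact: (measurableT_comp mv h).
Qed.

(** The time [2 / (n + 1)] is the sum of two mollification times [1 / (n + 1)]. *)
Definition string_energy n w : \bar R :=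
  (\int[m]_z \int[m]_z' (hkd (e_ n) (tsub (v w z) (v w z')))%:E)%E.

Let inner n (p : T * Z) : \bar R := (\int[m]_z' hkp n (p, z'))%E.

Let minner n : measurable_fun setT (inner n).
Proof. exact: (@measurable_fun_fubini_tonelli_F _ _ (T * Z)%type Z R m (hkp n)). Qed.

Let inner_ge0 n p : (0 <= inner n p)%E. Proof. exact: integral_ge0. Qed.

Let measurable_string_energy n : measurable_fun setT (string_energy n).
Proof. exact: (@measurable_fun_fubini_tonelli_F _ _ T Z R m (inner n)). Qed.

Let mean n (q : Z * Z) : \bar R := (\int[P]_w hkp n ((w, q.1), q.2))%E.

Let mmean n : measurable_fun setT (mean n).
Proof.
pose K (p : T * (Z * Z)) := hkp n ((p.1, p.2.1), p.2.2).
have h : measurable_fun setT (fun p : T * (Z * Z) => ((p.1, p.2.1), p.2.2)).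
  apply/measurable_fun_pairP; split; last exact: (measurableT_comp measurable_snd measurable_snd).
  apply/measurable_fun_pairP; split; first exact: measurable_fst.
  exact: (measurableT_comp measurable_fst measurable_snd).
have mK : measurable_fun setT K by exact: (measurableT_comp (mhkp n) h).
have K0 p : (0 <= K p)%E by exact: hkp_ge0.
exact: (@measurable_fun_fubini_tonelli_G _ _ T (Z * Z)%type R P K).
Qed.

Let mean_ge0 n q : (0 <= mean n q)%E. Proof. exact: integral_ge0. Qed.

(** Tonelli twice: the expectation passes inside one space-time integral at a time. *)
Let string_energy_swap n :
  (\int[P]_w string_energy n w = \int[m]_z \int[m]_z' mean n (z, z'))%E.
Proof.
rewrite (@fubini_tonelli _ _ T Z R P m (inner n))//.
apply: eq_integral => z _.
pose K (p : T * Z) := hkp n ((p.1, z), p.2).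
have h : measurable_fun setT (fun p : T * Z => ((p.1, z), p.2)).
  apply/measurable_fun_pairP; split; last exact: measurable_snd.
  apply/measurable_fun_pairP; split; [exact: measurable_fst|exact: measurable_cst].
have mK : measurable_fun setT K by exact: (measurableT_comp (mhkp n) h).
have K0 p : (0 <= K p)%E by exact: hkp_ge0.
exact: (@fubini_tonelli _ _ T Z R P m K).
Qed.

Local Notation C := (@pair_cst R).

Let C0 : 0 < C.
Proof. by rewrite powR_gt0// !mulr_gt0 ?divr_gt0 ?pi_gt0// invr_gt0 !mulr_gt0 ?pi_gt0. Qed.

Let e_gt0 n : 0 < e_ n. Proof. by rewrite divr_gt0. Qed.

(** Off the null set [N] the version agrees with [u], and the bound on increments applies at
    positive times; at time [0] the kernel is infinite. *)
Let mean_le n z z' : I z -> I z' -> (mean n (z, z') <= pairk C z z')%E.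
Proof.
case: z z' => [t x] [s y] [/= At Bx] [/= As By].
have t0 : 0 <= t := A0 At. have s0 : 0 <= s := A0 As.
have [t00|tn0] := eqVneq t 0; first by rewrite pairk_pinfty ?leey//; apply: Or31.
have [s00|sn0] := eqVneq s 0; first by rewrite pairk_pinfty ?leey//; apply: Or32.
have tp : 0 < t by rewrite lt_neqAle eq_sym tn0.
have sp : 0 < s by rewrite lt_neqAle eq_sym sn0.
apply: le_trans (string_increment_le Ffil noise string d_lt6 x y (e_gt0 n) tp sp).
rewrite le_eqVlt; apply/orP; left; apply/eqP.
apply: ge0_ae_eq_integral => //.
- have h : measurable_fun [set: T] (fun w => ((w, (t, x) : Z), (s, y) : Z)).
    apply/measurable_fun_pairP; split; last exact: measurable_cst.
    apply/measurable_fun_pairP; split; [exact: measurable_id|exact: measurable_cst].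
  exact: (measurableT_comp (mhkp n) h).
- apply/measurable_EFinP; apply: measurable_hkd_tsub; exact: (measurable_string Ffil string).
- by move=> w _; rewrite lee_fin hkd_ge0.
- exists N; split => // w /= h; apply: contrapT => Nw; apply: h => _.
  by rewrite /hkp /= !regular_versionE.
Qed.

(** The integral of the pair kernel bounds the expected energies uniformly in [n], so by Fatou their
    lower limit is integrable, hence almost surely finite. *)
Lemma limn_einf_string_energy :
  {ae P, forall w, exists K : R, (limn_einf (string_energy ^~ w) <= K%:E)%E}.
Proof.
pose Q := (\int[m]_z \int[m]_z' pairk C z z')%E.
have Qoo : (Q < +oo)%E by exact: (integral_pairk_lt M0 (ltW C0) mA mB AM BM box_measureE).
have mp := @measurable_pairk R C.
have p0 q : (0 <= pairk C q.1 q.2)%E by rewrite pairk_ge0// ltW.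
have EQ n : (\int[P]_w string_energy n w <= Q)%E.
  rewrite string_energy_swap; apply: le_integral_mrestr.
  - exact: (@measurable_fun_fubini_tonelli_F _ _ Z Z R m (mean n)).
  - by move=> z; exact: integral_ge0.
  - exact: (@measurable_fun_fubini_tonelli_F _ _ Z Z R m (fun p => pairk C p.1 p.2)).
  - by move=> z; apply: integral_ge0 => z' _; exact: (p0 (z, z')).
  move=> z Iz; apply: le_integral_mrestr.
  - exact: (measurableT_comp (mmean n) (measurable_pair1 z)).
  - by move=> z'.
  - exact: (measurableT_comp mp (measurable_pair1 z)).
  - by move=> z'; exact: (p0 (z, z')).
  by move=> z' Iz'; exact: mean_le.
have se0 n w : (0 <= string_energy n w)%E.
  by apply: integral_ge0 => z _; apply: integral_ge0 => z' _; rewrite lee_fin hkd_ge0.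
have ml : measurable_fun setT (fun w => limn_einf (string_energy ^~ w)).
  exact: measurable_fun_limn_einf.
have l0 w : (0 <= limn_einf (string_energy ^~ w))%E by exact: limn_einf_ge0.
have il : P.-integrable setT (fun w => limn_einf (string_energy ^~ w)).
  apply/integrableP; split => //.
  under eq_integral do rewrite gee0_abs//.
  apply: le_lt_trans Qoo; apply: (le_trans (fatou P measurableT _ _)) => //.
  exact: (limn_einf_le (N := 0)).
apply: filterS (integrable_ae measurableT il) => w /(_ Logic.I) lfin.
by exists (fine (limn_einf (string_energy ^~ w))); rewrite fineK.
Qed.

(** Stated as an equality of functions on all sets, so that it can be rewritten inside the
    conclusion about local times. *)
Lemma occupation_version w : ~ N w ->
  occupation (fun t x => u t x w) I = image_finite_measure m (mvw w) :> (set _ -> \bar R).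
Proof.
move=> Nw; apply/funext => D; rewrite /occupation /image_finite_measure image_measureE.
change (lebesgue2 (A `*` B `&` [set z | D (u z.1 z.2 w)]) = lebesgue2 (v w @^-1` D `&` I)).
congr (lebesgue2 _); rewrite setIC; apply/seteqP.
by split => -[t x] [/= h [/= At Bx]]; split => //; move: h; rewrite /= regular_versionE//; exact: A0.
Qed.

Lemma limn_einf_energy_version w : limn_einf (string_energy ^~ w) =
  limn_einf (fun n => \int[image_finite_measure m (mvw w)]_y
    \int[image_finite_measure m (mvw w)]_z (hkd (e_ n) (tsub y z))%:E)%E.
Proof.
congr limn_einf; apply/funext => n; rewrite /string_energy.
have mg (y : d.-tuple R) : measurable_fun setT (fun z => (hkd (e_ n) (tsub y z))%:E).
  by apply/measurable_EFinP; exact: measurable_hkd_tsub.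
rewrite ge0_integral_image_measure.
- apply: eq_integral => z _.
  by rewrite ge0_integral_image_measure// => y; rewrite lee_fin hkd_ge0.
- exact: mvw.
- apply: (@measurable_fun_fubini_tonelli_F _ _ _ _ R (image_finite_measure m (mvw w))
    (fun p => (hkd (e_ n) (tsub p.1 p.2))%:E)).
  + by apply/measurable_EFinP; exact: measurable_hkd_tsub.
  + by move=> p; rewrite lee_fin hkd_ge0.
- by move=> y; apply: integral_ge0 => z _; rewrite lee_fin hkd_ge0.
Qed.

Let integral_occupation w (f : d.-tuple R -> R) : ~ N w -> measurable_fun setT f ->
  \int[lebesgue2]_(z in I) f (u z.1 z.2 w) = \int[image_finite_measure m (mvw w)]_y f y.
Proof.
move=> Nw mf; rewrite /Rintegral; congr fine.
have mfE : measurable_fun setT (EFin \o f) by exact/measurable_EFinP.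
transitivity (\int[lebesgue2]_(z in I) (f (v w z))%:E)%E.
  apply: eq_integral => -[t x]; rewrite inE => -[/= At Bx].
  by rewrite regular_versionE//; exact: A0.
transitivity (\int[m]_z (f (v w z))%:E)%E; apply/esym.
  exact: (@integral_mrestr _ _ _ _ _ mI (fun z => (f (v w z))%:E) (measurableT_comp mfE (mvw w))).
exact: (@integral_image_measure _ _ _ _ _ m _ (mvw w) (EFin \o f) mfE).
Qed.

Lemma occupation_fourier_version w : ~ N w ->
  occupation_fourier (fun t x => u t x w) I =
  (fun y => Complex (fourier_cos (image_finite_measure m (mvw w)) y)
                    (fourier_sin (image_finite_measure m (mvw w)) y)).
Proof.
move=> Nw; apply/funext => y; rewrite /occupation_fourier /Cintegral /expi /=.
congr Complex.
  rewrite (integral_occupation (f := fun z => cos (dotp y z)) Nw)//.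
  by apply: measurable_fun_cos; exact: measurable_dotp.
rewrite (integral_occupation (f := fun z => sin (dotp y z)) Nw)//.
by apply: measurable_fun_sin; exact: measurable_dotp.
Qed.

End string_energy.

(** * Local times of measures of finite energy *)

Local Open Scope complex_scope.

Lemma prode_le {R : realType} n (f g : 'I_n -> \bar R) :
  (forall i, 0 <= f i <= g i)%E -> (\prod_(i < n) f i <= \prod_(i < n) g i)%E.
Proof.
move=> fg; suff : (0 <= \prod_(i < n) f i <= \prod_(i < n) g i)%E by case/andP.
elim: (index_enum _) => [|i r IH]; first by rewrite !big_nil lexx lee01.
rewrite !big_cons; have /andP[f0 fgi] := fg i; have /andP[r0 rr] := IH.
by rewrite mule_ge0// lee_pmul.
Qed.

Section finite_energy.
Context {R : realType} {d : nat}.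
Variables (mu : {finite_measure set (d.-tuple R) -> \bar R}) (K : R).
Local Notation lebn := (@lebesgue_tuple R d).
Local Notation e_ n := (n.+1%:R^-1 : R).
Local Notation mu2 := (square_measure mu).

Hypothesis energy_le : (limn_einf (fun n : nat =>
  \int[mu]_y \int[mu]_z (hkd (2 / n.+1%:R) (tsub y z))%:E) <= K%:E)%E.

Let e_gt0 n : 0 < e_ n. Proof. by rewrite invr_gt0. Qed.

Let twopi_gt0 : 0 < (2 * pi : R) ^+ d.
Proof. by rewrite exprn_gt0// mulr_gt0// pi_gt0. Qed.

Let cvg_gaussd_e (v : d.-tuple R) : gaussd (e_ n) v @[n --> \oo] --> (1 : R).
Proof.
have : expR (- (e_ n * dotp v v)) @[n --> \oo] --> expR (- (0 * dotp v v)).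
  apply: (cvg_comp _ expR); last exact: continuous_expR.
  by apply: (@cvgN _ R^o); apply: cvgMl; exact: cvg_harmonic.
by rewrite mul0r oppr0 expR0; under eq_fun do rewrite -gaussdE.
Qed.

(** The energies are [(2 pi)^-d] times the integrals of [fourier_sqr] with weights that tend to [1];
    Fatou transfers their finite lower limit to the unweighted integral. *)
Lemma integral_fourier_sqr_lty : (\int[lebn]_v (fourier_sqr mu v)%:E < +oo)%E.
Proof.
pose c : R := (2 * pi) ^- d; have c0 : 0 < c by rewrite invr_gt0.
pose g n v := c * (gaussd (e_ n + e_ n) v * fourier_sqr mu v).
have g0 n v : 0 <= g n v by rewrite mulr_ge0 ?(ltW c0)// mulr_ge0 ?gaussd_ge0 ?fourier_sqr_ge0.
have E v : limn_einf (fun n => (g n v)%:E) = (c * fourier_sqr mu v)%:E.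
  suff /cvg_limn_einf_sup[-> _] : (g n v)%:E @[n --> \oo] --> (c * fourier_sqr mu v)%:E by [].
  apply: cvg_EFin; first exact: nearW.
  apply: cvgMr; rewrite -[X in _ --> X]mul1r; apply: cvgMl.
  have : gaussd (e_ n) v * gaussd (e_ n) v @[n --> \oo] --> (1 * 1 : R).
    by apply: cvgM; exact: cvg_gaussd_e.
  rewrite mulr1; apply: cvg_trans; by apply: near_eq_cvg; apply: nearW => n; rewrite gaussdD.
have msqr : measurable_fun setT (fun v => (fourier_sqr mu v)%:E).
  by apply/measurable_EFinP; exact: measurable_fourier_sqr.
suff : (\int[lebn]_v (c * fourier_sqr mu v)%:E <= K%:E)%E.
  under eq_integral do rewrite EFinM.
  rewrite ge0_integralZl ?lee_fin ?(ltW c0)//; last by move=> v _; rewrite lee_fin fourier_sqr_ge0.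
  move: (\int[lebn]_v _)%E => [r| |]//=; first by rewrite ltry.
  by rewrite gt0_muley// lte_fin.
under eq_integral do rewrite -E.
apply: le_trans (fatou lebn measurableT _ _) _.
- move=> n; apply/measurable_EFinP; apply: measurable_funM => //.
  by apply: measurable_funM; [exact: measurable_gaussd|exact: measurable_fourier_sqr].
- by move=> n v _; rewrite lee_fin.
apply: le_trans energy_le; rewrite le_eqVlt; apply/orP; left; apply/eqP; congr limn_einf.
apply/funext => n; have ee : 0 < e_ n + e_ n by rewrite addr_gt0.
rewrite (_ : 2 / n.+1%:R = e_ n + e_ n); last by rewrite mulr_natl mulr2n.
have ig := integrable_gaussd_fourier_sqr mu ee.
under eq_integral do rewrite EFinM.
rewrite integralZl//= -[X in (_ * X)%E]fineK; last exact: integrable_fin_num.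
rewrite -/(Rintegral lebn setT (fun v => gaussd (e_ n + e_ n) v * fourier_sqr mu v)).
rewrite energy_fourier// -EFinM mulrA mulVf ?gt_eqF// mul1r.
have mh : measurable_fun setT (fun p : d.-tuple R * d.-tuple R => (hkd (e_ n + e_ n) (tsub p.1 p.2))%:E).
  by apply/measurable_EFinP; exact: measurable_hkd_tsub.
rewrite -(@fubini_tonelli1 _ _ _ _ _ mu mu _ mh)//; last by move=> p; rewrite lee_fin hkd_ge0.
rewrite /Rintegral fineK//.
rewrite -[X in X \is a _](integral_mollifyM mu (e_gt0 n) (e_gt0 n)).
by apply: integrable_fin_num => //; exact: integrable_mollifyM.
Qed.

Let integrable_fourier_sqr : lebn.-integrable setT (EFin \o fourier_sqr mu).
Proof.
apply/integrableP; split; first by apply/measurable_EFinP; exact: measurable_fourier_sqr.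
under eq_integral do rewrite /= ger0_norm ?fourier_sqr_ge0//.
exact: integral_fourier_sqr_lty.
Qed.

(** The squared [L^2] distance between [mu^] and its product with [gaussd (e_ n)]; up to the factor
    [(2 pi)^-d] it is the rate [delta] of the mollifications. *)
Let defect n := \int[lebn]_v ((1 - gaussd (e_ n) v) ^+ 2 * fourier_sqr mu v).

Let measurable_defect (a : R) (g : d.-tuple R -> R) : measurable_fun setT g ->
  measurable_fun setT (fun v => (g v - gaussd a v) ^+ 2 * fourier_sqr mu v).
Proof.
move=> mg; apply: measurable_funM; last exact: measurable_fourier_sqr.
by apply: measurable_funX; apply: measurable_funB => //; exact: measurable_gaussd.
Qed.

Let sqr01 (x y : R) : 0 <= y <= x -> x <= 1 -> (x - y) ^+ 2 <= (1 - y) ^+ 2 <= 1.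
Proof. by move=> /andP[? ?] ?; rewrite !expr2; apply/andP; split; nra. Qed.

Let integrable_defect n (g : d.-tuple R -> R) : measurable_fun setT g ->
  (forall v, gaussd (e_ n) v <= g v <= 1) ->
  lebn.-integrable setT (EFin \o (fun v => (g v - gaussd (e_ n) v) ^+ 2 * fourier_sqr mu v)).
Proof.
move=> mg g1; apply: le_integrable integrable_fourier_sqr => //.
  by apply/measurable_EFinP; exact: measurable_defect.
move=> v _; rewrite /= lee_fin normrM ler_piMl// ger0_norm ?sqr_ge0//.
have /andP[h1 h2] := g1 v.
by have /andP[? ?] := @sqr01 (g v) (gaussd (e_ n) v) ltac:(by rewrite gaussd_ge0 h1) h2; lra.
Qed.

Let cvg_defect : defect n @[n --> \oo] --> (0 : R).
Proof.
suff : (\int[lebn]_v ((1 - gaussd (e_ n) v) ^+ 2 * fourier_sqr mu v)%:E)%E @[n --> \oo] --> 0%E.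
  by move=> /fine_cvgP[].
rewrite -[X in _ --> X](integral0 lebn setT).
apply: (@dominated_cvg _ _ _ lebn setT measurableT
  (fun n v => ((1 - gaussd (e_ n) v) ^+ 2 * fourier_sqr mu v)%:E) _ (fun v => (fourier_sqr mu v)%:E)) => //.
- by move=> n; apply/measurable_EFinP; exact: measurable_defect.
- move=> v _; apply: cvg_EFin; first exact: nearW.
  rewrite -[X in _ --> X](mul0r (fourier_sqr mu v)); apply: cvgMl.
  suff : (1 - gaussd (e_ n) v) ^+ 2 @[n --> \oo] --> ((1 - 1) ^+ 2 : R) by rewrite subrr expr0n.
  apply: (cvg_comp (fun n => 1 - gaussd (e_ n) v) (fun r => r ^+ 2)); last exact: sqr_continuous.
  by apply: cvgB; [exact: cvg_cst|exact: cvg_gaussd_e].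
- move=> n v _; rewrite /= lee_fin normrM (ger0_norm (fourier_sqr_ge0 _ _)) ler_piMl ?fourier_sqr_ge0//.
  rewrite ger0_norm ?sqr_ge0//.
  by have /andP[_] := @sqr01 1 (gaussd (e_ n) v) ltac:(by rewrite gaussd_ge0 gaussd_le1// ltW) (lexx _).
Qed.

Let delta n := (2 * pi) ^- d * defect n.

Let cvg_delta : delta n @[n --> \oo] --> (0 : R).
Proof. by rewrite -[X in _ --> X](mulr0 ((2 * pi) ^- d)); apply: cvgMr. Qed.

(** Since [gaussd (e_ n) <= gaussd (e_ m) <= 1], replacing the larger weight by [1] enlarges the
    difference and leaves a bound that depends on [n] only. *)
Let mollify_cauchy n m : (n <= m)%N ->
  (\int[lebn]_x ((mollify mu (e_ n) x - mollify mu (e_ m) x) ^+ 2)%:E <= (delta n)%:E)%E.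
Proof.
move=> nm; have me : e_ m <= e_ n by rewrite lef_pV2 ?posrE// ler_nat.
rewrite integral_mollifyB_sqr// lee_fin ler_wpM2l ?invr_ge0 ?(ltW twopi_gt0)//.
have gm (v : d.-tuple R) : gaussd (e_ n) v <= gaussd (e_ m) v <= 1.
  rewrite gaussd_le1 ?andbT; last exact: ltW.
  by rewrite !gaussdE ler_expR lerN2 ler_wpM2r// dotp_ge0.
have g1 (v : d.-tuple R) : gaussd (e_ n) v <= 1 <= (1 : R) by rewrite gaussd_le1 ?lexx// ltW.
have -> : \int[lebn]_v ((gaussd (e_ n) v - gaussd (e_ m) v) ^+ 2 * fourier_sqr mu v) =
    \int[lebn]_v ((gaussd (e_ m) v - gaussd (e_ n) v) ^+ 2 * fourier_sqr mu v).
  by apply: eq_Rintegral => v _; rewrite -sqrrN opprB.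
apply: le_Rintegral => //.
- by apply: integrable_defect => //; exact: measurable_gaussd.
- by apply: (@integrable_defect n (fun=> 1)) => // v; exact: g1.
- move=> v _; rewrite ler_wpM2r ?fourier_sqr_ge0//.
  have /andP[h1 h2] := gm v.
  by have /andP[] := @sqr01 (gaussd (e_ m) v) (gaussd (e_ n) v) ltac:(by rewrite gaussd_ge0 h1) h2.
Qed.

(** The limit [L] is compared with [mu] on products of tents: these are Lipschitz, which gives
    convergence of the mollifications to [mu], and square integrable, which gives convergence to
    [L]. Letting the slope grow yields equality on open boxes. *)
Lemma finite_energy_density : exists L : d.-tuple R -> R,
  [/\ measurable_fun setT L, (forall x, 0 <= L x),
    (forall n, \int[lebn]_x ((mollify mu (e_ n) x - L x) ^+ 2)%:E <= (delta n)%:E)%E &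
    (forall A, measurable A -> mu A = \int[lebn]_(x in A) (L x)%:E)%E].
Proof.
have mm n : measurable_fun setT (mollify mu (e_ n)) by exact: measurable_mollify.
have [L [mL Ld L0]] := L2_cauchy_limit mm cvg_delta mollify_cauchy.
have {}L0 := L0 (fun n x => mollify_ge0 _ _ _).
exists L; split => // A mA.
have boxE a b : mu (open_box a b) = density_measure_pack lebn mL L0 (open_box a b).
  pose f k i := tent (a i) (b i) k.
  pose phi k (x : d.-tuple R) := \prod_(i < d) f k i (tnth x i).
  have f01 k i r : 0 <= f k i r <= 1 by rewrite tent_ge0 tent_le1.
  have phi0 k x : 0 <= phi k x by apply: prodr_ge0 => i _; exact: tent_ge0.
  have mphi k : measurable_fun setT (phi k).
    by apply: measurable_prod_tnth => i; exact: measurable_tent.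
  have phiE k : (\int[lebn]_x (L x * phi k x)%:E = \int[mu]_y (phi k y)%:E)%E.
    have iphi : mu.-integrable setT (EFin \o phi k).
      apply: (bounded_integrable mu (M := 1)) => // y.
      by rewrite ger0_norm// prodr_le1.
    (* The volume of the box, which bounds the integral of the squared test function; the maximum
       with [0] covers empty sides. *)
    pose F := \prod_(i < d) Num.max 0 (b i - a i).
    rewrite -[RHS]fineK ?integrable_fin_num//.
    apply: (L2_limit_test (f := fun n => mollify mu (e_ n)) (delta := delta) (F := F)) => //.
    - by move=> n x; exact: mollify_ge0.
    - under eq_integral do (rewrite /phi -prodrXl).
      rewrite (integral_prod_tnth (f := fun i r => f k i r ^+ 2)).
      + rewrite /F -prodEFin; apply: prode_le => i; apply/andP; split.
          by apply: integral_ge0 => r _; rewrite lee_fin sqr_ge0.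
        apply: (@le_trans _ _ (\int[lebesgue_measure]_r (\1_(`]a i, b i[%classic) r)%:E)%E).
          apply: ge0_le_integral => //.
          * by move=> r _; rewrite lee_fin sqr_ge0.
          * by apply/measurable_EFinP; apply: measurable_funX; exact: measurable_tent.
          * by apply/measurable_EFinP; exact: measurable_indic.
          * move=> r _; rewrite lee_fin indicE.
            have [rab|rab] := boolP (a i < r < b i).
              by rewrite mem_set ?in_itv//= exprn_ile1// ?tent_ge0 ?tent_le1.
            by rewrite /f tent_out// expr0n.
        rewrite integral_indic//= setIT lebesgue_measure_itv/= lte_fin.
        by case: ifPn => _; rewrite ?lee_fin -?EFinD ?lee_fin le_max lexx ?orbT.
      + by move=> i; apply: measurable_funX; exact: measurable_tent.
      + by move=> i r; exact: sqr_ge0.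
    - rewrite fineK ?integrable_fin_num//.
      apply: (cvg_mollify_test (C := k%:R)) => i; first exact: measurable_tent.
        by move=> r; exact: f01.
      by move=> r r'; exact: tent_lip.
  have cphi x : phi k x @[k --> \oo] --> (\1_(open_box a b) x : R).
    rewrite (_ : \1_(open_box a b) x = \prod_(i < d) (nat_of_bool (a i < tnth x i < b i)%R)%:R).
      rewrite /phi; elim: (index_enum _) => [|i r IH].
        by under eq_fun do rewrite big_nil; rewrite big_nil; exact: cvg_cst.
      under eq_fun do rewrite big_cons.
      by rewrite big_cons; apply: cvgM => //; exact: tent_cvg.
    rewrite indicE; have [xB|xB] := pselect (open_box a b x).
      by rewrite mem_set// big1// => i _; rewrite xB.
    rewrite memNset//; have /existsNP[i /negP/negbTE xi] := xB.
    by rewrite (bigD1 i)//= xi mul0r.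
  have nphi x k l : (k <= l)%N -> phi k x <= phi l x.
    by move=> kl; apply: ler_prod => i _; rewrite tent_ge0 tent_nd.
  have c1 : (\int[mu]_y (phi k y)%:E)%E @[k --> \oo] --> mu (open_box a b).
    have -> : mu (open_box a b) = (\int[mu]_y (\1_(open_box a b) y)%:E)%E.
      by rewrite integral_indic ?setIT//; exact: measurable_open_box.
    apply: (@dominated_cvg _ _ _ mu setT measurableT (fun k y => (phi k y)%:E) _ (fun=> 1%:E)) => //.
    + by move=> k; exact/measurable_EFinP.
    + by move=> y _; apply: cvg_EFin; [exact: nearW|exact: cphi].
    + exact: finite_measure_integrable_cst.
    + move=> k y _; rewrite /= lee_fin ger0_norm//.
      exact: prodr_le1.
  (* Monotone rather than dominated convergence, because the integrability of [L] is not known at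
     this point. *)
  have c2 : (\int[lebn]_x (L x * phi k x)%:E)%E @[k --> \oo] --> (\int[lebn]_(x in open_box a b) (L x)%:E)%E.
    rewrite integral_mkcond.
    rewrite (_ : (fun x => _) = (fun x => limn (fun k => (L x * phi k x)%:E))); last first.
      apply/funext => x; apply/esym/cvg_lim => //.
      rewrite (_ : (_ \_ _) x = (L x * \1_(open_box a b) x)%:E); last first.
        by rewrite patchE indicE; case: ifPn => _; rewrite ?mulr1 ?mulr0.
      by apply: cvg_EFin; [exact: nearW|apply: cvgMr].
    apply: cvg_monotone_convergence => //.
    + by move=> k; apply/measurable_EFinP; exact: measurable_funM.
    + by move=> k x _; rewrite lee_fin mulr_ge0.
    + by move=> x _ k l kl; rewrite lee_fin ler_wpM2l// nphi.
  apply: (cvg_unique _ c1); first exact: ereal_hausdorff.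
  by move: c2; under eq_fun do rewrite phiE.
have muT : (mu setT < +oo)%E by rewrite ltey_eq fin_num_measure.
exact: (measure_tuple_unique muT boxE).
Qed.

Let fourierC (v : d.-tuple R) : R[i] := fourier_cos mu v +i* fourier_sin mu v.
Let fourierC_ n (v : d.-tuple R) : R[i] := (gaussd (e_ n) v)%:C * fourierC v.

(** Fubini brings the Gaussian integral inside [mu]: its cosine part is the heat kernel centred at
    [x], its sine part vanishes, and the result is real. *)
Let inv_fourierC_ n x : inv_fourier (fourierC_ n) x = (mollify mu (e_ n) x)%:C.
Proof.
have md x' : measurable_fun setT (fun z : d.-tuple R * d.-tuple R => dotp z.1 (tsub z.2 x')).
  apply: measurable_dotp; first exact: measurable_fst.
  by apply: measurable_tsub; [exact: measurable_snd|exact: measurable_cst].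
have ic v : mu.-integrable setT (EFin \o (fun y => cos (dotp v y))).
  apply: (bounded_integrable mu (M := 1)); last by move=> y; exact: cos_max.
  by apply: measurable_fun_cos; exact: measurable_dotp.
have is_ v : mu.-integrable setT (EFin \o (fun y => sin (dotp v y))).
  apply: (bounded_integrable mu (M := 1)); last by move=> y; exact: sin_max.
  by apply: measurable_fun_sin; exact: measurable_dotp.
have sM (f : d.-tuple R -> R) (k : R) : mu.-integrable setT (EFin \o f) ->
    mu.-integrable setT (EFin \o (fun t => k * f t)).
  by move=> fi; rewrite /comp; under eq_fun do rewrite EFinM; exact: integrableZl.
have linE v (a b : R) : a * fourier_cos mu v + b * fourier_sin mu v =
    \int[mu]_y (a * cos (dotp v y) + b * sin (dotp v y)).
  by rewrite RintegralD ?RintegralZl//; exact: sM.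
have ReE v : complex.Re (expi (- dotp v x) * fourierC_ n v) =
    gaussd (e_ n) v * \int[mu]_y cos (dotp v (tsub y x)).
  transitivity (gaussd (e_ n) v * (cos (dotp v x) * fourier_cos mu v + sin (dotp v x) * fourier_sin mu v)).
    by rewrite /= cosN sinN; ring.
  rewrite linE; congr (_ * _); apply: eq_Rintegral => y _.
  by rewrite dotp_tsub cosB; ring.
have ImE v : complex.Im (expi (- dotp v x) * fourierC_ n v) =
    gaussd (e_ n) v * \int[mu]_y sin (dotp v (tsub y x)).
  transitivity (gaussd (e_ n) v * (- sin (dotp v x) * fourier_cos mu v + cos (dotp v x) * fourier_sin mu v)).
    by rewrite /= cosN sinN; ring.
  rewrite linE; congr (_ * _); apply: eq_Rintegral => y _.
  by rewrite dotp_tsub sinB; ring.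
rewrite /inv_fourier /Cintegral; under eq_Rintegral do rewrite ReE.
under [X in _ +i* X]eq_Rintegral do rewrite ImE.
rewrite (gaussd_fubini mu (M := 1) (e_gt0 n) ler01 (measurable_fun_cos (md x))); last first.
  by move=> z; exact: cos_max.
rewrite (gaussd_fubini mu (M := 1) (e_gt0 n) ler01 (measurable_fun_sin (md x))); last first.
  by move=> z; exact: sin_max.
under eq_Rintegral do rewrite /= fourier_gaussd//.
under [X in _ +i* X]eq_Rintegral do rewrite /= fourier_gaussd_sin//.
rewrite RintegralZl//; last exact: integrable_mollify.
rewrite Rintegral_cst// mul0r.
apply/eqP; rewrite eq_complex /= !mul0r !mulr0 subr0 addr0 eqxx andbT.
by rewrite mulKf// gt_eqF.
Qed.

(** The last clause quantifies over all densities, since a local time is determined only up to a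
    null set. *)
Theorem finite_energy_local_time :
  [/\ mu `<< lebn,
    exists l : d.-tuple R -> R, lebn.-integrable setT (EFin \o l) /\
      (forall B, measurable B -> mu B = \int[lebn]_(x in B) (l x)%:E)%E &
    forall l : d.-tuple R -> R, lebn.-integrable setT (EFin \o l) ->
      (forall B, measurable B -> mu B = \int[lebn]_(x in B) (l x)%:E)%E ->
      l \in Lfun lebn 2%:E /\ inv_fourier_L2 fourierC (fun x => (l x)%:C)].
Proof.
have [L [mL L0 Ldist muL]] := finite_energy_density.
have iL : lebn.-integrable setT (EFin \o L).
  apply/integrableP; split; first exact/measurable_EFinP.
  under eq_integral do rewrite /= ger0_norm//.
  by rewrite -muL// ltey_eq fin_num_measure.
split.
- apply/null_content_dominatesP => A mA A0; rewrite muL//.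
  by apply: null_set_integral => //; exact/measurable_funTS/measurable_EFinP.
- by exists L.
move=> l il mul.
have ml : measurable_fun setT l by apply/measurable_EFinP; exact: measurable_int il.
(* Densities of the same measure agree almost everywhere, so the distances from the mollifications
   to [L] carry over to [l]. *)
have lL : ae_eq lebn setT (EFin \o l) (EFin \o L).
  apply: integral_ae_eq => //; first exact/measurable_EFinP.
  by move=> B _ mB; rewrite /= -mul// -muL.
have mmol n : measurable_fun setT (mollify mu (e_ n)) by exact: measurable_mollify.
have ldist n : (\int[lebn]_x ((mollify mu (e_ n) x - l x) ^+ 2)%:E <= (delta n)%:E)%E.
  apply: le_trans (Ldist n); rewrite (@ae_eq_integral _ _ _ lebn _
    (fun x => ((mollify mu (e_ n) x - L x) ^+ 2)%:E))//.
  + by apply/measurable_EFinP; apply: measurable_funX; exact: measurable_funB.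
  + by apply/measurable_EFinP; apply: measurable_funX; exact: measurable_funB.
  + by apply: filterS lL => x /(_ I)/= [->].
have dge n : 0 <= delta n.
  rewrite -lee_fin; apply: le_trans (ldist n).
  by apply: integral_ge0 => x _; rewrite lee_fin sqr_ge0.
have l2 : l \in Lfun lebn 2%:E.
  apply: integrable_sqr_Lfun2 => //.
  (* [l^2 <= 2 (f - l)^2 + 2 f^2], where [f] is the mollification of index [0]; the difference of
     the two sides is [(2 f - l)^2]. *)
  apply: (@le_lt_trans _ _ (\int[lebn]_x (2%:E * ((mollify mu (e_ 0) x - l x) ^+ 2)%:E +
     2%:E * (mollify mu (e_ 0) x * mollify mu (e_ 0) x)%:E))%E).
    apply: ge0_le_integral => //.
    - by move=> x _; rewrite lee_fin sqr_ge0.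
    - by apply/measurable_EFinP; exact: measurable_funX.
    - apply: emeasurable_funD; apply/measurable_EFinP; apply: measurable_funM => //.
        by apply: measurable_funX; exact: measurable_funB.
      exact: measurable_funM.
    - move=> x _; rewrite -!EFinM -EFinD lee_fin.
      have := sqr_ge0 (2 * mollify mu (e_ 0) x - l x); nra.
  rewrite ge0_integralD//; first last.
  - by apply/measurable_EFinP; apply: measurable_funM => //; exact: measurable_funM.
  - by move=> x _; rewrite mule_ge0// lee_fin -expr2 sqr_ge0.
  - apply/measurable_EFinP; apply: measurable_funM => //.
    by apply: measurable_funX; exact: measurable_funB.
  - by move=> x _; rewrite mule_ge0// lee_fin sqr_ge0.
  rewrite ge0_integralZl//; first last.
  - by move=> x _; rewrite lee_fin sqr_ge0.
  - by apply/measurable_EFinP; apply: measurable_funX; exact: measurable_funB.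
  rewrite ge0_integralZl//; first last.
  - by move=> x _; rewrite lee_fin -expr2 sqr_ge0.
  - by apply/measurable_EFinP; exact: measurable_funM.
  rewrite lte_add_pinfty ?lte_mul_pinfty ?integral_ge0//.
  - by apply: le_lt_trans (ldist 0) _; rewrite ltry.
  - exact: (integrable_lty measurableT (integrable_mollifyM mu (e_gt0 0) (e_gt0 0))).
split => //.
have sqr_le (h : d.-tuple R -> R) : measurable_fun setT h ->
    (forall v, h v ^+ 2 <= fourier_sqr mu v) -> h \in Lfun lebn 2%:E.
  move=> mh hle; apply: integrable_sqr_Lfun2 => //.
  apply: le_lt_trans integral_fourier_sqr_lty; apply: ge0_le_integral => //.
  - by move=> v _; rewrite lee_fin sqr_ge0.
  - by apply/measurable_EFinP; exact: measurable_funX.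
  - by apply/measurable_EFinP; exact: measurable_fourier_sqr.
  - by move=> v _; rewrite lee_fin.
have mc := measurable_fourier_cos mu; have ms := measurable_fourier_sin mu.
have mg n : measurable_fun setT (gaussd (e_ n) : d.-tuple R -> R) := measurable_gaussd (e_ n).
have gle (n : nat) (v : d.-tuple R) (x : R) : (gaussd (e_ n) v * x) ^+ 2 <= x ^+ 2.
  by rewrite exprMn ler_piMl ?sqr_ge0// exprn_ile1 ?gaussd_ge0 ?gaussd_le1// ltW.
have cle v : fourier_cos mu v ^+ 2 <= fourier_sqr mu v by rewrite lerDl sqr_ge0.
have sle v : fourier_sin mu v ^+ 2 <= fourier_sqr mu v by rewrite lerDr sqr_ge0.
have ReE n v : complex.Re (fourierC_ n v) = gaussd (e_ n) v * fourier_cos mu v.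
  by rewrite /= mul0r subr0.
have ImE n v : complex.Im (fourierC_ n v) = gaussd (e_ n) v * fourier_sin mu v.
  by rewrite /= mul0r addr0.
have ReE' n : (fun v => complex.Re (fourierC_ n v)) = (fun v => gaussd (e_ n) v * fourier_cos mu v).
  by apply/funext => v; exact: ReE.
have ImE' n : (fun v => complex.Im (fourierC_ n v)) = (fun v => gaussd (e_ n) v * fourier_sin mu v).
  by apply/funext => v; exact: ImE.
split.
- by split; apply: sqr_le.
- split => //=; apply: integrable_sqr_Lfun2 => //.
  by under eq_integral do rewrite expr0n/=; rewrite integral0 ltry.
exists fourierC_; split.
- move=> n; split; split; rewrite ?ReE' ?ImE'.
  + apply/Lfun1_integrable; apply: integrable_gaussd_bounded => // v.
    exact: fourier_cos_le.
  + apply/Lfun1_integrable; apply: integrable_gaussd_bounded => // v.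
    exact: fourier_sin_le.
  + apply: sqr_le; first exact: measurable_funM.
    by move=> v; exact: le_trans (gle _ _ _) (cle v).
  + apply: sqr_le; first exact: measurable_funM.
    by move=> v; exact: le_trans (gle _ _ _) (sle v).
- have normE n v : Normc.normc (fourierC_ n v - fourierC v) =
    Num.sqrt ((1 - gaussd (e_ n) v) ^+ 2 * fourier_sqr mu v).
    rewrite /Normc.normc /fourierC_ /fourierC /= /fourier_sqr; congr Num.sqrt; ring.
  apply: (Lnorm2_cvg0 (r := defect)) => //.
  + move=> n.
    have i := @integrable_defect n (fun=> 1) (measurable_cst _) ltac:(by move=> v; rewrite gaussd_le1 ?lexx// ltW).
    rewrite -[leRHS](_ : \int[lebn]_v ((1 - gaussd (e_ n) v) ^+ 2 * fourier_sqr mu v)%:E = _)%E; last first.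
      by rewrite /defect /Rintegral fineK//; exact: integrable_fin_num i.
    rewrite le_eqVlt; apply/orP; left; apply/eqP; apply: eq_integral => v _.
    by rewrite normE sqr_sqrtr// mulr_ge0 ?sqr_ge0 ?fourier_sqr_ge0.
  + by move=> n; apply: Rintegral_ge0 => v _; rewrite mulr_ge0 ?sqr_ge0 ?fourier_sqr_ge0.
- have normE n x : Normc.normc (inv_fourier (fourierC_ n) x - (l x)%:C) =
    Num.sqrt ((mollify mu (e_ n) x - l x) ^+ 2).
    by rewrite inv_fourierC_ /Normc.normc /=; congr Num.sqrt; ring.
  apply: (Lnorm2_cvg0 (r := delta)) => //.
  move=> n; under eq_integral do rewrite normE sqr_sqrtr ?sqr_ge0//.
  exact: ldist.
Qed.

End finite_energy.

Theorem theorem3p1 (R : realType) (dO : measure_display)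
  (T : measurableType dO) (P : probability T R)
  (F : R -> set (set T)) (d : nat)
  (W : 'I_d -> (R * R -> R) -> T -> R) (u : R -> R -> T -> d.-tuple R)
  (P_complete : measure_is_complete P)
  (F_filtration : right_continuous_filtration F)
  (W_noise : white_noise P F W)
  (u_string : random_string P F W u)
  (d_ge1 : (1 <= d)%N) (d_lt6 : (d < 6)%N)
  (I : set (R * R)) (I_rectangle : rectangle I) :
  {ae P, forall w : T,
    let path := fun t x : R => u t x w in
    [/\ has_local_times path I,
        exists l : d.-tuple R -> R, is_local_time path I l &
        forall l : d.-tuple R -> R, is_local_time path I l ->
          (l : d.-tuple R -> R) \in Lfun (lebesgue_tuple d) 2%:E /\
          inv_fourier_L2 (occupation_fourier path I) (fun x => (l x)%:C)]}.
Proof.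
have [M [A [B [M0 [mA mB] [AM BM] A0 ->]]]] := rectangleP I_rectangle.
have [N [mN PN contN]] := string_continuous u_string.
have cu w : ~ N w -> forall j,
    {within spacetime, continuous (fun z : R * R => tnth (u z.1 z.2 w) j)}.
  by move=> Nw; apply: contrapT => h; exact/Nw/contN.
have NP : {ae P, forall w, ~ N w} by exists N; split => // w /= /contrapT.
have E := limn_einf_string_energy F_filtration W_noise u_string d_lt6 mN PN cu M0 mA mB AM BM A0.
(* From here on the path is fixed and the argument is deterministic: off one null event it is
   continuous and its energies have a finite lower limit. *)
apply: filterS2 NP E => w Nw [K wK].
rewrite (limn_einf_energy_version F_filtration u_string) in wK.
have [dom ex all] := finite_energy_local_time wK.
have occE := occupation_version F_filtration u_string mN cu mA mB AM BM A0 Nw.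
have fouE := occupation_fourier_version F_filtration u_string mN cu mA mB AM BM A0 Nw.
rewrite /has_local_times /is_local_time occE fouE; split => //.
by move=> l [il lE]; exact: all.
Qed.
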